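(* Let $\Bbbk$ be a field of characteristic zero. For a Lie algebra $\mathfrak{g}$ over $\Bbbk$, let $U^{\mathrm{PreLie}}(\mathfrak{g})$ denote its universal enveloping pre-Lie algebra, and let $\mathrm{RT}_{\neq 1}$ be the linear species of rooted trees for which no vertex has exactly one child. Then there is a vector space isomorphism $$U^{\mathrm{PreLie}}(\mathfrak{g})\cong \mathrm{RT}_{\neq 1}(S(\mathfrak{g})),$$ where $S(\mathfrak{g})=\bigoplus_{n\ge 1}S^n(\mathfrak{g})$. Moreover, these isomorphisms can be chosen in a way that is natural with respect to Lie algebra morphisms, i.e. the functors $\mathfrak{g}\mapsto U^{\mathrm{PreLie}}(\mathfrak{g})$ and $\mathfrak{g}\mapsto \mathrm{RT}_{\neq 1}(S(\mathfrak{g}))$ from Lie algebras to vector spaces are naturally isomorphic.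
   Context: A pre-Lie (right-symmetric) algebra is a vector space $V$ with a bilinear operation $\triangleleft$ satisfying $(a_1\triangleleft a_2)\triangleleft a_3 - a_1\triangleleft (a_2\triangleleft a_3)=(a_1\triangleleft a_3)\triangleleft a_2 - a_1\triangleleft (a_3\triangleleft a_2)$. Every pre-Lie algebra is a Lie algebra with respect to $[a_1,a_2]=a_1\triangleleft a_2-a_2\triangleleft a_1$; this defines a functor from pre-Lie algebras to Lie algebras, and $U^{\mathrm{PreLie}}$ is its left adjoint. (Equivalently, $U^{\mathrm{PreLie}}(\mathfrak{g})$ is the quotient of the free pre-Lie algebra on the vector space $\mathfrak{g}$ by the ideal generated by the elements $x\triangleleft y-y\triangleleft x-[x,y]$, $x,y\in\mathfrak{g}$.) For a finite nonempty set $I$, $\mathrm{RT}_{\neq 1}(I)$ is the vector space with basis the (non-planar) rooted trees with vertex set $I$ such that no vertex has exactly one child; $\mathrm{RT}_{\neq 1}(\varnothing)=0$. The one-vertex tree is allowed. A linear species $F$ is evaluated on a vector space $V$ (as a Schur functor) by $F(V)=\bigoplus_{n\ge 0}F(\{1,\ldots,n\})\otimes_{\Bbbk S_n}V^{\otimes n}$. $S^n(\mathfrak g)$ denotes the $n$-th symmetric power of the underlying vector space of $\mathfrak g$. *)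

(* Defs.v *)
From HB Require Import structures.
From mathcomp Require Import all_boot ssrAC perm ssralg ring_quotient boolp.
From mathcomp.multinomials Require Import freeg.

Set Implicit Arguments.
Unset Strict Implicit.
Unset Printing Implicit Defensive.

Import GRing.Theory.
Local Open Scope ring_scope.
Local Open Scope quotient_scope.

Reserved Notation "x ◁ y" (at level 40, left associativity).

Section FreeModule.
Variables (k : fieldType) (X : choiceType).

Definition fgen (x : X) : {freeg X / k} := << x >>.

Lemma freeg_elim (P : {freeg X / k} -> Prop) :
  P 0 -> (forall a x D, P D -> P (a *: fgen x + D)) -> forall D, P D.
Proof.
move=> P0 PD D; rewrite -(freeg_sumE D).
elim: (dom D) => [|x s IH]; first by rewrite big_nil.
rewrite big_cons.
have -> : << coeff x D *g x >> = coeff x D *: fgen x :> {freeg X / k}.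
  by apply/eqP/freeg_eqP => y; rewrite coeffZ !coeffU mul1r.
exact: PD.
Qed.

Variables (M : lmodType k) (f : X -> M).

Lemma fglift_linear : linear (fglift f : {freeg X / k} -> M).
Proof.
pose F : {freeg X / k} -> M := fglift f.
have FB : {morph F : x y / x - y} := lift_is_additive f.
have F0 : F 0 = 0 by rewrite -[0 in LHS](subr0 0) FB subrr.
have FD : {morph F : x y / x + y}.
  by move=> x y; rewrite -[y in LHS]opprK FB -[- y]add0r FB F0 sub0r opprK.
move=> a u v; rewrite -/F FD; congr (_ + _).
have -> : a *: u = \sum_(x <- dom u) << a * coeff x u *g x >> by [].
rewrite -[u in RHS]freeg_sumE.
rewrite !(big_morph F FD F0) scaler_sumr; apply: eq_bigr => x _.
by rewrite /F !liftU scalerA.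
Qed.

HB.instance Definition _ :=
  GRing.isLinear.Build k {freeg X / k} M *:%R (fglift f) fglift_linear.

Lemma fglift_gen x : fglift f (fgen x) = f x.
Proof. by rewrite liftU scale1r. Qed.

End FreeModule.

Lemma freeg_linear_eq (k : fieldType) (X : choiceType) (M : lmodType k)
    (F G : {linear {freeg X / k} -> M}) :
  (forall x, F (fgen k x) = G (fgen k x)) -> F =1 G.
Proof.
move=> FG; apply: freeg_elim => [|a x D IH]; first by rewrite !raddf0.
by rewrite !linearP /= FG IH.
Qed.

Section QuotientBySpan.
Variables (k : fieldType) (V : lmodType k).

Inductive span (R : V -> Prop) : V -> Prop :=
| span_gen v of R v : span R v
| span0 : span R 0
| span_lin a u v of span R u & span R v : span R (a *: u + v).

Variable R : V -> Prop.

Definition in_span : {pred V} := fun v => `[< span R v >].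

Lemma in_span_zmod : zmod_closed in_span.
Proof.
split=> [|u v /asboolP Ru /asboolP Rv]; apply/asboolP; first exact: span0.
by rewrite addrC -scaleN1r; apply: span_lin.
Qed.

HB.instance Definition _ := GRing.isZmodClosed.Build V in_span in_span_zmod.

Definition quot : Type := Quotient.quot in_span.
HB.instance Definition _ := GRing.Zmodule.on quot.

Definition quot_pi (v : V) : quot := \pi_(Quotient.quot in_span) v.

Lemma quot_piP u v : quot_pi u = quot_pi v <-> span R (u - v).
Proof.
split=> [/eqP|Ruv].
  by rewrite -Quotient.idealrBE => /asboolP.
by apply/eqP; rewrite -Quotient.idealrBE; apply/asboolP.
Qed.

Lemma quot_piK (q : quot) : quot_pi (repr q) = q.
Proof. exact: reprK. Qed.

Lemma quot_pi_surj (P : quot -> Prop) : (forall v, P (quot_pi v)) -> forall q, P q.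
Proof. by move=> H q; rewrite -(quot_piK q). Qed.

Lemma quot_piB : {morph quot_pi : u v / u - v}.
Proof. by move=> u v; rewrite /quot_pi !piE. Qed.

Definition quot_scale a (q : quot) : quot := quot_pi (a *: repr q).

Lemma quot_scale_pi a v : quot_scale a (quot_pi v) = quot_pi (a *: v).
Proof.
apply/quot_piP; rewrite -scalerBr -[_ *: _]addr0.
by apply: span_lin (span0 R); apply/quot_piP; rewrite quot_piK.
Qed.

Lemma quot_piD : {morph quot_pi : u v / u + v}.
Proof. by move=> u v; rewrite /quot_pi !piE. Qed.

Fact quot_scalerA a b q : quot_scale a (quot_scale b q) = quot_scale (a * b) q.
Proof. by elim/quot_pi_surj: q => v; rewrite !quot_scale_pi scalerA. Qed.
Fact quot_scale1r : left_id 1 quot_scale.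
Proof. by elim/quot_pi_surj => v; rewrite quot_scale_pi scale1r. Qed.
Fact quot_scalerDr : right_distributive quot_scale +%R.
Proof.
move=> a; elim/quot_pi_surj => u; elim/quot_pi_surj => v.
by rewrite -quot_piD !quot_scale_pi scalerDr quot_piD.
Qed.
Fact quot_scalerDl q : {morph quot_scale^~ q : a b / a + b}.
Proof.
by elim/quot_pi_surj: q => v a b; rewrite !quot_scale_pi scalerDl quot_piD.
Qed.

HB.instance Definition _ := GRing.Zmodule_isLmodule.Build k quot
  quot_scalerA quot_scale1r quot_scalerDr quot_scalerDl.

Fact quot_pi_linear : linear quot_pi.
Proof. by move=> a u v; rewrite quot_piD -quot_scale_pi. Qed.
HB.instance Definition _ :=
  GRing.isLinear.Build k V quot *:%R quot_pi quot_pi_linear.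

Lemma quot_rel v : R v -> quot_pi v = 0.
Proof.
by move=> Rv; rewrite -(raddf0 quot_pi); apply/quot_piP; rewrite subr0; apply: span_gen.
Qed.

Section Lift.
Variables (W : lmodType k) (f : {linear V -> W}).
Hypothesis fR : forall v, R v -> f v = 0.

Definition quot_lift (q : quot) : W := f (repr q).

Lemma span_kill v : span R v -> f v = 0.
Proof.
elim=> [u /fR //||a u w _ fu _ fw]; first exact: raddf0.
by rewrite linearP /= fu fw scaler0 addr0.
Qed.

Let quot_lift_pi0 v : quot_lift (quot_pi v) = f v.
Proof.
apply/eqP; rewrite -subr_eq0 -raddfB; apply/eqP/span_kill.
by apply/quot_piP; rewrite quot_piK.
Qed.

Fact quot_lift_linear : linear quot_lift.
Proof.
move=> a; elim/quot_pi_surj => u; elim/quot_pi_surj => v.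
by rewrite -linearP !quot_lift_pi0 linearP.
Qed.

Definition quot_lin : {linear quot -> W} :=
  HB.pack quot_lift (GRing.isLinear.Build k quot W *:%R quot_lift quot_lift_linear).

Lemma quot_lin_pi v : quot_lin (quot_pi v) = f v.
Proof. exact: quot_lift_pi0. Qed.

End Lift.
End QuotientBySpan.

Section DirectSum.
Variables (k : fieldType) (V : nat -> lmodType k).

Definition finitely_supported (x : forall n, V n) :=
  `[< exists N, forall n, (N <= n)%N -> x n = 0 >].

Record dsum := DSum { dsum_val : forall n, V n; _ : finitely_supported dsum_val }.
HB.instance Definition _ := [isSub for dsum_val].
HB.instance Definition _ := [Choice of dsum by <:].

Lemma dsum_supp (x : dsum) : exists N, forall n, (N <= n)%N -> dsum_val x n = 0.
Proof. by case: x => x /= /asboolP. Qed.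

Lemma dsumP (x y : dsum) : (forall n, dsum_val x n = dsum_val y n) -> x = y.
Proof. by move=> xy; apply/val_inj/functional_extensionality_dep. Qed.

Fact dsum_zero_subproof : finitely_supported (fun n => 0).
Proof. by apply/asboolP; exists 0%N. Qed.
Fact dsum_opp_subproof (x : dsum) : finitely_supported (fun n => - dsum_val x n).
Proof.
have [N xN] := dsum_supp x.
by apply/asboolP; exists N => n /xN ->; rewrite oppr0.
Qed.
Fact dsum_add_subproof (x y : dsum) :
  finitely_supported (fun n => dsum_val x n + dsum_val y n).
Proof.
have [N xN] := dsum_supp x; have [M yM] := dsum_supp y.
apply/asboolP; exists (maxn N M) => n; rewrite geq_max => /andP[/xN -> /yM ->].
by rewrite addr0.
Qed.
Fact dsum_scale_subproof a (x : dsum) :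
  finitely_supported (fun n => a *: dsum_val x n).
Proof.
have [N xN] := dsum_supp x.
by apply/asboolP; exists N => n /xN ->; rewrite scaler0.
Qed.

Definition dsum_zero := DSum dsum_zero_subproof.
Definition dsum_opp x := DSum (dsum_opp_subproof x).
Definition dsum_add x y := DSum (dsum_add_subproof x y).
Definition dsum_scale a x := DSum (dsum_scale_subproof a x).

Fact dsum_addA : associative dsum_add.
Proof. by move=> x y z; apply: dsumP => n; apply: addrA. Qed.
Fact dsum_addC : commutative dsum_add.
Proof. by move=> x y; apply: dsumP => n; apply: addrC. Qed.
Fact dsum_add0 : left_id dsum_zero dsum_add.
Proof. by move=> x; apply: dsumP => n; apply: add0r. Qed.
Fact dsum_addN : left_inverse dsum_zero dsum_opp dsum_add.
Proof. by move=> x; apply: dsumP => n; apply: addNr. Qed.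
HB.instance Definition _ :=
  GRing.isZmodule.Build dsum dsum_addA dsum_addC dsum_add0 dsum_addN.

Fact dsum_scaleA a b x : dsum_scale a (dsum_scale b x) = dsum_scale (a * b) x.
Proof. by apply: dsumP => n; apply: scalerA. Qed.
Fact dsum_scale1 : left_id 1 dsum_scale.
Proof. by move=> x; apply: dsumP => n; apply: scale1r. Qed.
Fact dsum_scaleDr : right_distributive dsum_scale +%R.
Proof. by move=> a x y; apply: dsumP => n; apply: scalerDr. Qed.
Fact dsum_scaleDl x : {morph dsum_scale^~ x : a b / a + b}.
Proof. by move=> a b; apply: dsumP => n; apply: scalerDl. Qed.
HB.instance Definition _ := GRing.Zmodule_isLmodule.Build k dsum
  dsum_scaleA dsum_scale1 dsum_scaleDr dsum_scaleDl.

End DirectSum.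

Section DirectSumMap.
Variables (k : fieldType) (V W : nat -> lmodType k).
Variable f : forall n, {linear V n -> W n}.

Fact dsum_map_subproof (x : dsum V) :
  finitely_supported (fun n => f n (dsum_val x n)).
Proof.
have [N xN] := dsum_supp x.
by apply/asboolP; exists N => n /xN ->; rewrite raddf0.
Qed.

Definition dsum_map x : dsum W := DSum (dsum_map_subproof x).

Fact dsum_map_linear : linear dsum_map.
Proof. by move=> a x y; apply: dsumP => n; apply: linearP. Qed.
HB.instance Definition _ :=
  GRing.isLinear.Build k (dsum V) (dsum W) *:%R dsum_map dsum_map_linear.

End DirectSumMap.

Section TensorPower.
Variables (k : fieldType) (n : nat).

Section Def.
Variable V : lmodType k.

Definition update (v : {ffun 'I_n -> V}) i x : {ffun 'I_n -> V} :=
  [ffun j => if j == i then x else v j].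

Inductive multilinearity : {freeg {ffun 'I_n -> V} / k} -> Prop :=
| MultiLinearity v i a x y :
    multilinearity (fgen k (update v i (a *: x + y))
                    - (a *: fgen k (update v i x) + fgen k (update v i y))).

Definition tpow : lmodType k := quot multilinearity.

Definition tpure (v : {ffun 'I_n -> V}) : tpow := quot_pi multilinearity (fgen k v).

Definition multilinear (W : lmodType k) (phi : {ffun 'I_n -> V} -> W) :=
  forall v i a x y,
    phi (update v i (a *: x + y)) = a *: phi (update v i x) + phi (update v i y).

Lemma tpure_multilinear : multilinear tpure.
Proof.
move=> v i a x y; rewrite /tpure -linearP.
by apply/eqP; rewrite -subr_eq0 -raddfB; apply/eqP/quot_rel.
Qed.

Section Lift.
Variables (W : lmodType k) (phi : {ffun 'I_n -> V} -> W).
Hypothesis phiP : multilinear phi.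

Fact tpow_lift_subproof D : multilinearity D -> fglift phi D = 0.
Proof.
by case=> v i a x y; rewrite linearB linearP /= !fglift_gen phiP subrr.
Qed.

Definition tpow_lift : {linear tpow -> W} := quot_lin tpow_lift_subproof.

Lemma tpow_lift_pure v : tpow_lift (tpure v) = phi v.
Proof. by rewrite quot_lin_pi /= fglift_gen. Qed.

End Lift.

Lemma tpow_linear_eq (W : lmodType k) (F G : {linear tpow -> W}) :
  (forall v, F (tpure v) = G (tpure v)) -> F =1 G.
Proof.
move=> FG; elim/quot_pi_surj.
exact: (@freeg_linear_eq _ _ _ (F \o quot_pi _)%FUN (G \o quot_pi _)%FUN).
Qed.

Fact tpow_perm_subproof (s : {perm 'I_n}) :
  multilinear (fun v => tpure [ffun i => v (s i)]).
Proof.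
have E v i x : [ffun j => update v i x (s j)]
                = update [ffun j => v (s j)] (s^-1%g i) x.
  by apply/ffunP => j; rewrite !ffunE (can2_eq (permK s) (permKV s)).
by move=> v i a x y; rewrite !E tpure_multilinear.
Qed.

(* [perm] composes as [(s * t) i = t (s i)], so this is a left action. *)
Definition tpow_perm s : {linear tpow -> tpow} := tpow_lift (tpow_perm_subproof s).

Lemma tpow_perm_pure s v : tpow_perm s (tpure v) = tpure [ffun i => v (s i)].
Proof. exact: tpow_lift_pure. Qed.

End Def.

Section Map.
Variables (V W : lmodType k) (f : {linear V -> W}).

Fact tpow_map_subproof : multilinear (fun v => tpure [ffun i => f (v i)]).
Proof.
have E v i x : [ffun j => f (update v i x j)] = update [ffun j => f (v j)] i (f x).
  by apply/ffunP => j; rewrite !ffunE; case: ifP.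
by move=> v i a x y; rewrite !E linearP tpure_multilinear.
Qed.

Definition tpow_map : {linear tpow V -> tpow W} := tpow_lift tpow_map_subproof.

Lemma tpow_map_pure v : tpow_map (tpure v) = tpure [ffun i => f (v i)].
Proof. exact: tpow_lift_pure. Qed.

Lemma tpow_map_perm s t : tpow_map (tpow_perm V s t) = tpow_perm W s (tpow_map t).
Proof.
apply: (@tpow_linear_eq _ _ (tpow_map \o tpow_perm V s)%FUN (tpow_perm W s \o tpow_map)%FUN).
move=> v; change (tpow_map (tpow_perm V s (tpure v)) = tpow_perm W s (tpow_map (tpure v))).
rewrite tpow_perm_pure !tpow_map_pure tpow_perm_pure.
by congr tpure; apply/ffunP => i; rewrite !ffunE.
Qed.

End Map.
End TensorPower.

Section SymmetricPower.
Variable k : fieldType.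

Inductive sym_rel n (V : lmodType k) : tpow n V -> Prop :=
| SymRel (s : {perm 'I_n}) t : sym_rel (tpow_perm V s t - t).

(* Coinvariants of the symmetric group acting on the tensor power. *)
Definition sympow n V : lmodType k := quot (@sym_rel n V).

Section Map.
Variables (V W : lmodType k) (f : {linear V -> W}).

Fact sympow_map_subproof n t :
  sym_rel t -> (quot_pi (@sym_rel n W) \o tpow_map n f)%FUN t = 0.
Proof.
case=> s u; apply: quot_rel; rewrite linearB.
by rewrite (tpow_map_perm f s u).
Qed.

Definition sympow_map n : {linear sympow n V -> sympow n W} :=
  quot_lin (@sympow_map_subproof n).

End Map.

Definition sym_plus (V : lmodType k) : lmodType k := dsum (fun n => sympow n.+1 V).

Definition sym_plus_map (V W : lmodType k) (f : {linear V -> W}) :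
    {linear sym_plus V -> sym_plus W} :=
  dsum_map (fun n => sympow_map f n.+1).

End SymmetricPower.

(* Tensor product over a group algebra: [rho] is a right action on [M] and
   [lam] a left action on [N]. *)
Section BalancedTensor.
Variables (k : fieldType) (G : Type).

Section Def.
Variables (M N : lmodType k) (rho : G -> M -> M) (lam : G -> N -> N).

Inductive tensor_rel : {freeg (M * N)%type / k} -> Prop :=
| TensorLinl a x y z :
    tensor_rel (fgen k (a *: x + y, z) - (a *: fgen k (x, z) + fgen k (y, z)))
| TensorLinr a x y z :
    tensor_rel (fgen k (x, a *: y + z) - (a *: fgen k (x, y) + fgen k (x, z)))
| TensorBalanced g x y :
    tensor_rel (fgen k (rho g x, y) - fgen k (x, lam g y)).

Definition tensor : lmodType k := quot tensor_rel.

Definition tensor_pure (x : M) (y : N) : tensor := quot_pi tensor_rel (fgen k (x, y)).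

Lemma tensor_pure_linl a x y z :
  tensor_pure (a *: x + y) z = a *: tensor_pure x z + tensor_pure y z.
Proof.
apply/eqP; rewrite /tensor_pure -subr_eq0 -linearP -linearB.
by apply/eqP/quot_rel/TensorLinl.
Qed.

Lemma tensor_pure_linr a x y z :
  tensor_pure x (a *: y + z) = a *: tensor_pure x y + tensor_pure x z.
Proof.
apply/eqP; rewrite /tensor_pure -subr_eq0 -linearP -linearB.
by apply/eqP/quot_rel/TensorLinr.
Qed.

Lemma tensor_pure_balanced g x y : tensor_pure (rho g x) y = tensor_pure x (lam g y).
Proof.
apply/eqP; rewrite /tensor_pure -subr_eq0 -linearB.
by apply/eqP/quot_rel/TensorBalanced.
Qed.

End Def.

Section Map.
Variables (M N N' : lmodType k) (rho : G -> M -> M).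
Variables (lam : G -> N -> N) (lam' : G -> N' -> N').
Variables (f : {linear N -> N'}).
Hypothesis fP : forall g y, f (lam g y) = lam' g (f y).

Fact tensor_map_subproof D :
  tensor_rel rho lam D -> fglift (fun u => tensor_pure rho lam' u.1 (f u.2)) D = 0.
Proof.
case=> [a x y z|a x y z|h x y]; rewrite linearB ?linearP /= !fglift_gen /=.
- by rewrite tensor_pure_linl scalerN -opprD subrr.
- by rewrite linearP tensor_pure_linr scalerN -opprD subrr.
- by rewrite fP tensor_pure_balanced subrr.
Qed.

Definition tensor_map : {linear tensor rho lam -> tensor rho lam'} :=
  quot_lin tensor_map_subproof.

Lemma tensor_map_pure x y :
  tensor_map (tensor_pure rho lam x y) = tensor_pure rho lam' x (f y).
Proof. by rewrite quot_lin_pi /= fglift_gen. Qed.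

End Map.
End BalancedTensor.

Section Species.
Variable k : fieldType.

Record linear_species := LinearSpecies {
  sp_obj :> finType -> lmodType k;
  sp_map : forall (I J : finType) (f : I -> J),
    bijective f -> {linear sp_obj I -> sp_obj J};
  sp_map_id : forall (I : finType) (fb : bijective (@id I)) x, sp_map fb x = x;
  sp_map_comp : forall (I J K : finType) (f : I -> J) (g : J -> K)
    (fb : bijective f) (gb : bijective g) (gfb : bijective (g \o f)) x,
    sp_map gfb x = sp_map gb (sp_map fb x) }.

Variable F : linear_species.

(* As [perm] composes as [(s * t) i = t (s i)], this is a right action. *)
Definition sp_perm n (s : {perm 'I_n}) : F 'I_n -> F 'I_n :=
  sp_map F (injF_bij (@perm_inj _ s)).

Definition schur (V : lmodType k) : lmodType k :=
  dsum (fun n => tensor (@sp_perm n) (fun s => tpow_perm V s)).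

Definition schur_map (V W : lmodType k) (f : {linear V -> W}) :
    {linear schur V -> schur W} :=
  dsum_map (fun n => tensor_map (@sp_perm n) (@tpow_map_perm k n V W f)).

End Species.

(* A rooted tree on the vertex set [I] is encoded by its parent function, which
   is [None] at the root only. *)
Section RootedTrees.
Variable I : finType.
Implicit Types p : {ffun I -> option I}.

Definition child_of p : rel I := fun x y => p x == Some y.

Definition is_rooted_tree p :=
  [exists r, (p r == None) && [forall x, connect (child_of p) x r]].

Definition children p x := [set y | child_of p y x].

Definition no_unary_vertex p := [forall x, #|children p x| != 1%N].

Definition rtree_ne1 :=
  {p : {ffun I -> option I} | is_rooted_tree p && no_unary_vertex p}.

End RootedTrees.

Section Relabel.
Variables (I J : finType) (f : I -> J).

Definition relabel (p : {ffun I -> option I}) : {ffun J -> option J} :=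
  [ffun j => obind (fun i => omap f (p i)) [pick i | f i == j]].

Hypothesis fb : bijective f.

Lemma relabelE p i : relabel p (f i) = omap f (p i).
Proof.
rewrite ffunE; case: pickP => [i' /eqP /(bij_inj fb) -> //|/(_ i)].
by rewrite eqxx.
Qed.

Lemma child_of_relabel p x y :
  child_of (relabel p) (f x) (f y) = child_of p x y.
Proof.
rewrite /child_of relabelE; case: (p x) => //= z.
by apply/eqP/eqP => [[/(bij_inj fb) ->]|[->]].
Qed.

Lemma relabel_tree p :
  is_rooted_tree p && no_unary_vertex p ->
  is_rooted_tree (relabel p) && no_unary_vertex (relabel p).
Proof.
have [g fK gK] := fb.
case/andP=> /existsP[r /andP[/eqP pr /forallP rP]] /forallP uP.
apply/andP; split.
  apply/existsP; exists (f r); rewrite relabelE pr eqxx /=.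
  apply/forallP => x; rewrite -[x]gK.
  case/connectP: (rP (g x)) => s; elim: s (g x) => [|y s IH] z /=.
    by move=> _ ->; apply: connect0.
  case/andP=> zy ys rE; apply: connect_trans (IH _ ys rE).
  by apply: connect1; rewrite child_of_relabel.
apply/forallP => x; rewrite -[x]gK.
suff -> : children (relabel p) (f (g x)) = f @: children p (g x).
  by rewrite card_imset //; apply: can_inj fK.
apply/setP => y; rewrite -[y]gK mem_imset; last exact: can_inj fK.
by rewrite !inE child_of_relabel.
Qed.

Definition rtree_relabel (t : rtree_ne1 I) : rtree_ne1 J :=
  exist _ (relabel (val t)) (relabel_tree (valP t)).

End Relabel.

Section RTSpecies.
Variable k : fieldType.

Definition RT_obj (I : finType) : lmodType k := {freeg (rtree_ne1 I) / k}.

Definition RT_map (I J : finType) (f : I -> J) (fb : bijective f) :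
    {linear RT_obj I -> RT_obj J} :=
  fglift (fun t => fgen k (rtree_relabel fb t)).

Fact RT_map_id (I : finType) (fb : bijective (@id I)) x : RT_map fb x = x.
Proof.
apply: (@freeg_linear_eq _ _ _ (RT_map fb) idfun) => t /=.
rewrite fglift_gen; congr fgen; apply/val_inj/ffunP => i /=.
by rewrite -[i]/(id i) relabelE //=; case: (sval t _).
Qed.

Fact RT_map_comp (I J K : finType) (f : I -> J) (g : J -> K)
    (fb : bijective f) (gb : bijective g) (gfb : bijective (g \o f)) x :
  RT_map gfb x = RT_map gb (RT_map fb x).
Proof.
apply: (@freeg_linear_eq _ _ _ (RT_map gfb) (RT_map gb \o RT_map fb)%FUN) => t /=.
rewrite !fglift_gen; congr fgen; apply/val_inj/ffunP => j /=.
have [h _ hK] := gfb; rewrite -[j]hK relabelE //= !relabelE //.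
by case: (sval t _).
Qed.

Definition RT_ne1 : linear_species k := LinearSpecies RT_map_id RT_map_comp.

End RTSpecies.

HB.mixin Record isLie (k : fieldType) V of GRing.Lmodule k V := {
  lieb : V -> V -> V;
  lieb_linl : forall a x y z, lieb (a *: x + y) z = a *: lieb x z + lieb y z;
  lieb_linr : forall a x y z, lieb x (a *: y + z) = a *: lieb x y + lieb x z;
  lieb_alt : forall x, lieb x x = 0;
  lieb_jacobi : forall x y z,
    lieb x (lieb y z) + lieb y (lieb z x) + lieb z (lieb x y) = 0 }.

#[short(type="lieType")]
HB.structure Definition Lie (k : fieldType) :=
  { V of GRing.Lmodule k V & isLie k V }.

Definition lie_morphism (k : fieldType) (g h : lieType k) (f : g -> h) :=
  forall x y, f (lieb x y) = lieb (f x) (f y).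

HB.mixin Record hasBilinearProduct (k : fieldType) V of GRing.Lmodule k V := {
  bprod : V -> V -> V;
  bprod_linl : forall a x y z, bprod (a *: x + y) z = a *: bprod x z + bprod y z;
  bprod_linr : forall a x y z, bprod x (a *: y + z) = a *: bprod x y + bprod x z }.

#[short(type="naAlgType")]
HB.structure Definition NonAssocAlgebra (k : fieldType) :=
  { V of GRing.Lmodule k V & hasBilinearProduct k V }.

Notation "x ◁ y" := (bprod x y) : ring_scope.

HB.mixin Record isPreLie (k : fieldType) V of NonAssocAlgebra k V := {
  right_symmetric : forall x y z : V,
    (x ◁ y) ◁ z - x ◁ (y ◁ z) = (x ◁ z) ◁ y - x ◁ (z ◁ y) }.

#[short(type="preLieType")]
HB.structure Definition PreLie (k : fieldType) :=
  { V of NonAssocAlgebra k V & isPreLie k V }.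

Section BilinearProduct.
Variables (k : fieldType) (A : naAlgType k).
Implicit Types x y z : A.

Lemma bprodDl x y z : (x + y) ◁ z = x ◁ z + y ◁ z.
Proof. by rewrite -[x]scale1r bprod_linl !scale1r. Qed.
Lemma bprodDr x y z : x ◁ (y + z) = x ◁ y + x ◁ z.
Proof. by rewrite -[y]scale1r bprod_linr !scale1r. Qed.
Lemma bprod0l z : (0 : A) ◁ z = 0.
Proof. by apply: (addrI (0 ◁ z)); rewrite -bprodDl !addr0. Qed.
Lemma bprod0r z : z ◁ (0 : A) = 0.
Proof. by apply: (addrI (z ◁ 0)); rewrite -bprodDr !addr0. Qed.
Lemma bprodNl x y : (- x) ◁ y = - (x ◁ y).
Proof. by apply: (addrI (x ◁ y)); rewrite -bprodDl !subrr bprod0l. Qed.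
Lemma bprodNr x y : x ◁ (- y) = - (x ◁ y).
Proof. by apply: (addrI (x ◁ y)); rewrite -bprodDr !subrr bprod0r. Qed.
Lemma bprodBl x y z : (x - y) ◁ z = x ◁ z - y ◁ z.
Proof. by rewrite bprodDl bprodNl. Qed.
Lemma bprodBr x y z : x ◁ (y - z) = x ◁ y - x ◁ z.
Proof. by rewrite bprodDr bprodNr. Qed.

End BilinearProduct.

(* An alias, since the Lie bracket of a pre-Lie algebra is not its product. *)
Definition lie_of (k : fieldType) (A : preLieType k) : Type := A.

Section LieOfPreLie.
Variables (k : fieldType) (A : preLieType k).

HB.instance Definition _ := GRing.Lmodule.on (lie_of A).

Definition commutator (x y : lie_of A) : lie_of A := (x : A) ◁ y - (y : A) ◁ x.

Fact commutator_linl a x y z :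
  commutator (a *: x + y) z = a *: commutator x z + commutator y z.
Proof.
rewrite /commutator (@bprod_linl _ A) (@bprod_linr _ A) scalerBr.
by rewrite opprD addrACA.
Qed.
Fact commutator_linr a x y z :
  commutator x (a *: y + z) = a *: commutator x y + commutator x z.
Proof.
rewrite /commutator (@bprod_linl _ A) (@bprod_linr _ A) scalerBr.
by rewrite opprD addrACA.
Qed.
Fact commutator_alt x : commutator x x = 0.
Proof. exact: subrr. Qed.
Fact commutator_jacobi x y z :
  commutator x (commutator y z) + commutator y (commutator z x)
    + commutator z (commutator x y) = 0.
Proof.
rewrite /commutator !(@bprodBl _ A) !(@bprodBr _ A).
have RS (u v w : A) : ((u ◁ w) ◁ v - u ◁ (w ◁ v)) + (u ◁ (v ◁ w) - (u ◁ v) ◁ w) = 0.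
  by rewrite -right_symmetric -[X in _ + X]opprB subrr.
rewrite !opprB !addrA.
rewrite [LHS](ACl (((7*2)*(1*12))*((11*6)*(5*4))*((3*10)*(9*8))))/=.
by rewrite !RS !addr0.
Qed.

HB.instance Definition _ := isLie.Build k (lie_of A)
  commutator_linl commutator_linr commutator_alt commutator_jacobi.

End LieOfPreLie.

Section AlgebraQuotient.
Variables (k : fieldType) (A : naAlgType k).

Inductive ideal (R : A -> Prop) : A -> Prop :=
| ideal_gen x of R x : ideal R x
| ideal0 : ideal R 0
| ideal_lin a x y of ideal R x & ideal R y : ideal R (a *: x + y)
| ideal_mull x y of ideal R y : ideal R (x ◁ y)
| ideal_mulr x y of ideal R x : ideal R (x ◁ y).

Variable R : A -> Prop.

Definition alg_quot : Type := quot (ideal R).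
HB.instance Definition _ := GRing.Lmodule.on alg_quot.

Definition alg_pi : {linear A -> alg_quot} := quot_pi (ideal R).

Lemma alg_piP x y : alg_pi x = alg_pi y <-> ideal R (x - y).
Proof.
split=> [/quot_piP|Rxy]; last by apply/quot_piP; apply: span_gen.
by elim=> //; [apply: ideal0|move=> *; apply: ideal_lin].
Qed.

Definition alg_quot_mul (x y : alg_quot) : alg_quot := alg_pi (repr x ◁ repr y).

Lemma alg_quot_mul_pi x y : alg_quot_mul (alg_pi x) (alg_pi y) = alg_pi (x ◁ y).
Proof.
have E z : ideal R (repr (alg_pi z) - z).
  by apply/alg_piP; apply: quot_piK.
apply/alg_piP; set x' := repr _; set y' := repr _.
have -> : x' ◁ y' - x ◁ y = 1 *: ((x' - x) ◁ y') + x ◁ (y' - y).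
  by rewrite scale1r bprodBl bprodBr addrA subrK.
by apply: ideal_lin; [apply/ideal_mulr/E|apply/ideal_mull/E].
Qed.

Lemma alg_pi_surj (P : alg_quot -> Prop) :
  (forall v, P (alg_pi v)) -> forall q, P q.
Proof. exact: quot_pi_surj. Qed.

Fact alg_quot_linl a x y z :
  alg_quot_mul (a *: x + y) z = a *: alg_quot_mul x z + alg_quot_mul y z.
Proof.
elim/alg_pi_surj: x => x; elim/alg_pi_surj: y => y; elim/alg_pi_surj: z => z.
by rewrite -linearP !alg_quot_mul_pi bprod_linl linearP.
Qed.
Fact alg_quot_linr a x y z :
  alg_quot_mul x (a *: y + z) = a *: alg_quot_mul x y + alg_quot_mul x z.
Proof.
elim/alg_pi_surj: x => x; elim/alg_pi_surj: y => y; elim/alg_pi_surj: z => z.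
by rewrite -linearP !alg_quot_mul_pi bprod_linr linearP.
Qed.

HB.instance Definition _ :=
  hasBilinearProduct.Build k alg_quot alg_quot_linl alg_quot_linr.

Lemma alg_piM x y : alg_pi (x ◁ y) = alg_pi x ◁ alg_pi y.
Proof. by rewrite -alg_quot_mul_pi. Qed.

Lemma alg_piB x y : alg_pi (x - y) = alg_pi x - alg_pi y.
Proof. exact: raddfB. Qed.

Lemma alg_rel x : R x -> alg_pi x = 0.
Proof. by move=> Rx; apply: quot_rel; apply: ideal_gen. Qed.

Section Lift.
Variables (B : naAlgType k) (f : {linear A -> B}).
Hypothesis fM : forall x y, f (x ◁ y) = f x ◁ f y.
Hypothesis fR : forall x, R x -> f x = 0.

Fact alg_lift_subproof x : ideal R x -> f x = 0.
Proof.
elim=> [y /fR//||a y z _ fy _ fz|y z _ fz|y z _ fy]; first exact: raddf0.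
- by rewrite linearP /= fy fz scaler0 addr0.
- by rewrite fM fz bprod0r.
- by rewrite fM fy bprod0l.
Qed.

Definition alg_lift : {linear alg_quot -> B} := quot_lin alg_lift_subproof.

Lemma alg_lift_pi x : alg_lift (alg_pi x) = f x.
Proof. exact: quot_lin_pi. Qed.

Lemma alg_liftM x y : alg_lift (x ◁ y) = alg_lift x ◁ alg_lift y.
Proof.
elim/alg_pi_surj: x => x; elim/alg_pi_surj: y => y.
by rewrite -alg_piM !alg_lift_pi fM.
Qed.

End Lift.
End AlgebraQuotient.

Section PreLieQuotient.
Variables (k : fieldType) (A : preLieType k) (R : A -> Prop).

Fact alg_quot_right_symmetric (x y z : alg_quot R) :
  (x ◁ y) ◁ z - x ◁ (y ◁ z) = (x ◁ z) ◁ y - x ◁ (z ◁ y).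
Proof.
elim/alg_pi_surj: x => x; elim/alg_pi_surj: y => y; elim/alg_pi_surj: z => z.
by rewrite -!alg_piM -!alg_piB right_symmetric.
Qed.
HB.instance Definition _ := isPreLie.Build k (alg_quot R) alg_quot_right_symmetric.

End PreLieQuotient.

Inductive magma (X : Type) := Leaf of X | Node of magma X & magma X.
HB.instance Definition _ (X : Type) := gen_eqMixin (magma X).
HB.instance Definition _ (X : Type) := gen_choiceMixin (magma X).

Section FreeNonAssoc.
Variables (k : fieldType) (X : Type).

Definition free_na : Type := {freeg (magma X) / k}.
HB.instance Definition _ := GRing.Lmodule.on free_na.

Definition free_na_var (x : X) : free_na := fgen k (Leaf x).

Definition free_na_mul (u v : free_na) : free_na :=
  fglift (fun s => fglift (fun t => fgen k (Node s t)) v) u.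

Fact free_na_linl a u v w :
  free_na_mul (a *: u + v) w = a *: free_na_mul u w + free_na_mul v w.
Proof. exact: linearP. Qed.
Fact free_na_linr a u v w :
  free_na_mul u (a *: v + w) = a *: free_na_mul u v + free_na_mul u w.
Proof.
rewrite /free_na_mul; elim/freeg_elim: u => [|b s u IH].
  by rewrite !raddf0 addr0.
rewrite !linearP /= !fglift_gen linearP /= IH !scalerDr !scalerA.
by rewrite addrACA [b * a]mulrC.
Qed.
HB.instance Definition _ :=
  hasBilinearProduct.Build k free_na free_na_linl free_na_linr.

Section Lift.
Variables (A : naAlgType k) (h : X -> A).

Fixpoint magma_eval (t : magma X) : A :=
  match t with Leaf x => h x | Node s t => magma_eval s ◁ magma_eval t end.

Definition free_na_lift : {linear free_na -> A} := fglift magma_eval.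

Lemma free_na_lift_var x : free_na_lift (free_na_var x) = h x.
Proof. exact: fglift_gen. Qed.

Lemma free_na_liftM u v :
  free_na_lift (u ◁ v) = free_na_lift u ◁ free_na_lift v.
Proof.
elim/freeg_elim: u => [|a s u IHu]; first by rewrite bprod0l raddf0 bprod0l.
rewrite bprod_linl !linearP /= IHu bprod_linl; congr (_ *: _ + _) => {u IHu}.
elim/freeg_elim: v => [|b t v IHv]; first by rewrite bprod0r raddf0 bprod0r.
rewrite bprod_linr !linearP /= IHv bprod_linr; congr (_ *: _ + _).
by rewrite [_ ◁ _ in LHS]/(free_na_mul _ _) /free_na_mul !fglift_gen.
Qed.

End Lift.

Lemma free_na_ext (A : naAlgType k) (F G : {linear free_na -> A}) :
  (forall u v, F (u ◁ v) = F u ◁ F v) -> (forall u v, G (u ◁ v) = G u ◁ G v) ->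
  (forall x, F (free_na_var x) = G (free_na_var x)) -> F =1 G.
Proof.
move=> FM GM FG; apply: freeg_linear_eq; elim=> [x|s IHs t IHt]; first exact: FG.
have -> : fgen k (Node s t) = (fgen k s : free_na) ◁ (fgen k t : free_na).
  by rewrite [RHS]/(free_na_mul _ _) /free_na_mul !fglift_gen.
by rewrite FM GM IHs IHt.
Qed.

End FreeNonAssoc.

Section FreePreLie.
Variables (k : fieldType) (V : lmodType k).

Inductive free_prelie_rel : free_na k V -> Prop :=
| FreePreLieLin a x y :
    free_prelie_rel (free_na_var k (a *: x + y)
                     - (a *: free_na_var k x + free_na_var k y))
| FreePreLieSym u v w :
    free_prelie_rel (((u ◁ v) ◁ w - u ◁ (v ◁ w)) - ((u ◁ w) ◁ v - u ◁ (w ◁ v))).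

Definition free_prelie : Type := alg_quot free_prelie_rel.
HB.instance Definition _ := NonAssocAlgebra.on free_prelie.

Fact free_prelie_right_symmetric (x y z : free_prelie) :
  (x ◁ y) ◁ z - x ◁ (y ◁ z) = (x ◁ z) ◁ y - x ◁ (z ◁ y).
Proof.
elim/alg_pi_surj: x => x; elim/alg_pi_surj: y => y; elim/alg_pi_surj: z => z.
have /eqP := alg_rel (FreePreLieSym x y z).
by rewrite !alg_piB subr_eq0 !alg_piM => /eqP.
Qed.
HB.instance Definition _ := isPreLie.Build k free_prelie free_prelie_right_symmetric.

Definition free_prelie_var (x : V) : free_prelie :=
  alg_pi free_prelie_rel (free_na_var k x).

Fact free_prelie_var_linear : linear free_prelie_var.
Proof.
move=> a x y; rewrite /free_prelie_var -linearP.
by apply/eqP; rewrite -subr_eq0 -raddfB; apply/eqP/alg_rel; apply: FreePreLieLin.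
Qed.
HB.instance Definition _ := GRing.isLinear.Build k V free_prelie *:%R
  free_prelie_var free_prelie_var_linear.

Section Lift.
Variables (A : preLieType k) (h : {linear V -> A}).

Fact free_prelie_lift_subproof u : free_prelie_rel u -> free_na_lift h u = 0.
Proof.
have LB : {morph free_na_lift h : v w / v - w} := raddfB _.
case=> [a x y|u' v w]; rewrite !LB.
  by rewrite [X in _ - X]linearP !free_na_lift_var linearP subrr.
by rewrite !free_na_liftM right_symmetric subrr.
Qed.

Definition free_prelie_lift : {linear free_prelie -> A} :=
  alg_lift (free_na_liftM h) free_prelie_lift_subproof.

Lemma free_prelie_lift_var x : free_prelie_lift (free_prelie_var x) = h x.
Proof. by rewrite alg_lift_pi free_na_lift_var. Qed.

Lemma free_prelie_liftM x y :
  free_prelie_lift (x ◁ y) = free_prelie_lift x ◁ free_prelie_lift y.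
Proof. exact: alg_liftM. Qed.

End Lift.
End FreePreLie.

Section EnvelopingPreLie.
Variable k : fieldType.

Section Def.
Variable g : lieType k.

Inductive bracket_rel : free_prelie g -> Prop :=
| BracketRel x y :
    bracket_rel (free_prelie_var x ◁ free_prelie_var y
                 - free_prelie_var y ◁ free_prelie_var x
                 - free_prelie_var (lieb x y)).

Definition UPreLie : preLieType k := alg_quot bracket_rel.

Definition UPreLie_unit : {linear g -> lie_of UPreLie} :=
  (alg_pi bracket_rel \o @free_prelie_var k g)%FUN.

Lemma UPreLie_unit_lie : lie_morphism UPreLie_unit.
Proof.
move=> x y; have /eqP := alg_rel (BracketRel x y).
by rewrite !alg_piB !alg_piM subr_eq0 => /eqP /esym.
Qed.

Section Lift.
Variables (A : preLieType k) (h : {linear g -> lie_of A}).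
Hypothesis hL : lie_morphism h.

Fact UPreLie_lift_subproof u :
  bracket_rel u -> free_prelie_lift (h : {linear g -> A}) u = 0.
Proof.
have LB : {morph free_prelie_lift (h : {linear g -> A}) : v w / v - w} := raddfB _.
case=> x y; rewrite !LB !free_prelie_liftM !free_prelie_lift_var hL.
exact: (subrr (commutator (h x) (h y))).
Qed.

Definition UPreLie_lift : {linear UPreLie -> A} :=
  alg_lift (free_prelie_liftM (h : {linear g -> A})) UPreLie_lift_subproof.

End Lift.
End Def.

(* [UPreLie] is left adjoint to [lie_of]. *)
Lemma UPreLie_universal (g : lieType k) (A : preLieType k)
    (h : {linear g -> lie_of A}) (hL : lie_morphism h) :
  [/\ forall x y, UPreLie_lift hL (x ◁ y) = UPreLie_lift hL x ◁ UPreLie_lift hL y,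
      forall x, UPreLie_lift hL (UPreLie_unit g x) = h x
    & forall F : {linear UPreLie g -> A},
        (forall x y, F (x ◁ y) = F x ◁ F y) ->
        (forall x, F (UPreLie_unit g x) = h x) -> F =1 UPreLie_lift hL].
Proof.
have LM : forall x y,
    UPreLie_lift hL (x ◁ y) = UPreLie_lift hL x ◁ UPreLie_lift hL y.
  by move=> x y; apply: alg_liftM.
have Lu x : UPreLie_lift hL (UPreLie_unit g x) = h x.
  by rewrite /UPreLie_lift alg_lift_pi free_prelie_lift_var.
split=> // F FM Fu; elim/alg_pi_surj; elim/alg_pi_surj.
pose pi := (alg_pi (@bracket_rel g) \o alg_pi (@free_prelie_rel k g))%FUN.
apply: (@free_na_ext _ _ _ (F \o pi)%FUN (UPreLie_lift hL \o pi)%FUN).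
- by move=> u v; rewrite -FM -!alg_piM.
- by move=> u v; rewrite -LM -!alg_piM.
- by move=> x; apply: etrans (Fu x) (esym (Lu x)).
Qed.

Section Map.
Variables (g h : lieType k) (f : {linear g -> h}).
Hypothesis fL : lie_morphism f.

Fact UPreLie_map_subproof : lie_morphism (UPreLie_unit h \o f)%FUN.
Proof. by move=> x y; exact: etrans (congr1 (UPreLie_unit h) (fL x y)) (UPreLie_unit_lie _ _). Qed.

Definition UPreLie_map : {linear UPreLie g -> UPreLie h} :=
  UPreLie_lift UPreLie_map_subproof.

End Map.
End EnvelopingPreLie.

(* Main.v *)
(* Let [T] be [RT_ne1 (S g)] and [a{c1,...,cn}] the symmetric brace.  By PBW,
   [S g] is identified with the augmentation ideal of [U(g)], which acts on the
   unit adjoined to [UPreLie g] on the right; folding a tree with [w{c1,...,cn}]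
   at each vertex, for [w] its label so viewed in [UPreLie g], gives a map
   [Psi : T -> UPreLie g], which is natural.

   Left inverse: the would-be unary node [w{t}], with [t = v{C}], is determined
   by Guin and Oudom's identity: the sum of [w{...}] over all partitions of the
   forest [C] together with the letters of [v], each block being itself a word
   applied to a forest, is [(wv){C}].  Solving it for the one-block term [L w t]
   defines an action of words on [T] for which [w |-> (C |-> w{C})] maps [g] to
   the pre-Lie algebra of formal vector fields on [T].  The induced morphism
   from [UPreLie g], evaluated at the origin, inverts [Psi].

   Surjectivity: the image of [Psi] contains [g], and is closed under the product
   because the same identity, which holds in [UPreLie g], rewrites unary nodes. *)

Require Import Defs.
From HB Require Import structures.
From mathcomp Require Import all_boot ssrAC perm ssralg ring_quotient boolp.
From mathcomp.multinomials Require Import freeg.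
From mathcomp Require Import zify.

Set Implicit Arguments.
Unset Strict Implicit.
Unset Printing Implicit Defensive.

Import GRing.Theory.
Local Open Scope ring_scope.

(** * Sums over splittings and set partitions of a list *)

(** The algebra U(g) is never built. Linear maps out of it are functions of words satisfying
    [ucomp], and PBW enters through [sigma], a function from words to S(g) with that property which
    inverts symmetrization. Symmetrization, unlike a choice of ordered basis, commutes with Lie
    morphisms: hence the naturality. In the identity that defines [L w t], letters of the root word
    of [t] may join any block, so its value involves [L u c] for children [c] of [t] and subwords
    [u] of the root word. A recursion for fixed [w] is therefore impossible: the fold over trees
    takes values in the space of all functions of words satisfying [ucomp], and this compatibility
    is proved along with the definition. For forests other than a single tree the identity holds by
    construction; for a single tree it follows from the associativity of nested partitions. No
    product is put on trees: vector fields are pre-Lie by themselves, so only a Lie morphism from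
    [g] has to be checked, and evaluation at the origin recovers a tree because it turns braces of
    fields into Taylor coefficients. *)

Inductive Split (X : Type) : seq X -> seq X -> seq X -> Prop :=
| Split_nil : Split [::] [::] [::]
| Split_l a l x y of Split l x y : Split (a :: l) (a :: x) y
| Split_r a l x y of Split l x y : Split (a :: l) x (a :: y).

Section SplitSum.
Variables (k : fieldType) (X : Type).

Section Def.
Variable V : lmodType k.
Implicit Types (H : seq X -> seq X -> V) (l : seq X).

(** The unshuffle coproduct of [l], paired with [H]; [ssumC], [ssum_assoc] and [ssum_nil_r] are its
    cocommutativity, coassociativity and counit. *)
Fixpoint ssum H l : V :=
  if l is a :: l' then
    ssum (fun x y => H (a :: x) y) l' + ssum (fun x y => H x (a :: y)) l'
  else H [::] [::].

Lemma eq_ssum_in H H' l :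
  (forall x y, Split l x y -> H x y = H' x y) -> ssum H l = ssum H' l.
Proof.
elim: l H H' => [|a l IH] H H' E /=; first by apply: E; constructor.
by congr (_ + _); apply: IH => x y s; apply: E; constructor.
Qed.

Lemma eq_ssum H H' l : (forall x y, H x y = H' x y) -> ssum H l = ssum H' l.
Proof. by move=> E; apply: eq_ssum_in. Qed.

Lemma ssumP a H H' l :
  ssum (fun x y => a *: H x y + H' x y) l = a *: ssum H l + ssum H' l.
Proof.
elim: l H H' => [|b l IH] H H' //=.
by rewrite !IH scalerDr addrACA.
Qed.

Lemma ssumD H H' l :
  ssum (fun x y => H x y + H' x y) l = ssum H l + ssum H' l.
Proof.
rewrite -[ssum H l]scale1r -ssumP.
by apply: eq_ssum => x y; rewrite scale1r.
Qed.

Lemma ssumB H H' l :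
  ssum (fun x y => H x y - H' x y) l = ssum H l - ssum H' l.
Proof.
rewrite [RHS]addrC -scaleN1r -ssumP.
by apply: eq_ssum => x y; rewrite scaleN1r addrC.
Qed.

Lemma ssumC H l : ssum H l = ssum (fun x y => H y x) l.
Proof.
by elim: l H => [|a l IH] H //=; rewrite addrC; congr (_ + _); apply: IH.
Qed.

(** Each side distributes the entries of [l] among three lists; only the order in which these are
    split off differs. *)
Lemma ssum_swap (H : seq X -> seq X -> seq X -> V) l :
  ssum (fun x y => ssum (fun u v => H x u v) y) l =
  ssum (fun x y => ssum (fun u v => H u x v) y) l.
Proof.
elim: l H => [|a l IH] H //=; rewrite !ssumD.
rewrite (IH (fun x => H (a :: x))) (IH (fun x u => H x (a :: u))).
by rewrite (IH (fun x u v => H x u (a :: v))) addrCA.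
Qed.

Lemma ssum_assoc (H : seq X -> seq X -> seq X -> V) l :
  ssum (fun x y => ssum (fun u v => H x u v) y) l =
  ssum (fun x y => ssum (fun u v => H u v y) x) l.
Proof.
elim: l H => [|a l IH] H //=; rewrite !ssumD.
rewrite (IH (fun x => H (a :: x))) (IH (fun x u => H x (a :: u))).
by rewrite (IH (fun x u v => H x u (a :: v))) addrA.
Qed.

Lemma ssum_cat H p q :
  ssum H (p ++ q) =
  ssum (fun p1 p2 => ssum (fun q1 q2 => H (p1 ++ q1) (p2 ++ q2)) q) p.
Proof. by elim: p H => [|a p IH] H //=; rewrite !IH. Qed.

Lemma ssum_nil_r (G : seq X -> V) l :
  ssum (fun x y => if y is [::] then G x else 0) l = G l.
Proof.
elim: l G => [|a l IH] G //=; rewrite IH -[RHS]addr0; congr (_ + _).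
rewrite -[RHS](subrr (ssum (fun _ _ => 0) l)) -ssumB.
by apply: eq_ssum => x y; rewrite subr0.
Qed.

End Def.

Lemma ssum_linear (V V' : lmodType k) (F : {linear V -> V'}) H l :
  F (ssum H l) = ssum (fun x y => F (H x y)) l.
Proof. by elim: l H => [|a l IH] H //=; rewrite raddfD /= !IH. Qed.

End SplitSum.

Lemma ssum_lin (k : fieldType) (X : Type) (V V' : lmodType k) (L : V -> V')
    (H : seq X -> seq X -> V) l :
  linear L -> L (ssum H l) = ssum (fun x y => L (H x y)) l.
Proof.
move=> LP; pose L' : {linear V -> V'} := HB.pack L (GRing.isLinear.Build k V V' *:%R L LP).
exact: (ssum_linear L').
Qed.

Lemma ssum_map (k : fieldType) (X Y : Type) (V : lmodType k) (j : Y -> X)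
    (H : seq X -> seq X -> V) l :
  ssum H (map j l) = ssum (fun x y => H (map j x) (map j y)) l.
Proof. by elim: l H => [|a l IH] H //=; rewrite !IH. Qed.

Section SplitFacts.
Variable X : Type.
Implicit Types l x y : seq X.

Lemma Split_inv a l x y : Split (a :: l) x y ->
  (exists2 x', x = a :: x' & Split l x' y) \/ (exists2 y', y = a :: y' & Split l x y').
Proof. by move=> H; inversion H; subst; [left; exists x0|right; exists y0]. Qed.

Lemma Split_nil_inv x y : Split [::] x y -> x = [::] /\ y = [::].
Proof. by move=> H; inversion H. Qed.

Lemma Split_size l x y : Split l x y -> (size l = size x + size y)%N.
Proof. by elim=> //= a l' x' y' _ ->; rewrite ?addnS. Qed.

End SplitFacts.

Section PartitionSum.
Variables (k : fieldType) (X T : Type) (f : seq X -> T).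

Section Def.
Variable V : lmodType k.
Implicit Types (F G : seq T -> V) (l : seq X).

(** The first entry singles out its block, so each set partition occurs once. The fuel bounds the
    length, since the remainder [y] is not a structural subterm. *)
Fixpoint psum_rec n F l : V :=
  match n, l with
  | n'.+1, a :: l' =>
      ssum (fun x y => psum_rec n' (fun ts => F (f (a :: x) :: ts)) y) l'
  | _, _ => F [::]
  end.

(* The sum of [F (map f pi)] over the set partitions [pi] of [l]. *)
Definition psum F l := psum_rec (size l) F l.

Lemma psum_recE n F l : (size l <= n)%N -> psum_rec n F l = psum F l.
Proof.
rewrite /psum; have [m] := ubnP (size l); elim: m n F l => // m IH n F [|a l].
  by case: n.
rewrite ltnS => lem; case: n => //= n len; apply: eq_ssum_in => x y /Split_size E.
have le_y : (size y <= size l)%N by rewrite E leq_addl.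
have lt_y := leq_ltn_trans le_y lem; have le_yn : (size y <= n)%N by apply: leq_trans le_y _.
by rewrite (IH _ _ _ lt_y le_yn) (IH _ _ _ lt_y le_y).
Qed.

Lemma psum_nil F : psum F [::] = F [::]. Proof. by []. Qed.

Lemma psum_cons F a l :
  psum F (a :: l) = ssum (fun x y => psum (fun ts => F (f (a :: x) :: ts)) y) l.
Proof.
rewrite [LHS]/psum /=; apply: eq_ssum_in => x y /Split_size E.
by rewrite psum_recE // E leq_addl.
Qed.

Lemma psum_ind (P : seq X -> Prop) :
  P [::] -> (forall a l, (forall y, (size y <= size l)%N -> P y) -> P (a :: l)) ->
  forall l, P l.
Proof.
move=> P0 PS l; have [m] := ubnP (size l); elim: m l => // m IH [|a l] //=.
rewrite ltnS => lem; apply: PS => y ley; apply: IH; exact: leq_ltn_trans ley lem.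
Qed.

Lemma eq_psum F G l : (forall ts, F ts = G ts) -> psum F l = psum G l.
Proof.
elim/psum_ind: l F G => [|a l IH] F G E; first exact: E.
rewrite !psum_cons; apply: eq_ssum_in => x y /Split_size El.
by apply: IH => [|ts]; rewrite ?El ?leq_addl.
Qed.

Lemma psumP a F G l :
  psum (fun ts => a *: F ts + G ts) l = a *: psum F l + psum G l.
Proof.
elim/psum_ind: l F G => [|b l IH] F G; first by [].
rewrite !psum_cons -ssumP; apply: eq_ssum_in => x y /Split_size El.
by rewrite IH // El leq_addl.
Qed.

Lemma psumD F G l : psum (fun ts => F ts + G ts) l = psum F l + psum G l.
Proof.
rewrite -[psum F l]scale1r -psumP.
by apply: eq_psum => x; rewrite scale1r.
Qed.

Lemma psumB F G l : psum (fun ts => F ts - G ts) l = psum F l - psum G l.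
Proof.
rewrite [RHS]addrC -scaleN1r -psumP.
by apply: eq_psum => x; rewrite scaleN1r addrC.
Qed.

Lemma psum_ssum (Y : Type) (H : seq T -> seq Y -> seq Y -> V) l m :
  psum (fun ts => ssum (H ts) m) l = ssum (fun x y => psum (fun ts => H ts x y) l) m.
Proof. by elim: m H => [|a m IH] H //=; rewrite psumD !IH. Qed.

(* The coproduct of the exponential of [f] is its exterior square. *)
Lemma psum_split (G : seq T -> seq T -> V) l :
  psum (fun ts => ssum G ts) l =
  ssum (fun x y => psum (fun us => psum (fun vs => G us vs) y) x) l.
Proof.
elim/psum_ind: l G => [|a l IH] G //=; rewrite psum_cons /=.
under eq_ssum => x y do rewrite psumD.
rewrite ssumD; congr (_ + _).
  under [RHS]eq_ssum => x y do rewrite psum_cons.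
  rewrite -(ssum_assoc (fun u v y => psum (fun us =>
    psum (fun vs => G (f (a :: u) :: us) vs) y) v)).
  by apply: eq_ssum_in => x y /Split_size E; rewrite IH // E leq_addl.
transitivity (ssum (fun x y => ssum (fun u v => psum (fun us =>
   psum (fun vs => G us (f (a :: u) :: vs)) v) x) y) l).
  rewrite ssum_swap.
  by apply: eq_ssum_in => x y /Split_size E; rewrite IH // E leq_addl.
apply: eq_ssum => x y; rewrite -psum_ssum.
by apply: eq_psum => us; rewrite psum_cons.
Qed.

Lemma psum_nonnil (v : V) l :
  psum (fun ts => if ts is [::] then v else 0) l = if l is [::] then v else 0.
Proof.
case: l => // a l; rewrite psum_cons.
have Z y : psum (fun=> 0 : V) y = 0.
  rewrite -[RHS](subrr (psum (fun=> 0 : V) y)) -psumB.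
  by apply: eq_psum => ts; rewrite subr0.
transitivity (ssum (fun _ _ => 0 : V) l); first by apply: eq_ssum => x y; rewrite Z.
rewrite -[RHS](subrr (ssum (fun _ _ => 0 : V) l)) -ssumB.
by apply: eq_ssum => x y; rewrite subr0.
Qed.

(** Only the partition with a single block contributes; this isolates the one-block term of the
    Guin-Oudom identity. *)
Lemma psum_one (F : T -> V) a l :
  psum (fun ts => if ts is [:: t] then F t else 0) (a :: l) = F (f (a :: l)).
Proof.
rewrite psum_cons -(ssum_nil_r (fun x => F (f (a :: x)))).
apply: eq_ssum => x y; rewrite -(psum_nonnil (F (f (a :: x))) y).
by apply: eq_psum; case.
Qed.

End Def.

Lemma psum_linear (V V' : lmodType k) (L : {linear V -> V'}) F l :
  L (psum F l) = psum (fun ts => L (F ts)) l.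
Proof.
elim/psum_ind: l F => [|a l IH] F //; rewrite !psum_cons ssum_linear.
by apply: eq_ssum_in => x y /Split_size E; rewrite IH // E leq_addl.
Qed.

End PartitionSum.

Lemma psum_map (k : fieldType) (X Y T : Type) (V : lmodType k) (f : seq X -> T)
    (h : Y -> X) (F : seq T -> V) l :
  psum f F (map h l) = psum (fun m => f (map h m)) F l.
Proof.
elim/psum_ind: l F => [|a l IH] F //; rewrite [map _ _]/= !psum_cons ssum_map.
by apply: eq_ssum_in => x y /Split_size E; rewrite IH // E leq_addl.
Qed.

Lemma eq_psum_f (k : fieldType) (X T : Type) (V : lmodType k) (f f' : seq X -> T)
    (F : seq T -> V) l :
  (forall m, f m = f' m) -> psum f F l = psum f' F l.
Proof. by move=> E; congr (psum _ F l); apply: functional_extensionality_dep. Qed.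

(** * Multilinear and symmetric functions of lists, and composition of partitions *)

Section Multilinear.
Variable k : fieldType.

(* [j] marks the entries of the lists in which [G] is to be linear. *)
Definition mlin (U V : lmodType k) (X : Type) (j : U -> X) (G : seq X -> V) :=
  forall p q a x y,
    G (p ++ j (a *: x + y) :: q) = a *: G (p ++ j x :: q) + G (p ++ j y :: q).

Definition sym2 (X V : Type) (F : seq X -> V) :=
  forall p q x y, F (p ++ x :: y :: q) = F (p ++ y :: x :: q).

Lemma mlin0 (U V : lmodType k) (X : Type) (j : U -> X) (G : seq X -> V) p q :
  mlin j G -> G (p ++ j 0 :: q) = 0.
Proof.
move=> GP; apply: (@addIr _ (G (p ++ j 0 :: q))); rewrite add0r.
by have := GP p q 1 0 0; rewrite !scale1r addr0.
Qed.

Lemma mlin_cons (U V : lmodType k) (F : seq U -> V) t :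
  mlin id F -> mlin id (fun ts => F (t :: ts)).
Proof. by move=> FP p q; exact: (FP (t :: p)). Qed.

Lemma sym2_cons (X V : Type) (F : seq X -> V) t :
  sym2 F -> sym2 (fun ts => F (t :: ts)).
Proof. by move=> FP p; exact: (FP (t :: p)). Qed.

Lemma sym2_perm (X : eqType) (V : Type) (F : seq X -> V) s t :
  sym2 F -> perm_eq s t -> F s = F t.
Proof.
move=> FS; elim: s t F FS => [|x s IH] t F FS.
  by rewrite perm_sym => /perm_nilP ->.
move=> st; have xt: x \in t by rewrite -(perm_mem st) mem_head.
case: (splitPr xt) st => p q st.
have M r : F (r ++ x :: p ++ q) = F (r ++ p ++ x :: q).
  by elim: p r {st xt} => //= y p IHp r; rewrite FS -cat_rcons IHp cat_rcons.
rewrite -(M [::]) /=; apply: (IH _ (fun ts => F (x :: ts))); first exact: sym2_cons.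
rewrite -(perm_cons x); apply: perm_trans st _.
by rewrite -[x :: q]cat1s perm_catCA.
Qed.

End Multilinear.

Section PartitionMultilinear.
Variables (k : fieldType) (X : Type) (T V : lmodType k) (f : seq X -> T).

(** The marked entry lies in exactly one block, and [F] is linear in the value of that block. *)
Lemma psum_mlin (U : lmodType k) (j : U -> X) (F : seq T -> V) :
  mlin j f -> mlin id F -> mlin j (psum f F).
Proof.
move=> fj FP p q c x y; move: {2}(size (p ++ q)) (leqnn (size (p ++ q))) => n.
elim: n p q F FP => [|n IH] p q F FP.
  case: p => //; case: q => // _; rewrite /= !psum_cons /= !psum_nil /=.
  by rewrite (fj [::]) (FP [::]).
case: p => [|d p] /= len.
  rewrite !psum_cons -ssumP; apply: eq_ssum => u v; rewrite -psumP.
  by apply: eq_psum => ts; rewrite (fj [::]) (FP [::]).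
rewrite !psum_cons !ssum_cat -ssumP; apply: eq_ssum_in => p1 p2 /Split_size Ep.
rewrite /= scalerDr addrACA -!ssumP.
congr (_ + _); apply: eq_ssum_in => q1 q2 /Split_size Eq.
  rewrite -psumP; apply: eq_psum => ts.
  by rewrite -!cat_cons fj (FP [::]).
apply: IH; first exact: (mlin_cons _ FP).
move: len; rewrite ltnS !size_cat Ep Eq; apply: leq_trans.
by rewrite leq_add // leq_addl.
Qed.

(* If exchanging two adjacent entries [a], [b] changes [f] by the value at the
   single entry [c], the same holds for the sums over partitions: the terms
   with [a] and [b] in different blocks cancel in pairs. *)
Lemma psum_rel (a b c : X) (F : seq T -> V) :
  (forall p q, f (p ++ a :: b :: q) - f (p ++ b :: a :: q) = f (p ++ c :: q)) ->
  mlin id F -> sym2 F -> forall p q,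
  psum f F (p ++ a :: b :: q) - psum f F (p ++ b :: a :: q) = psum f F (p ++ c :: q).
Proof.
move=> fR FP FS p q; move: {2}(size (p ++ q)) (leqnn (size (p ++ q))) => n.
have FB s t (G : seq T -> V) ts : mlin id G -> G (s :: ts) - G (t :: ts) = G (s - t :: ts).
  move=> GP; rewrite [RHS](_ : _ = G ((-1) *: t + s :: ts)); last by rewrite scaleN1r addrC.
  by rewrite (GP [::]) scaleN1r addrC.
elim: n p q F FP FS => [|n IH] p q F FP FS len.
  case: p len => //; case: q => // _; rewrite /= !psum_cons /= !psum_cons /= !psum_nil.
  rewrite (FS [::]) opprD addrACA subrr addr0 FB //.
  by rewrite (fR [::] [::]).
case: p len => [|d p] /= len.
  rewrite !psum_cons /= opprD addrACA -!ssumB -[RHS]addr0; congr (_ + _).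
    apply: eq_ssum => x y; rewrite -psumB; apply: eq_psum => ts.
    by rewrite FB // (fR [::]).
  rewrite ssumB; apply/eqP; rewrite subr_eq0; apply/eqP.
  under eq_ssum => x y do rewrite psum_cons.
  rewrite ssum_swap; apply: eq_ssum => x y; rewrite psum_cons.
  by apply: eq_ssum => u v; apply: eq_psum => ts; apply: (FS [::]).
rewrite !psum_cons !ssum_cat -ssumB; apply: eq_ssum_in => p1 p2 /Split_size Ep.
rewrite /=; set A1 := ssum _ _; set A2 := ssum _ _; set A3 := ssum _ _; set A4 := ssum _ _.
set B1 := ssum _ _; set B4 := ssum _ _.
(* The block of [d] has been split off. In [A1] and [A4] it contains both or neither of [a] and [b];
   [A2] and [A3], where it contains just one of them, occur in both sums. *)
have -> : A1 + A2 + (A3 + A4) - (B1 + A3 + (A2 + B4)) = (A1 - B1) + (A4 - B4).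
  rewrite (addrC A3 A4) (addrACA A1) (addrC A2 B4) (addrACA B1) (addrC A3 A2).
  by rewrite opprD (addrACA (A1 + A4)) subrr addr0 opprD (addrACA A1).
rewrite -!ssumB; congr (_ + _); apply: eq_ssum_in => q1 q2 /Split_size Eq.
  rewrite -psumB; apply: eq_psum => ts.
  by rewrite FB // -!cat_cons fR.
apply: IH; [exact: (mlin_cons _ FP)|exact: (sym2_cons _ FS)|].
move: len; rewrite ltnS !size_cat Ep Eq; apply: leq_trans.
by rewrite leq_add // leq_addl.
Qed.

End PartitionMultilinear.

Section Composition.
Variables (k : fieldType) (A X : Type) (T V : lmodType k).
Variables (f : seq X -> T) (i : A -> X) (j : T -> X).
Hypothesis f1 : forall t, f [:: j t] = t.
Hypothesis f2 : forall t u ts, f [:: j t, j u & map j ts] = 0.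

(** By [f2] a block of two or more elements has value [0] and kills its term; by [f1] a singleton
    contributes its element. *)
Lemma psum_pure (F : seq T -> V) ts : mlin id F -> psum f F (map j ts) = F ts.
Proof.
elim/psum_ind: ts F => [|t ts IH] F FP //=.
rewrite psum_cons ssum_map -[RHS](ssum_nil_r (fun us => F (t :: us)) ts) [RHS]ssumC.
apply: eq_ssum_in => -[|u us] y /Split_size E.
  by rewrite f1 IH ?E //; apply: mlin_cons.
rewrite /= f2 IH ?E ?leq_addl //; last exact: mlin_cons.
exact: (mlin0 [::] y FP).
Qed.

Lemma psum_lin (U : lmodType k) (L : U -> V) (F : seq T -> U) l :
  linear L -> L (psum f F l) = psum f (fun ts => L (F ts)) l.
Proof.
move=> LP; pose L' : {linear U -> V} := HB.pack L (GRing.isLinear.Build k U V *:%R L LP).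
exact: (psum_linear f L').
Qed.

(** A class of lists closed under splitting, because [fR] is available in one application only below
    a given tree, by induction, and in the other only for lists with at most one letter. *)
Variable R : seq X -> Prop.
Hypothesis R_Split : forall l x y, Split l x y -> R l -> R x /\ R y.
Hypothesis fR : forall l w, R l ->
  psum f (fun ts => f (map i w ++ map j ts)) l = f (map i w ++ l).

(* Partitioning the blocks of a partition of [l] together with [w] amounts to
   partitioning [w ++ l], provided this holds for a single outer block. *)
Lemma psum_comp (F : seq T -> V) w l : mlin id F -> R l ->
  psum f (fun ts => psum f F (map i w ++ map j ts)) l = psum f F (map i w ++ l).
Proof.
elim/psum_ind: w F l => [|a w IH] F l FP Rl.
  by apply: eq_psum => ts; rewrite psum_pure.
rewrite /= psum_cons ssum_cat ssum_map.
transitivity (psum f (fun ts => ssum (fun w1 w2 => ssum (fun t1 t2 =>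
    psum f (fun us => F (f (i a :: map i w1 ++ map j t1) :: us))
      (map i w2 ++ map j t2)) ts) w) l).
  apply: eq_psum => ts; rewrite psum_cons ssum_cat ssum_map.
  by apply: eq_ssum => w1 w2; rewrite ssum_map.
rewrite psum_ssum; apply: eq_ssum_in => w1 w2 /Split_size E.
(* Distributing blocks between the outer block of [a] and the other outer blocks amounts to
   distributing the entries of [l] and then partitioning both parts. *)
rewrite psum_split; apply: eq_ssum_in => l1 l2 /R_Split /(_ Rl) [R1 R2].
transitivity (psum f (fun t1 => psum f (fun us =>
    F (f (i a :: map i w1 ++ map j t1) :: us)) (map i w2 ++ l2)) l1).
  by apply: eq_psum => t1; apply: IH => //; [rewrite E leq_addl|apply: mlin_cons].
rewrite -(fR (a :: w1) R1).
rewrite (@psum_lin _ (fun t => psum f (fun us => F (t :: us)) (map i w2 ++ l2))) //.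
move=> b t u; rewrite -psumP; apply: eq_psum => us.
exact: (FP [::]).
Qed.

End Composition.

(** * Symmetric braces *)

Section DerivationSum.
Variables (k : fieldType) (A : preLieType k).

Section Def.
Variable V : lmodType k.
Implicit Types (F G : seq A -> V) (C : seq A) (c d : A).

(* The sum of the values of [F] at the lists obtained from [C] by multiplying
   one entry by [c] on the right. *)
Fixpoint dersum c F C : V :=
  if C is b :: C' then F ((b ◁ c) :: C') + dersum c (fun D => F (b :: D)) C' else 0.

Lemma dersum_cons c F b C :
  dersum c F (b :: C) = F ((b ◁ c) :: C) + dersum c (fun D => F (b :: D)) C.
Proof. by []. Qed.

Lemma eq_dersum_in c F G C :
  (forall D, size D = size C -> F D = G D) -> dersum c F C = dersum c G C.
Proof.
elim: C F G => //= b C IH F G E; rewrite E //; congr (_ + _).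
by apply: IH => D /= sD; apply: E; rewrite /= sD.
Qed.

Lemma dersumP c a F G C :
  dersum c (fun D => a *: F D + G D) C = a *: dersum c F C + dersum c G C.
Proof.
elim: C F G => /= [|b C IH] F G; first by rewrite scaler0 addr0.
by rewrite IH scalerDr addrACA.
Qed.

Lemma dersumD c F G C :
  dersum c (fun D => F D + G D) C = dersum c F C + dersum c G C.
Proof.
rewrite -[dersum c F C]scale1r -dersumP.
by apply: eq_dersum_in => x y; rewrite scale1r.
Qed.

Lemma dersumB c F G C :
  dersum c (fun D => F D - G D) C = dersum c F C - dersum c G C.
Proof.
rewrite [RHS]addrC -scaleN1r -dersumP.
by apply: eq_dersum_in => x y; rewrite scaleN1r addrC.
Qed.

Lemma dersum_cat c F p q :
  dersum c F (p ++ q) =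
  dersum c (fun D => F (D ++ q)) p + dersum c (fun D => F (p ++ D)) q.
Proof. by elim: p F => /= [|b p IH] F; rewrite ?add0r // IH addrA. Qed.

(** Multilinearity at one length only, [n] being the number of entries other than the marked one:
    for [brace] it is proved by induction on the length. *)
Definition mlin_size n F := forall p q a x y, size (p ++ q) = n ->
  F (p ++ (a *: x + y) :: q) = a *: F (p ++ x :: q) + F (p ++ y :: q).

Definition sym2_size n F := forall p q x y, size (p ++ q) = n ->
  F (p ++ x :: y :: q) = F (p ++ y :: x :: q).

Lemma mlin_size_cons n F b : mlin_size n.+1 F -> mlin_size n (fun D => F (b :: D)).
Proof. by move=> FP p q a x y E; apply: (FP (b :: p)); rewrite /= E. Qed.

Lemma mlin_sizeD n F p x y q : mlin_size n F -> size (p ++ q) = n ->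
  F (p ++ (x + y) :: q) = F (p ++ x :: q) + F (p ++ y :: q).
Proof. by move=> FP E; rewrite -[x]scale1r FP ?scale1r. Qed.

Lemma dersum_lin F C a c d : (forall n, size C = n.+1 -> mlin_size n F) ->
  dersum (a *: c + d) F C = a *: dersum c F C + dersum d F C.
Proof.
elim: C F => /= [|b C IH] F FP; first by rewrite scaler0 addr0.
rewrite bprod_linr (FP _ erefl [::]) // IH ?scalerDr 1?addrACA // => n E.
by apply: mlin_size_cons; apply: FP; rewrite E.
Qed.

Lemma dersum_mlin c F n : mlin_size n F -> mlin_size n (dersum c F).
Proof.
move=> FP p q a x y E; rewrite !dersum_cat /=.
rewrite bprod_linl FP //.
rewrite (@eq_dersum_in _ _ (fun D => a *: F (D ++ x :: q) + F (D ++ y :: q))); last first.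
  by move=> D sD; rewrite FP // size_cat sD -size_cat.
rewrite dersumP.
rewrite [X in _ + (_ + X) = _](@eq_dersum_in _ _
   (fun D => a *: F (p ++ x :: D) + F (p ++ y :: D))); last first.
  by move=> D sD; rewrite FP // size_cat sD -size_cat.
rewrite dersumP.
rewrite !scalerDr.
by set F1 := F _; set F2 := F _; rewrite (addrACA (a *: F1)) [LHS]addrACA.
Qed.

Lemma dersum_sym2 c F n : sym2_size n F -> sym2_size n (dersum c F).
Proof.
move=> FS p q x y E; rewrite !dersum_cat /= (FS p q (x ◁ c)) // (FS p q x (y ◁ c)) // (addrCA (F _)); congr (_ + _).
  by apply: eq_dersum_in => D sD; apply: FS; rewrite size_cat sD -size_cat.
congr (_ + (_ + _)); apply: eq_dersum_in => D sD.
by apply: FS; rewrite size_cat sD -size_cat.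
Qed.

(** When [c] and [d] hit the same entry this is right-symmetry; when they hit different entries the
    terms are symmetric already. *)
Lemma dersumC F C c d : (forall n, size C = n.+1 -> mlin_size n F) ->
  dersum (c ◁ d) F C + dersum d (dersum c F) C =
  dersum (d ◁ c) F C + dersum c (dersum d F) C.
Proof.
elim: C F => //= b C IH F FP.
rewrite !dersumD !addrA.
have E : F (b ◁ (c ◁ d) :: C) + F (b ◁ d ◁ c :: C) =
         F (b ◁ (d ◁ c) :: C) + F (b ◁ c ◁ d :: C).
  rewrite -!(mlin_sizeD (p := [::]) _ _ (FP _ erefl)) //; congr (F (_ :: _)).
  have /eqP := right_symmetric b c d; rewrite subr_eq addrAC eq_sym subr_eq => /eqP E.
  by rewrite addrC E addrC.
have {}IH := IH (fun D => F (b :: D)) (fun n E => mlin_size_cons b (FP n.+1 (congr1 S E))).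
set X1 := F _ in E *; set X2 := F (b ◁ d ◁ c :: C) in E *.
set X3 := F _ in E *; set X4 := F (b ◁ c ◁ d :: C) in E *.
set Y1 := dersum _ _ _ in IH *; set Y2 := dersum d _ _ in IH *.
rewrite [LHS](ACl ((1*3)*(2*6)*(4*5)))/= E IH.
by rewrite [RHS](ACl ((1*3)*(2*6)*(5*4))).
Qed.

Lemma dersum_ssum (H : seq A -> seq A -> V) c C :
  dersum c (ssum H) C =
  ssum (fun x y => dersum c (fun D => H D y) x + dersum c (fun D => H x D) y) C.
Proof.
elim: C H => [|b C IH] H /=; first by rewrite addr0.
rewrite dersumD !IH addrACA.
by congr (_ + _); rewrite -ssumD; apply: eq_ssum => x y; rewrite !addrA // [X in X + _]addrC.
Qed.

End Def.

Lemma dersum_linear (V V' : lmodType k) (L : V -> V') c F C : linear L ->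
  L (dersum c F C) = dersum c (fun D => L (F D)) C.
Proof.
move=> LP; pose L' : {linear V -> V'} := HB.pack L (GRing.isLinear.Build k V V' *:%R L LP).
have LD : {morph L : x y / x + y} := raddfD L'.
elim: C F => /= [|b C IH] F; first exact: (raddf0 L').
by rewrite LD -IH.
Qed.

End DerivationSum.

Section Braces.
Variables (k : fieldType) (A : preLieType k).
Implicit Types (a b c : A) (C : seq A).

(** The fuel is the length: the derivative terms change entries of [C'] but not their number. *)
Fixpoint brace_rec n a C : A :=
  match n, C with
  | n'.+1, c :: C' => brace_rec n' a C' ◁ c - dersum c (brace_rec n' a) C'
  | _, _ => a
  end.

(* The symmetric brace [a{c1,...,cn}] of Guin and Oudom. *)
Definition brace a C := brace_rec (size C) a C.

Arguments brace : simpl never.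

Lemma brace_nil a : brace a [::] = a. Proof. by []. Qed.

Lemma brace_cons a c C :
  brace a (c :: C) = brace a C ◁ c - dersum c (brace a) C.
Proof.
rewrite [LHS]/brace /=; congr (_ - _).
by apply: eq_dersum_in => D; rewrite /brace => ->.
Qed.

Lemma brace_lin (r : k) a b C : brace (r *: a + b) C = r *: brace a C + brace b C.
Proof.
have [n] := ubnP (size C); elim: n C => // n IH [|c C] // len.
rewrite !brace_cons IH // bprod_linl scalerBr addrACA; congr (_ + _).
rewrite -opprD -dersumP; congr (- _).
by apply: eq_dersum_in => D sD; rewrite IH // sD.
Qed.

Lemma brace_mlin_size a n : mlin_size n (brace a).
Proof.
elim: n => [|n IH] [|d p] q b x y //.
- case: q => // _; rewrite /= !brace_cons /= !brace_nil.
  by rewrite bprod_linr !subr0.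
- move=> E; rewrite /= !brace_cons bprod_linr dersum_lin; last first.
    by move=> m; rewrite E => -[<-].
  by rewrite opprD addrACA scalerBr.
- move=> [E]; rewrite /= !brace_cons IH // (dersum_mlin d IH) // bprod_linl.
  by rewrite opprD addrACA scalerBr.
Qed.

Lemma brace_mlin a : mlin id (brace a).
Proof. by move=> p q b x y; apply: (@brace_mlin_size a (size (p ++ q))). Qed.

(** Each of the three groups is symmetric in [x] and [y]: the first by right-symmetry, the second
    visibly, the third by [dersumC]. *)
Lemma brace_cons2 a x y C :
  brace a [:: x, y & C] =
    (brace a C ◁ y ◁ x - brace a C ◁ (y ◁ x))
    - (dersum y (fun D => brace a D ◁ x) C + dersum x (fun D => brace a D ◁ y) C)
    + (dersum (y ◁ x) (brace a) C + dersum x (dersum y (brace a)) C).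
Proof.
rewrite !brace_cons /= brace_cons bprodBl.
have -> : dersum x (fun D => brace a (y :: D)) C =
    dersum x (fun D => brace a D ◁ y - dersum y (brace a) D) C.
  by apply: eq_dersum_in => D _; rewrite brace_cons.
have -> : dersum y (brace a) C ◁ x = dersum y (fun D => brace a D ◁ x) C.
  by apply: (dersum_linear (L := fun z => z ◁ x)) => b u v; apply: bprod_linl.
rewrite dersumB !opprD !opprK !addrA.
by rewrite [LHS](ACl (1*3*2*5*4*6)).
Qed.

Lemma brace_sym2 a : sym2 (brace a).
Proof.
suff S n : sym2_size n (brace a) by move=> p q x y; apply: (S (size (p ++ q))).
have S0 q x y : brace a [:: x, y & q] = brace a [:: y, x & q].
  rewrite (brace_cons2 a x y) (brace_cons2 a y x).
  rewrite (dersumC y x); last by move=> m _; apply: brace_mlin_size.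
  by rewrite right_symmetric [X in _ - X]addrC.
elim: n => [|n IH] [|d p] q x y; [by move=> _; apply: S0|by []|by move=> _; apply: S0|].
by move=> [E]; rewrite /= !brace_cons IH // (dersum_sym2 d IH).
Qed.

(** Multiplying [a{b{x},y}] by [c] and removing the derivative terms leaves [a{b{x},c,y}] and
    [a{b{c,x},y}], the two ways in which [c] joins a splitting. *)
Lemma brace_prod a b C :
  brace (a ◁ b) C = ssum (fun x y => brace a (brace b x :: y)) C.
Proof.
have [n] := ubnP (size C); elim: n C => [C|n IH [_|c C len]]; first by rewrite ltn0.
  rewrite [RHS]/= [RHS]brace_cons !brace_nil.
  by rewrite [dersum _ _ _]/= subr0.
rewrite (brace_cons (a ◁ b)) IH //.
have -> : dersum c (brace (a ◁ b)) C =
    dersum c (ssum (fun x y => brace a (brace b x :: y))) C.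
  by apply: eq_dersum_in => D sD; rewrite IH // sD.
rewrite dersum_ssum (@ssum_lin _ _ _ _ (fun z => z ◁ c)); last first.
  by move=> r u v; apply: bprod_linl.
rewrite -ssumB [RHS]/= -ssumD; apply: eq_ssum => x y.
rewrite [brace a [:: _, c & _]](brace_sym2 a [::]) [brace a (c :: _)]brace_cons dersum_cons.
have -> : brace a (brace b (c :: x) :: y) =
    brace a (brace b x ◁ c :: y) - dersum c (fun D => brace a (brace b D :: y)) x.
  have LP : linear (fun z => brace a (z :: y)).
    by move=> r u v; apply: (brace_mlin a [::]).
  rewrite (brace_cons b c x) -[- dersum c (brace b) x]scaleN1r addrC LP scaleN1r addrC.
  by rewrite (dersum_linear c _ _ LP).
set X1 := _ ◁ c; set X2 := brace a _; set X3 := dersum _ _ _; set X4 := dersum _ _ _.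
move: X1 X2 X3 X4 => X1 X2 X3 X4; rewrite !opprD !addrA.
by rewrite [RHS](ACl (3*2*5*(1*4))) /= subrr addr0.
Qed.

End Braces.

Arguments brace : simpl never.

Lemma brace_morph (k : fieldType) (A B : preLieType k) (F : {linear A -> B}) :
  (forall x y, F (x ◁ y) = F x ◁ F y) ->
  forall a C, F (brace a C) = brace (F a) (map F C).
Proof.
move=> FM a C; have FB : forall u v, F (u - v) = F u - F v by exact: raddfB.
have [n] := ubnP (size C); elim: n C => // n IH [|c C] // len.
rewrite [map _ _]/= !brace_cons FB FM IH //; congr (_ - _).
have E G : dersum (F c) G (map F C) = dersum c (fun D => G (map F D)) C.
  by elim: (C) G => //= b C' IHC G; rewrite FM IHC.
rewrite E (dersum_linear (L := F)); last exact: linearP.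
by apply: eq_dersum_in => D sD; rewrite IH // sD.
Qed.

(** * Injections and universal property of direct sums *)

Section DirectSumTheory.
Variables (k : fieldType) (V : nat -> lmodType k).

Definition dinj_fun n (x : V n) m : V m :=
  if @eqP _ n m is ReflectT e then ecast i (V i) e x else 0.

Lemma dinj_fun_same n (x : V n) : dinj_fun x n = x.
Proof.
by rewrite /dinj_fun; case: eqP => // e; rewrite (eq_irrelevance e erefl).
Qed.

Lemma dinj_fun_diff n (x : V n) m : n <> m -> dinj_fun x m = 0.
Proof. by rewrite /dinj_fun; case: eqP. Qed.

Fact dinj_subproof n (x : V n) : finitely_supported (dinj_fun x).
Proof.
apply/asboolP; exists n.+1 => m lt_nm; apply: dinj_fun_diff => E.
by rewrite E ltnn in lt_nm.
Qed.

Definition dinj n (x : V n) : dsum V := DSum (dinj_subproof x).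

Fact dinj_linear n : linear (@dinj n).
Proof.
move=> a x y; apply: dsumP => m /=; case: (eqVneq n m) => [<-|/eqP d].
  by rewrite !dinj_fun_same.
by rewrite !dinj_fun_diff // scaler0 addr0.
Qed.
HB.instance Definition _ n :=
  GRing.isLinear.Build k (V n) (dsum V) *:%R (@dinj n) (@dinj_linear n).

Lemma dsum_elim (P : dsum V -> Prop) :
  P 0 -> (forall x y, P x -> P y -> P (x + y)) -> (forall n (x : V n), P (dinj x)) ->
  forall x, P x.
Proof.
move=> P0 PD PI x; have [N xN] := dsum_supp x.
have -> : x = \sum_(n < N) dinj (dsum_val x n).
  apply: dsumP => m.
  have valD : {morph dsum_val (V:=V)^~ m : y z / y + z} by [].
  have val0 : dsum_val (0 : dsum V) m = 0 by [].
  rewrite (big_morph _ valD val0) /=; case: (ltnP m N) => [lt_mN|le_Nm].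
    rewrite (bigD1 (Ordinal lt_mN)) //= dinj_fun_same big1 ?addr0 // => i ne_i.
    by apply: dinj_fun_diff => E; case/eqP: ne_i; apply: val_inj.
  rewrite xN // big1 // => i _; apply: dinj_fun_diff => E.
  by have := ltn_ord i; rewrite E ltnNge le_Nm.
by elim/big_ind: _.
Qed.

Section Lift.
Variables (Z : lmodType k) (f : forall n, {linear V n -> Z}).

Definition dsum_lift_fun (x : dsum V) : Z :=
  \sum_(n < sval (cid (dsum_supp x))) f n (dsum_val x n).

Lemma dsum_lift_funE (x : dsum V) N : (forall n, (N <= n)%N -> dsum_val x n = 0) ->
  dsum_lift_fun x = \sum_(n < N) f n (dsum_val x n).
Proof.
move=> xN; rewrite /dsum_lift_fun; case: cid => M /= xM.
have E a b : (a <= b)%N -> (forall n, (a <= n)%N -> dsum_val x n = 0) ->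
    \sum_(n < b) f n (dsum_val x n) = \sum_(n < a) f n (dsum_val x n).
  move=> le_ab xa; rewrite -!(big_mkord xpredT (fun n => f n (dsum_val x n))).
  have E0 : \sum_(a <= n < b) f n (dsum_val x n) = 0.
    by rewrite big_nat_cond big1 // => n; rewrite andbT => /andP[/xa -> _]; rewrite raddf0.
  by rewrite (big_cat_nat (leq0n a) le_ab) /= E0 addr0.
rewrite -(E M (maxn M N)) ?leq_maxl // -(E N (maxn M N)) ?leq_maxr //.
Qed.

Fact dsum_lift_linear : linear dsum_lift_fun.
Proof.
move=> a x y; have [N xN] := dsum_supp x; have [M yM] := dsum_supp y.
have le_l n : (maxn N M <= n)%N -> (N <= n)%N by rewrite geq_max => /andP[].
have le_r n : (maxn N M <= n)%N -> (M <= n)%N by rewrite geq_max => /andP[].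
rewrite (@dsum_lift_funE x (maxn N M)) => [|n /le_l /xN //].
rewrite (@dsum_lift_funE y (maxn N M)) => [|n /le_r /yM //].
rewrite (@dsum_lift_funE _ (maxn N M)) => [|n le]; last first.
  by rewrite /= xN ?yM ?scaler0 ?addr0 //; [apply: le_r|apply: le_l].
by rewrite scaler_sumr -big_split; apply: eq_bigr => n _; apply: linearP.
Qed.

Definition dsum_lift : {linear dsum V -> Z} :=
  HB.pack dsum_lift_fun
    (GRing.isLinear.Build k (dsum V) Z *:%R dsum_lift_fun dsum_lift_linear).

Lemma dsum_lift_inj n (x : V n) : dsum_lift (dinj x) = f n x.
Proof.
rewrite /= (@dsum_lift_funE _ n.+1) => [|m lt_nm]; last first.
  by apply: dinj_fun_diff => E; rewrite E ltnn in lt_nm.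
rewrite big_ord_recr /= dinj_fun_same big1 ?add0r // => i _.
rewrite dinj_fun_diff ?raddf0 // => E.
by have := ltn_ord i; rewrite -[X in (X < _)%N]E ltnn.
Qed.

End Lift.

End DirectSumTheory.

Lemma dsum_map_dinj (k : fieldType) (V W : nat -> lmodType k)
    (f : forall n, {linear V n -> W n}) n (x : V n) :
  dsum_map f (dinj x) = dinj (f n x).
Proof.
apply: dsumP => m /=; case: (eqVneq n m) => [<-|/eqP d].
  by rewrite !dinj_fun_same.
by rewrite !dinj_fun_diff // raddf0.
Qed.

Lemma tpow_elim (k : fieldType) n (V : lmodType k) (P : tpow n V -> Prop) :
  P 0 -> (forall a x y, P x -> P y -> P (a *: x + y)) -> (forall v, P (tpure v)) ->
  forall x, P x.
Proof.
move=> P0 PL Pp; elim/quot_pi_surj; elim/freeg_elim => [|a v D IH].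
  by rewrite raddf0.
by rewrite linearP; apply: PL => //; apply: Pp.
Qed.

(** * Symmetrization of words *)

Section Words.
Variables (k : fieldType) (g : lmodType k).

Definition sym_pi n : {linear tpow n.+1 g -> sym_plus g} :=
  (@dinj k (fun n => sympow n.+1 g) n \o quot_pi (@sym_rel k n.+1 g))%FUN.

Lemma sym_pi_perm n s t : sym_pi n (tpow_perm g s t) = sym_pi n t.
Proof.
rewrite /=; congr dinj; apply/eqP; rewrite -subr_eq0 -linearB.
by apply/eqP/quot_rel/SymRel.
Qed.

Definition sympure n (w : seq g) : sym_plus g :=
  sym_pi n (tpure [ffun i : 'I_n.+1 => nth 0 w i]).

(** The commutative monomial of a word; the empty word gives [0], as S(g) starts in degree one. *)
Definition symw (w : seq g) : sym_plus g :=
  if w is [::] then 0 else sympure (size w).-1 w.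

Lemma symwE n w : size w = n.+1 -> symw w = sympure n w.
Proof. by case: w => //= x w [->]. Qed.

Lemma symw_mlin : mlin id symw.
Proof.
move=> p q a x y; pose n := (size p + size q)%N.
have E z : size (p ++ z :: q) = n.+1 by rewrite size_cat addnS.
rewrite (symwE (E (a *: x + y))) (symwE (E x)) (symwE (E y)) /sympure.
have lt_p : (size p < n.+1)%N by rewrite ltnS leq_addr.
have U z : [ffun i : 'I_n.+1 => nth 0 (p ++ z :: q) i] =
    update [ffun i : 'I_n.+1 => nth 0 (p ++ 0 :: q) i] (Ordinal lt_p) z.
  apply/ffunP => i; rewrite !ffunE -val_eqE /= !nth_cat.
  case: (ltngtP i (size p)) => // [lt_pi|->]; last by rewrite subnn.
  by rewrite -[(i - size p)%N]prednK ?subn_gt0.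
rewrite (U (a *: x + y)) (U x) (U y) tpure_multilinear; exact: (linearP (sym_pi n)).
Qed.

Definition mkw n (w : seq g) (s : {perm 'I_n}) : seq g :=
  [seq nth 0 w (s i) | i <- enum 'I_n].

Lemma size_mkw n w s : size (@mkw n w s) = n.
Proof. by rewrite size_map size_enum_ord. Qed.

Lemma nth_mkw n w s (i : 'I_n) : nth 0 (@mkw n w s) i = nth 0 w (s i).
Proof. by rewrite (nth_map i) ?size_enum_ord // nth_ord_enum. Qed.

Lemma symw_mkw n w s : size w = n -> symw (@mkw n w s) = symw w.
Proof.
case: n s => [|n] s sw; first by rewrite /mkw (size0nil (size_enum_ord 0)) (size0nil sw).
rewrite (symwE sw) (symwE (size_mkw w s)) /sympure.
rewrite -(sym_pi_perm s (tpure [ffun i : 'I_n.+1 => nth 0 w i])) tpow_perm_pure.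
by congr (sym_pi n (tpure _)); apply/ffunP => i; rewrite !ffunE nth_mkw.
Qed.

Lemma perm_mkw n w s : size w = n -> perm_eq (@mkw n w s) w.
Proof.
move=> sw; rewrite -[X in perm_eq _ X](mkseq_nth 0) sw /mkseq -val_enum_ord -map_comp.
rewrite /mkw (map_comp (fun i : 'I_n => nth 0 w i) s); apply: perm_map.
apply: uniq_perm; rewrite ?enum_uniq ?(map_inj_uniq (@perm_inj _ s)) ?enum_uniq //.
by move=> i; rewrite mem_enum inE -[i](permKV s) map_f // mem_enum.
Qed.

(* [swp] exchanges, and [ctr] below contracts, the letters [i] and [i.+1]. *)
Fixpoint swp i (w : seq g) : seq g :=
  match i, w with
  | 0, [:: x, y & q] => [:: y, x & q]
  | i'.+1, x :: q => x :: swp i' q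
  | _, _ => w
  end.

Lemma swp_cat (p : seq g) i q : swp (size p + i) (p ++ q) = p ++ swp i q.
Proof. by elim: p => //= x p ->. Qed.

Lemma size_swp i w : size (swp i w) = size w.
Proof. by elim: i w => [|i IH] [|x w] //=; [case: w|rewrite IH]. Qed.

Lemma swp_split i (w : seq g) : (i.+1 < size w)%N ->
  exists (p : seq g) x y q, size p = i /\ w = p ++ [:: x, y & q].
Proof.
elim: i w => [|i IH] [|x w] //=.
  by case: w => // y q _; exists [::], x, y, q.
by rewrite ltnS => /IH[p [u [v [q [<- ->]]]]]; exists (x :: p), u, v, q.
Qed.

Lemma swpK i w : swp i (swp i w) = w.
Proof. by elim: i w => [|i IH] [|x w] //=; [case: w|rewrite IH]. Qed.

Lemma swp_mkw n w s i (lt_i : (i.+1 < n)%N) :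
  swp i (@mkw n w s) = mkw w (tperm (Ordinal (ltnW lt_i)) (Ordinal lt_i) * s).
Proof.
have [|p [x [y [q [sp E]]]]] := @swp_split i (mkw w s); first by rewrite size_mkw.
have H j : (j < n)%N -> nth 0 (swp i (mkw w s)) j =
    nth 0 (mkw w s) (if j == i then i.+1 else if j == i.+1 then i else j).
  rewrite E -{1}[i]addn0 -sp swp_cat /= !nth_cat => _.
  case: (eqVneq j (size p)) => [->|ne]; first by rewrite ltnn ltnNge leqnSn subnn subSnn.
  case: (eqVneq j (size p).+1) => [->|ne'].
    by rewrite ltnn subnn ltnNge leqnSn subSnn.
  case: ltnP => // le; rewrite -(subnKC le) addKn.
  case E': (j - size p)%N => [|[|m]] //.
    by case/eqP: ne; apply/eqP; rewrite eqn_leq le -subn_eq0 E'.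
  by case/eqP: ne'; rewrite -(subnKC le) E' addn1.
apply: (@eq_from_nth _ 0) => [|j]; first by rewrite size_swp !size_mkw.
rewrite size_swp size_mkw => lt_j; rewrite H //.
rewrite (nth_mkw _ _ (Ordinal lt_j)) permM.
case: tpermP => [E'|E'|/eqP + /eqP].
- have -> : j = i by exact: (congr1 val E').
  by rewrite eqxx -(nth_mkw w s (Ordinal lt_i)).
- have -> : j = i.+1 by exact: (congr1 val E').
  by rewrite -[_.+1 == _]negbK neq_ltn leqnn orbT eqxx -(nth_mkw w s (Ordinal (ltnW lt_i))).
rewrite -!val_eqE /= => /negPf -> /negPf ->.
exact: (nth_mkw w s (Ordinal lt_j)).
Qed.

End Words.

(** * Transpositions corrected by brackets, and their averages *)

Section Contraction.
Variables (k : fieldType) (g : lieType k).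

Fixpoint ctr i (w : seq g) : seq g :=
  match i, w with
  | 0, [:: x, y & q] => lieb x y :: q
  | i'.+1, x :: q => x :: ctr i' q
  | _, _ => w
  end.

Lemma ctr_cat (p : seq g) i q : ctr (size p + i) (p ++ q) = p ++ ctr i q.
Proof. by elim: p => //= x p ->. Qed.

Lemma lieb_anti (x y : g) : lieb y x = - lieb x y.
Proof.
apply/eqP; rewrite -addr_eq0.
have DL (u v w : g) : lieb (u + v) w = lieb u w + lieb v w.
  by rewrite -[u]scale1r lieb_linl !scale1r.
have DR (u v w : g) : lieb w (u + v) = lieb w u + lieb w v.
  by rewrite -[u]scale1r lieb_linr !scale1r.
have := lieb_alt (x + y); rewrite DL !DR !lieb_alt add0r addr0 => E.
by rewrite addrC E.
Qed.

Lemma liebNr (x y : g) : lieb x (- y) = - lieb x y.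
Proof.
have := lieb_linr (-1) x y 0; have := lieb_linr 1 x 0 0.
rewrite !scale1r !scaleN1r !addr0 => E ->.
by rewrite -[X in _ + X](addrK (lieb x 0)) -E subrr addr0.
Qed.

(* Compatibility with the relations of the enveloping algebra of [g]. *)
Definition ucomp (V : lmodType k) (phi : seq g -> V) :=
  mlin id phi /\
  forall p q x y, phi (p ++ [:: x, y & q]) - phi (p ++ [:: y, x & q]) = phi (p ++ lieb x y :: q).

Lemma swpE (p : seq g) x y q : swp (size p) (p ++ [:: x, y & q]) = p ++ [:: y, x & q].
Proof. by rewrite -[size p]addn0 swp_cat. Qed.

Lemma ctrE (p : seq g) x y q : ctr (size p) (p ++ [:: x, y & q]) = p ++ lieb x y :: q.
Proof. by rewrite -[size p]addn0 ctr_cat. Qed.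

Section Averaging.
Variables (V : lmodType k) (s : seq g -> V) (n : nat).
Hypothesis s_mlin : mlin id s.
Hypothesis s_rel : forall p q x y, (size p + size q < n.-1)%N ->
  s (p ++ [:: x, y & q]) - s (p ++ [:: y, x & q]) = s (p ++ lieb x y :: q).
Implicit Types (F G : seq g -> V) (w : seq g).

(** Here [s] is the map already built on words of length at most [n], and [F] a candidate on words
    of length [n.+1]. It is fixed by [tau i] exactly if it satisfies the bracket relation at the
    letters [i] and [i.+1]. *)
Definition tau i F w : V := F (swp i w) + s (ctr i w).

Let eqn F G := forall w, size w = n.+1 -> F w = G w.

Lemma tau_eq i F G : eqn F G -> eqn (tau i F) (tau i G).
Proof. by move=> E w sw; rewrite /tau E // size_swp. Qed.

Lemma sN p x q : s (p ++ - x :: q) = - s (p ++ x :: q).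
Proof.
by have := s_mlin p q (-1) x 0; rewrite (mlin0 p q s_mlin) !scaleN1r !addr0.
Qed.

Lemma sD p x y q : s (p ++ (x + y) :: q) = s (p ++ x :: q) + s (p ++ y :: q).
Proof. by have := s_mlin p q 1 x y; rewrite !scale1r. Qed.

Lemma tau_tau i F : (i < n)%N -> eqn (tau i (tau i F)) F.
Proof.
move=> lt_i w sw; rewrite /tau swpK.
have [|p [x [y [q [<- ->]]]]] := @swp_split _ g i w; first by rewrite sw.
rewrite -[size p]addn0 swp_cat !ctr_cat /= lieb_anti sN -addrA.
by rewrite addNr addr0.
Qed.

Lemma swp_split2 i w : (i.+2 < size w)%N ->
  exists (p : seq g) x y z q, size p = i /\ w = p ++ [:: x, y, z & q].
Proof.
move=> lt_i; have [p [x [y [q [sp E]]]]] := swp_split (ltnW lt_i).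
rewrite E size_cat /= sp in lt_i; case: q E lt_i => [|z q] E.
  by rewrite addnS addn1 ltnn.
by exists p, x, y, z, q.
Qed.

(** The two orders differ by exchanges of two letters in words already contracted elsewhere; [s_rel]
    evaluates both differences to the doubly contracted word. *)
Lemma tau_comm i j F : (i.+1 < j)%N -> (j < n)%N ->
  eqn (tau i (tau j F)) (tau j (tau i F)).
Proof.
move=> lt_ij lt_j w sw.
have [p [x [y [m [u [v [r [Ei [Ej Ew]]]]]]]]] : exists p x y m u v r,
    [/\ size p = i, j = (size p + (size m).+2)%N
       & w = p ++ [:: x, y & m ++ [:: u, v & r]] :> seq g].
  have [|p [x [y [q [sp E]]]]] := @swp_split _ g i w.
    by rewrite sw ltnS; apply: leq_trans (ltnW lt_j); apply: ltnW.
  have Ej : j = (size p + (j - i.+2).+2)%N by rewrite sp !addnS -!addSn subnKC.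
  have [|m [u [v [r [sm Eq]]]]] := @swp_split _ g (j - i.+2) q.
    have : (j.+1 < size w)%N by rewrite sw ltnS.
    by rewrite E size_cat /= [in X in (X < _)%N -> _]Ej -addnS ltn_add2l.
  by exists p, x, y, m, u, v, r; rewrite sm E Eq; split.
have sz : ((size p + (size m + size r)).+2 < n)%N.
  by move: sw; rewrite Ew size_cat /= size_cat /=; lia.
subst i w; rewrite /tau !swpE !ctrE.
have S2 a b c d : swp j (p ++ [:: a, b & m ++ [:: c, d & r]]) =
    p ++ [:: a, b & m ++ [:: d, c & r]].
  by rewrite Ej swp_cat /= swpE.
have C2 a b c d : ctr j (p ++ [:: a, b & m ++ [:: c, d & r]]) =
    p ++ [:: a, b & m ++ lieb c d :: r].
  by rewrite Ej ctr_cat /= ctrE.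
rewrite !S2 !C2 swpE ctrE -!addrA; congr (_ + _).
have R1 := @s_rel p (m ++ lieb u v :: r) x y.
have R2 := @s_rel (p ++ lieb x y :: m) r u v.
rewrite !size_cat /= -!catA /= in R1 R2.
have {}R1 := R1 ltac:(lia); have {}R2 := R2 ltac:(lia).
by apply/eqP; rewrite -subr_eq0 [X in _ - X]addrC opprD addrACA -opprB R1 R2 addNr.
Qed.

(** The six contracted words pair off under [s_rel] into three double brackets, whose sum vanishes
    by the Jacobi identity. *)
Lemma tau_braid i F : (i.+1 < n)%N ->
  eqn (tau i (tau i.+1 (tau i F))) (tau i.+1 (tau i (tau i.+1 F))).
Proof.
move=> lt_i w sw; have [|p [x [y [z [q [Ei Ew]]]]]] := @swp_split2 i w.
  by rewrite sw ltnS.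
have sz : ((size p + size q).+2 = n)%N.
  by move: sw; rewrite Ew size_cat /= !addnS => -[].
have S2 a b c : swp i.+1 (p ++ [:: a, b, c & q]) = p ++ [:: a, c, b & q].
  by rewrite -Ei -addn1 swp_cat.
have C2 a b c : ctr i.+1 (p ++ [:: a, b, c & q]) = p ++ [:: a, lieb b c & q].
  by rewrite -Ei -addn1 ctr_cat.
subst w; rewrite /tau S2 C2 -Ei !swpE !ctrE Ei !S2 !C2 -Ei !swpE !ctrE -!addrA; congr (_ + _).
have R1 := @s_rel p q (lieb y z) x; have R2 := @s_rel p q y (lieb x z).
have R3 := @s_rel p q (lieb x y) z.
have lt_pq : (size p + size q < n.-1)%N by lia.
apply/eqP; rewrite -subr_eq0 !opprD !addrA.
rewrite [X in X == _](ACl ((1*6)*(2*5)*(3*4))) /= R1 // R2 // R3 // -!sD.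
rewrite (lieb_anti x) (lieb_anti z x) liebNr (lieb_anti z (lieb x y)).
by rewrite -!opprD lieb_jacobi oppr0 (mlin0 p q s_mlin).
Qed.

(** The coset representatives in [average] are [chain j (m.+1 - j)], the cycles composed of [tau j],
    ..., [tau m]; for [j] equal to [m.+1] this is the identity. *)
Fixpoint chain j m F : seq g -> V :=
  if m is m'.+1 then tau j (chain j.+1 m' F) else F.

(* As [tau 0, ..., tau m] satisfy the relations of the adjacent transpositions,
   the average below, which extends over the cosets of the subgroup generated by
   all but the last of them, is invariant under all of them. *)
Fixpoint average m F : seq g -> V :=
  if m is m'.+1 then
    fun w => m'.+2%:R^-1 *: \sum_(j < m'.+2) chain j (m'.+1 - j) (average m' F) w
  else F.

Lemma chain_eq j m F G : eqn F G -> eqn (chain j m F) (chain j m G).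
Proof. by move=> E; elim: m j => //= m IH j; apply: tau_eq. Qed.

Lemma chain_comm i j m F : (i.+1 < j)%N -> (j + m <= n)%N ->
  eqn (tau i (chain j m F)) (chain j m (tau i F)).
Proof.
elim: m j => //= m IH j lt_ij le_n w sw; rewrite tau_comm //; last by lia.
by apply: tau_eq sw => {}w sw; apply: IH => //; lia.
Qed.

(** Conjugation by a cycle shifts generators: [tau i.+1] moves past the factors before [tau i], the
    braid relation turns it into [tau i], and this commutes with the factors that remain. *)
Lemma chain_braid i j m F : (j <= i)%N -> (i.+1 < j + m)%N -> (j + m <= n)%N ->
  eqn (tau i.+1 (chain j m F)) (chain j m (tau i F)).
Proof.
elim: m j => [|m IH] j le_ji lt_i le_n w sw; first by lia.
rewrite /=; case: (eqVneq j i) => [Eij|ne_ij].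
  subst j; case: m {IH} lt_i le_n => [|m] lt_i le_n; first by lia.
  rewrite /= -tau_braid //; last by lia.
  do 2!apply: tau_eq sw => {}w sw.
  by apply: chain_comm => //; lia.
rewrite -tau_comm //; try lia.
by apply: tau_eq sw => {}w sw; apply: IH => //; lia.
Qed.

Hypothesis char0 : [pchar k] =i pred0.

Lemma natS_neq0 m : m.+1%:R != 0 :> k.
Proof. by rewrite (pcharf0P _).1. Qed.

Lemma average_tau m F i : (m <= n)%N -> (i < m)%N -> eqn (tau i (average m F)) (average m F).
Proof.
elim: m i => // m IH i le_mn lt_im w sw /=.
pose G := average m F; pose c (j : 'I_m.+2) := chain j (m.+1 - j) G.
have lt_i1 : (i < m.+2)%N by lia.
have lt_i2 : (i.+1 < m.+2)%N by lia.
pose t := tperm (Ordinal lt_i1) (Ordinal lt_i2).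
(* [tau i] exchanges the representatives [i] and [i.+1]. It moves past every other one, as [tau i]
   or [tau i.-1], and is absorbed by [average m F] by induction. *)
have T j : tau i (c j) w = c (t j) w.
  rewrite /c /t; case: tpermP => [->|->|/eqP + /eqP] /=.
  - have -> : (m.+1 - i = (m.+1 - i.+1).+1)%N by lia.
    by rewrite /= tau_tau //; lia.
  - by have -> : (m.+1 - i = (m.+1 - i.+1).+1)%N by lia.
  rewrite -!val_eqE /= => ne1 ne2; have := ltn_ord j => lt_j.
  case: (ltngtP i j) ne1 => // lt_ij _.
    rewrite chain_comm //; try lia.
    by apply: chain_eq sw => {}w sw; apply: IH => //; lia.
  case: i lt_im lt_i1 lt_i2 t ne2 lt_ij => [|i] lt_im lt_i1 lt_i2 t ne2 lt_ij; first by lia.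
  rewrite chain_braid //; try lia.
  by apply: chain_eq sw => {}w sw; apply: IH => //; lia.
rewrite /tau -/G.
(* [tau i] is affine and the weights add up to 1, so it commutes with the mean: the correction term
   is counted [m.+2] times and divided by [m.+2]. *)
transitivity (m.+2%:R^-1 *: \sum_(j < m.+2) tau i (c j) w).
  rewrite /tau big_split scalerDr /=; congr (_ + _).
  rewrite sumr_const card_ord -scaler_nat scalerA mulVf ?scale1r //.
  exact: natS_neq0.
congr (_ *: _); rewrite [RHS](reindex_inj (@perm_inj _ t)).
by apply: eq_bigr => j _; apply: T.
Qed.

Lemma average_mlin m F : mlin id F -> mlin id (average m F).
Proof.
have tau_mlin i G : mlin id G -> mlin id (tau i G).
  move=> GP; move=> p q a x y; rewrite /tau scalerDr addrACA; congr (_ + _).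
    have [p' [q' E]] : exists p' q', forall z, swp i (p ++ z :: q) = p' ++ z :: q'.
      elim: i p => [|i IH] [|b p].
      - by case: q => [|b q]; [exists [::], [::]|exists [:: b], q].
      - by case: p => [|c p]; [exists [::], (b :: q)|exists (c :: b :: p), q].
      - by exists [::], (swp i q).
      - by have [p' [q' E]] := IH p; exists (b :: p'), q' => z /=; rewrite E.
    by rewrite !E GP.
  have [p' [q' [L [LP E]]]] : exists p' q' L, (forall b u v, L (b *: u + v) = b *: L u + L v)
      /\ (forall z, ctr i (p ++ z :: q) = p' ++ L z :: q').
    elim: i p => [|i IH] [|b p].
    - case: q => [|b q]; first by exists [::], [::], id.
      by exists [::], q, (fun z => lieb z b); split=> // c u v; rewrite lieb_linl.
    - case: p => [|c p]; last by exists (lieb b c :: p), q, id.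
      by exists [::], q, (fun z => lieb b z); split=> // c u v; rewrite lieb_linr.
    - by exists [::], (ctr i q), id.
    - have [p' [q' [L [LP E]]]] := IH p; exists (b :: p'), q', L; split=> // z /=.
      by rewrite E.
  by rewrite !E LP s_mlin.
have chain_mlin G l j : mlin id G -> mlin id (chain j l G).
  by move=> GP; elim: l j => //= l IH j; apply: tau_mlin.
move=> FP; elim: m => //= m IH p q a x y.
rewrite scalerA [a * _]mulrC -scalerA -scalerDr; congr (_ *: _).
rewrite scaler_sumr -big_split; apply: eq_bigr => j _.
exact: chain_mlin.
Qed.

End Averaging.

End Contraction.

(** * The Poincaré-Birkhoff-Witt theorem by symmetrization *)

Section PBW.
Variables (k : fieldType) (char0 : [pchar k] =i pred0) (g : lieType k).

(** Over all rearrangements the corrections cancel in pairs, as exchanging two letters changes the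
    sign of their bracket. *)
Lemma tot_average (V : lmodType k) (s F : seq g -> V) n m w :
  mlin id s -> size w = n.+1 -> (m <= n)%N ->
  \sum_(t : 'S_n.+1) average s m F (mkw w t) = \sum_(t : 'S_n.+1) F (mkw w t).
Proof.
move=> sP sw.
have ttau i G : (i < n)%N ->
    \sum_(t : 'S_n.+1) tau s i G (mkw w t) = \sum_(t : 'S_n.+1) G (mkw w t).
  move=> lt_i; have lt_i' : (i.+1 < n.+1)%N by lia.
  rewrite /tau big_split /=; set X := (X in _ + X).
  have X0 : X = 0.
    have : X = - X.
      rewrite {1}/X (reindex_inj (mulgI (tperm (Ordinal (ltnW lt_i')) (Ordinal lt_i')))) /=.
      rewrite -sumrN; apply: eq_bigr => t _; rewrite -swp_mkw.
      have [|p [x [y [q [<- ->]]]]] := @swp_split _ g i (mkw w t); first by rewrite size_mkw.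
      by rewrite swpE !ctrE (lieb_anti x) (sN sP).
    move/eqP; rewrite -subr_eq0 opprK -mulr2n -scaler_nat scaler_eq0.
    by rewrite (negPf (natS_neq0 char0 1)) => /eqP.
  rewrite X0 addr0 [RHS](reindex_inj (mulgI (tperm (Ordinal (ltnW lt_i')) (Ordinal lt_i')))).
  by apply: eq_bigr => t _; rewrite swp_mkw.
have tchain l j G : (j + l <= n)%N ->
    \sum_(t : 'S_n.+1) chain s j l G (mkw w t) = \sum_(t : 'S_n.+1) G (mkw w t).
  by elim: l j => //= l IH j le; rewrite ttau ?IH //; lia.
elim: m => //= m IH le_m; rewrite -scaler_sumr exchange_big /=.
rewrite (eq_bigr (fun=> \sum_(t : 'S_n.+1) F (mkw w t))) => [|j _].
  rewrite sumr_const card_ord -scaler_nat scalerA mulVf ?scale1r //.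
  exact: natS_neq0.
by rewrite tchain ?IH //; have := ltn_ord j; lia.
Qed.

(** At a new length the commutative monomial is averaged with [sigma_rec n'] as the correction; the
    result extends the map on shorter words compatibly with brackets. *)
Fixpoint sigma_rec n (w : seq g) : sym_plus g :=
  if n is n'.+1 then
    if (size w <= n')%N then sigma_rec n' w
    else average (sigma_rec n') n' (@symw k g) w
  else 0.

(* The inverse of the symmetrization map, on words in [g]. *)
Definition sigma (w : seq g) := sigma_rec (size w) w.

Lemma sigma_recE n w : (size w <= n)%N -> sigma_rec n w = sigma w.
Proof.
elim: n => [|n IH]; first by case: w.
rewrite leq_eqVlt => /orP[/eqP E|]; first by rewrite -E.
by rewrite ltnS => le /=; rewrite le IH.
Qed.

Lemma sigma_rec_mlin n : mlin id (sigma_rec n).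
Proof.
elim: n => [|n IH] p q a x y /=; first by rewrite scaler0 addr0.
have E z : size (p ++ z :: q) = (size p + size q).+1 by rewrite size_cat addnS.
rewrite !E; case: ifP => _; first exact: IH.
exact: (average_mlin IH n (@symw_mlin k g)).
Qed.

(** At the top length the relation is the invariance of the average under [tau]. *)
Lemma sigma_rec_rel n p q x y : (size p + size q < n.-1)%N ->
  sigma_rec n (p ++ [:: x, y & q]) - sigma_rec n (p ++ [:: y, x & q]) =
  sigma_rec n (p ++ lieb x y :: q).
Proof.
elim: n p q x y => // n IH p q x y lt_pq /=; rewrite !size_cat /= !addnS.
have -> : (size p + size q < n)%N by lia.
case: ifP => lt; first by apply: IH; lia.
have sw z t : size (p ++ [:: z, t & q]) = n.+1 by rewrite size_cat /=; lia.
have lt_p : (size p < n)%N by lia.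
rewrite -(average_tau (@sigma_rec_mlin n) IH char0 _ (leqnn n) lt_p (sw x y)).
by rewrite /tau swpE ctrE addrAC subrr add0r.
Qed.

Lemma sigma_ucomp : ucomp sigma.
Proof.
split=> [p q a x y|p q x y].
  pose n := (size p + size q).+1.
  have E z : sigma (p ++ z :: q) = sigma_rec n (p ++ z :: q).
    by rewrite sigma_recE // size_cat addnS.
  by rewrite !E; apply: sigma_rec_mlin.
pose n := (size p + size q).+2.
have E z t : sigma (p ++ [:: z, t & q]) = sigma_rec n (p ++ [:: z, t & q]).
  by rewrite sigma_recE // size_cat /= !addnS.
rewrite !E sigma_rec_rel ?sigma_recE // size_cat /=; lia.
Qed.

(** By [tot_average] symmetrizing undoes the corrections, so [sigma] after symmetrization is the
    identity of S(g). *)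
Lemma sigma_sym w : \sum_(t : 'S_(size w)) sigma (mkw w t) = (size w)`!%:R *: symw w.
Proof.
case E : (size w) => [|n].
  rewrite (size0nil E) scaler0 big1 // => t _.
  by rewrite /sigma /mkw (size0nil (size_enum_ord 0)).
rewrite (eq_bigr (fun t => average (sigma_rec n) n (@symw k g) (mkw w t))).
  rewrite tot_average //; last exact: sigma_rec_mlin.
  rewrite (eq_bigr (fun=> symw w)) => [|t _]; last by rewrite symw_mkw.
  by rewrite sumr_const card_Sn scaler_nat.
by move=> t _; rewrite /sigma size_mkw /= size_mkw ltnn.
Qed.

Lemma fact_neq0 n : n`!%:R != 0 :> k.
Proof. by rewrite (pcharf0P _).1 // -lt0n fact_gt0. Qed.

(** By [sigma_sym] every monomial is a mean of values of [sigma], so a label may be taken to be a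
    nonempty word. *)
Lemma sigma_elim (P : sym_plus g -> Prop) :
  P 0 -> (forall a x y, P x -> P y -> P (a *: x + y)) ->
  (forall x w, P (sigma (x :: w))) -> forall v, P v.
Proof.
move=> P0 PL Ps; have PD x y : P x -> P y -> P (x + y).
  by move=> Px Py; rewrite -[x]scale1r; apply: PL.
have PZ a x : P x -> P (a *: x) by move=> Px; rewrite -[_ *: _]addr0; apply: PL.
apply: dsum_elim => // n; elim/quot_pi_surj => t.
rewrite -[dinj _]/(sym_pi g n t).
elim/tpow_elim: t => [|a t u Pt Pu|v]; first by rewrite raddf0.
  by rewrite linearP; apply: PL.
pose w := [seq v i | i <- enum 'I_n.+1].
have sw : size w = n.+1 by rewrite size_map size_enum_ord.
have -> : sym_pi g n (tpure v) = symw w.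
  rewrite (symwE sw) /sympure; congr (sym_pi _ _ (tpure _)); apply/ffunP => i.
  by rewrite ffunE (nth_map i) ?size_enum_ord // nth_ord_enum.
have -> : symw w = ((size w)`!%:R)^-1 *: \sum_(s : 'S_(size w)) sigma (mkw w s).
  by rewrite sigma_sym scalerA mulVf ?scale1r // fact_neq0.
apply: PZ; elim/big_ind: _ => // s _.
by case E : (mkw w s) (size_mkw w s) => [|x u] //; rewrite sw.
Qed.

Section Hat.
Variables (Z : lmodType k) (phi : seq g -> Z).
Hypothesis phiP : ucomp phi.

Definition wavg n (v : {ffun 'I_n -> g}) : Z :=
  n`!%:R^-1 *: \sum_(t : 'S_n) phi [seq v (t i) | i <- enum 'I_n].

Fact wavg_multilinear n : multilinear (@wavg n).
Proof.
move=> v i a x y; rewrite /wavg scalerA [a * _]mulrC -scalerA -scalerDr; congr (_ *: _).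
rewrite scaler_sumr -big_split; apply: eq_bigr => t _ /=.
have [p [q E]] : exists p q, forall z,
    [seq update v i z (t j) | j <- enum 'I_n] = p ++ z :: q.
  have := enum_uniq 'I_n; have : t^-1%g i \in enum 'I_n by rewrite mem_enum.
  case/splitPr => p q; rewrite cat_uniq /= => /and3P[_ /norP[nip _] /andP[niq _]].
  exists [seq v (t j) | j <- p], [seq v (t j) | j <- q] => z.
  rewrite map_cat /= ffunE permKV eqxx; congr (_ ++ _ :: _).
    apply/eq_in_map => j jp; rewrite ffunE; case: eqP => // E.
    by move: nip; rewrite -E permK jp.
  apply/eq_in_map => j jq; rewrite ffunE; case: eqP => // E.
  by move: niq; rewrite -E permK jq.
by rewrite !E (phiP.1 p q).
Qed.

Fact hat_subproof n z : sym_rel z -> tpow_lift (@wavg_multilinear n) z = 0.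
Proof.
case=> s u; rewrite linearB; apply/eqP; rewrite subr_eq0; apply/eqP.
elim/tpow_elim: u => [|a x y Ex Ey|v]; first by rewrite !raddf0.
  by rewrite !linearP Ex Ey.
rewrite tpow_perm_pure !tpow_lift_pure /wavg; congr (_ *: _).
rewrite [RHS](reindex_inj (mulIg s)); apply: eq_bigr => t _; congr phi.
by apply: eq_map => i; rewrite ffunE permM.
Qed.

(** [phi] composed with symmetrization: the linear map that [phi] induces on U(g), transported to
    S(g). *)
Definition hat : {linear sym_plus g -> Z} :=
  dsum_lift (fun n => quot_lin (@hat_subproof n.+1)).

Lemma hat_pure n (v : {ffun 'I_n.+1 -> g}) : hat (sym_pi g n (tpure v)) = wavg v.
Proof.
apply: etrans (dsum_lift_inj _ _) _; apply: etrans (quot_lin_pi _ _) _.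
exact: tpow_lift_pure.
Qed.

Lemma hat_symw n w : size w = n.+1 ->
  n.+1`!%:R *: hat (symw w) = \sum_(t : 'S_n.+1) phi (mkw w t).
Proof.
move=> sw; rewrite (symwE sw) hat_pure /wavg scalerA mulfV ?fact_neq0 // scale1r.
apply: eq_bigr => t _; congr phi; apply: eq_map => i.
by rewrite ffunE.
Qed.

(** The defect [G] on words of a fixed length is symmetric, since its bracket terms are shorter and
    vanish by induction. Its sum over all rearrangements is zero, since both of its terms have the
    same symmetrization. *)
Lemma hat_sigma x w : hat (sigma (x :: w)) = phi (x :: w).
Proof.
have [n] := ubnP (size w); elim: n x w => // n IH x w lt_n; pose N := (size w).+1.
have hatB u v : hat u - hat v = hat (u - v) by rewrite -(raddfB hat).
pose G (u : seq g) := if size u == N then hat (sigma u) - phi u else 0.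
have GS : sym2 G.
  move=> p q a b; rewrite /G !size_cat /=; case: eqP => // E; apply/eqP.
  rewrite -subr_eq0 opprD addrACA -opprD hatB sigma_ucomp.2 phiP.2 subr_eq0.
  apply/eqP; case: p E => [|c p] /= E; first by apply: IH; lia.
  by apply: IH; rewrite size_cat /=; lia.
have EG u : size u = N -> G u = hat (sigma u) - phi u by move=> E; rewrite /G E eqxx.
apply/eqP; rewrite -subr_eq0 -EG //.
have : N`!%:R *: G (x :: w) = 0.
  transitivity (\sum_(t : 'S_N) G (mkw (x :: w) t)).
    rewrite (eq_bigr (fun=> G (x :: w))) => [|t _].
      by rewrite sumr_const card_Sn scaler_nat.
    by apply: sym2_perm => //; apply: perm_mkw.
  rewrite (eq_bigr _ (fun t _ => EG _ (size_mkw (x :: w) t))) big_split /= sumrN.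
  have -> : \sum_(t : 'S_N) hat (sigma (mkw (x :: w) t)) = hat (N`!%:R *: symw (x :: w)).
    by rewrite -(sigma_sym (x :: w)) (raddf_sum hat).
  by rewrite -hat_symw // (linearZZ hat) subrr.
by move/eqP; rewrite scaler_eq0 (negPf (fact_neq0 N)).
Qed.

End Hat.

End PBW.

(** * Decorated trees *)

Section Tensor.
Variables (k : fieldType) (G : Type) (M N : lmodType k).
Variables (rho : G -> M -> M) (lam : G -> N -> N).

Lemma tensor_elim (P : tensor rho lam -> Prop) :
  P 0 -> (forall a x y, P x -> P y -> P (a *: x + y)) ->
  (forall x y, P (tensor_pure rho lam x y)) -> forall z, P z.
Proof.
move=> P0 PL Pp; elim/quot_pi_surj; elim/freeg_elim => [|a [x y] D IH].
  by rewrite raddf0.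
by rewrite linearP; apply: PL => //; apply: Pp.
Qed.

Variables (Z : lmodType k) (B : M -> N -> Z).
Hypothesis B_linl : forall a x y z, B (a *: x + y) z = a *: B x z + B y z.
Hypothesis B_linr : forall a x y z, B x (a *: y + z) = a *: B x y + B x z.
Hypothesis B_bal : forall s x y, B (rho s x) y = B x (lam s y).

Fact tensor_lift_subproof D :
  tensor_rel rho lam D -> fglift (fun u => B u.1 u.2) D = 0.
Proof.
by case=> [a x y z|a x y z|s x y];
  rewrite linearB ?linearP /= !fglift_gen /= ?B_linl ?B_linr ?B_bal ?scalerN -?opprD subrr.
Qed.

Definition tensor_lift : {linear tensor rho lam -> Z} := quot_lin tensor_lift_subproof.

Lemma tensor_lift_pure x y : tensor_lift (tensor_pure rho lam x y) = B x y.
Proof. by rewrite quot_lin_pi /= fglift_gen. Qed.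

End Tensor.

Section DecoratedTrees.
Variables (k : fieldType) (W : lmodType k).

Lemma RT_elim (I : finType) (P : RT_obj k I -> Prop) :
  P 0 -> (forall a t (D : RT_obj k I), P D -> P (a *: (fgen k t : RT_obj k I) + D)) ->
  forall D, P D.
Proof. exact: freeg_elim. Qed.

(** Vertex sets are arbitrary finite types, so that grafting and passing to subtrees need no
    renumbering; [cls] passes to ordinals. *)
Record dtree := DTree {
  dt_vert : finType; dt_tree : rtree_ne1 dt_vert; dt_lab : dt_vert -> W }.

Definition par (Q : dtree) (x : dt_vert Q) : option (dt_vert Q) := val (dt_tree Q) x.

Definition diso (Q Q' : dtree) := exists f : dt_vert Q -> dt_vert Q',
  [/\ bijective f, forall x, par (f x) = omap f (par x)
    & forall x, dt_lab (f x) = dt_lab x].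

Notation T := (schur (RT_ne1 k) W).

Definition pureT n (t : rtree_ne1 'I_n) (v : {ffun 'I_n -> W}) : T :=
  dinj (V := fun n => tensor (@sp_perm k (RT_ne1 k) n) (fun s => tpow_perm W s))
    (tensor_pure (@sp_perm k (RT_ne1 k) n) (fun s => tpow_perm W s) (fgen k t) (tpure v)).

Definition cls (Q : dtree) : T :=
  pureT (rtree_relabel (enum_rank_bij (dt_vert Q)) (dt_tree Q))
    [ffun i => dt_lab (enum_val i)].

Lemma rtree_relabel_eq (I J : finType) (f : I -> J) (fb : bijective f)
    (t : rtree_ne1 I) (t' : rtree_ne1 J) :
  (forall x, val t' (f x) = omap f (val t x)) -> rtree_relabel fb t = t'.
Proof.
move=> E; apply/val_inj/ffunP => j; have [h _ hK] := fb.
by rewrite -[j]hK E /= relabelE.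
Qed.

(** A relabelling moves across the tensor product over the group algebra and becomes a permutation
    of the labels. *)
Lemma pureT_iso n m (f : 'I_n -> 'I_m) (fb : bijective f) t v :
  pureT (rtree_relabel fb t) v = pureT t [ffun i => v (f i)].
Proof.
have E : n = m by have := bij_eq_card fb; rewrite !card_ord.
subst m; pose s := perm (bij_inj fb).
rewrite /pureT; congr dinj.
have -> : fgen k (rtree_relabel fb t) = @sp_perm k (RT_ne1 k) n s (fgen k t).
  rewrite /sp_perm /= fglift_gen; congr fgen; apply: rtree_relabel_eq => x.
  by rewrite -(permE (bij_inj fb)) relabelE; [|apply: injF_bij perm_inj];
     case: (val t x) => //= y; rewrite permE.
rewrite tensor_pure_balanced tpow_perm_pure; congr (tensor_pure _ _ _ (tpure _)).
by apply/ffunP => i; rewrite !ffunE permE.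
Qed.

Lemma cls_iso Q Q' : diso Q Q' -> cls Q = cls Q'.
Proof.
case=> f [fb fp fl]; have [h fK hK] := fb.
pose r (i : 'I_#|dt_vert Q|) := enum_rank (f (enum_val i)).
have rb : bijective r.
  exists (fun i : 'I_#|dt_vert Q'| => enum_rank (h (enum_val i))) => i; rewrite /r enum_rankK ?fK ?hK ?enum_valK //.
rewrite /cls.
have -> : rtree_relabel (enum_rank_bij (dt_vert Q')) (dt_tree Q') =
    rtree_relabel rb (rtree_relabel (enum_rank_bij (dt_vert Q)) (dt_tree Q)).
  apply/esym/rtree_relabel_eq => x; rewrite -[x]enum_valK /r enum_rankK.
  rewrite /= !relabelE; try exact: enum_rank_bij.
  have := fp (enum_val x); rewrite /par /= => ->; case: (sval (dt_tree Q) _) => //= y.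
  by rewrite enum_rankK.
rewrite pureT_iso; congr pureT; apply/ffunP => i.
by rewrite !ffunE enum_rankK fl.
Qed.

Lemma cls_ord n (t : rtree_ne1 'I_n) (v : 'I_n -> W) :
  cls (DTree t v) = pureT t [ffun i => v i].
Proof.
by rewrite /cls pureT_iso; congr pureT; apply/ffunP => i; rewrite !ffunE /= enum_rankK.
Qed.

Lemma pureT_cls n (t : rtree_ne1 'I_n) v : pureT t v = cls (DTree t v).
Proof. by rewrite cls_ord; congr pureT; apply/ffunP => i; rewrite ffunE. Qed.

Lemma cls_elim (P : T -> Prop) :
  P 0 -> (forall a x y, P x -> P y -> P (a *: x + y)) ->
  (forall Q, P (cls Q)) -> forall z, P z.
Proof.
move=> P0 PL Pc; apply: dsum_elim => //.
  by move=> x y Px Py; rewrite -[x]scale1r; apply: PL.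
move=> n; elim/tensor_elim => [|a x y Px Py|x y].
- by rewrite raddf0.
- by rewrite linearP; apply: PL.
elim/freeg_elim: x => [|a t x Px].
  have -> : tensor_pure (@sp_perm k (RT_ne1 k) n) (fun s => tpow_perm W s) 0 y = 0.
    have := tensor_pure_linl (@sp_perm k (RT_ne1 k) n) (fun s => tpow_perm W s) (-1) 0 0 y.
    by rewrite scaler0 addr0 scaleN1r addNr.
  by rewrite raddf0.
rewrite tensor_pure_linl linearP; apply: (PL) => // {x Px}.
elim/tpow_elim: y => [|b x y Px Py|v]; last exact: (eq_ind_r P (Pc (DTree t v)) (pureT_cls t v)).
  have := tensor_pure_linr (@sp_perm k (RT_ne1 k) n) (fun s => tpow_perm W s) (-1) (fgen k t) 0 0.
  by rewrite scaler0 addr0 scaleN1r addNr => ->; rewrite raddf0.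
by rewrite tensor_pure_linr linearP; apply: PL.
Qed.

Lemma cls_linear_eq (Z : lmodType k) (F G : {linear T -> Z}) :
  (forall Q, F (cls Q) = G (cls Q)) -> F =1 G.
Proof.
move=> E; elim/cls_elim => [|a x y Ex Ey|//]; first by rewrite !raddf0.
by rewrite !linearP Ex Ey.
Qed.

Definition upd (I : finType) (v : I -> W) i x : I -> W := fun j => if j == i then x else v j.

(** The condition under which a function of decorated trees induces a linear map on the Schur
    functor, as [tlift_good] shows. *)
Definition good (Z : lmodType k) (phi : dtree -> Z) :=
  (forall Q Q', diso Q Q' -> phi Q = phi Q') /\
  (forall (I : finType) (t : rtree_ne1 I) v i a x y,
     phi (DTree t (upd v i (a *: x + y))) =
     a *: phi (DTree t (upd v i x)) + phi (DTree t (upd v i y))).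

Section Lift.
Variables (Z : lmodType k) (phi : dtree -> Z).
Hypothesis phiP : good phi.

Fact tlift_ml n (t : rtree_ne1 'I_n) :
  multilinear (fun v : {ffun 'I_n -> W} => phi (DTree t v)).
Proof.
move=> v i a x y.
have E z : (update v i z : 'I_n -> W) = upd v i z.
  by apply: functional_extensionality_dep => j; rewrite ffunE.
by rewrite !E phiP.2.
Qed.

Definition tlift_bil n (r : RT_obj k 'I_n) (y : tpow n W) : Z :=
  fglift (fun t => tpow_lift (tlift_ml t) y) r.

Fact tlift_linl n a x y (z : tpow n W) :
  tlift_bil (a *: x + y) z = a *: tlift_bil x z + tlift_bil y z.
Proof. exact: linearP. Qed.

Fact tlift_gen n t (y : tpow n W) : tlift_bil (fgen k t) y = tpow_lift (tlift_ml t) y.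
Proof. by rewrite /tlift_bil fglift_gen. Qed.

Fact tlift_linr n a (r : RT_obj k 'I_n) (y z : tpow n W) :
  tlift_bil r (a *: y + z) = a *: tlift_bil r y + tlift_bil r z.
Proof.
elim/RT_elim: r => [|b t r IH].
  have E x : tlift_bil 0 x = 0 by exact: raddf0.
  by rewrite !E scaler0 addr0.
rewrite !tlift_linl IH !tlift_gen linearP /= !scalerDr !scalerA.
by rewrite addrACA [b * a]mulrC.
Qed.

Fact tlift_bal n s x (y : tpow n W) :
  tlift_bil (@sp_perm k (RT_ne1 k) n s x) y = tlift_bil x (tpow_perm W s y).
Proof.
elim/RT_elim: x => [|a t x IH].
  have E z : tlift_bil 0 z = 0 by exact: raddf0.
  by rewrite /sp_perm raddf0 !E.
rewrite /sp_perm in IH *; rewrite linearP !tlift_linl IH; congr (_ *: _ + _) => {IH}.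
have -> : sp_map (RT_ne1 k) (injF_bij (@perm_inj _ s)) (fgen k t) =
    fgen k (rtree_relabel (injF_bij (@perm_inj _ s)) t) by exact: fglift_gen.
rewrite !tlift_gen.
elim/tpow_elim: y => [|b u v Eu Ev|v]; first by rewrite !raddf0.
  by rewrite !linearP Eu Ev.
rewrite tpow_perm_pure !tpow_lift_pure; apply/esym/phiP.1.
exists s; split=> [|i|i]; first exact: injF_bij perm_inj.
  by rewrite /par /= relabelE //; apply: injF_bij perm_inj.
by rewrite /= ffunE.
Qed.

Definition tlift_good : {linear T -> Z} :=
  dsum_lift (fun n => tensor_lift (@tlift_linl n) (@tlift_linr n) (@tlift_bal n)).

Lemma tlift_good_cls Q : tlift_good (cls Q) = phi Q.
Proof.
rewrite /cls; apply: etrans (dsum_lift_inj _ _) _; apply: etrans (tensor_lift_pure _ _ _ _ _) _.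
rewrite /tlift_bil fglift_gen tpow_lift_pure; apply/esym/phiP.1.
exists enum_rank; split=> [|i|i]; first exact: enum_rank_bij.
  by rewrite /par /= relabelE //; apply: enum_rank_bij.
by rewrite /= ffunE enum_rankK.
Qed.

End Lift.

End DecoratedTrees.

Section Extension.
Variables (k : fieldType) (W : lmodType k).
Notation T := (schur (RT_ne1 k) W).
Variable Z : lmodType k.

(** Zero for functions that are not [good], so that [ext] is a plain recursion which carries no
    proofs. *)
Definition tlift (phi : dtree W -> Z) : {linear T -> Z} :=
  if pselect (good phi) is left phiP then tlift_good phiP else \0.

Lemma tlift_cls phi Q : good phi -> tlift phi (cls Q) = phi Q.
Proof.
by rewrite /tlift; case: pselect => // phiP _; rewrite tlift_good_cls.
Qed.

Lemma tlift_lin phi psi psi' a z : good phi -> good psi -> good psi' ->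
  (forall Q, phi Q = a *: psi Q + psi' Q) -> tlift phi z = a *: tlift psi z + tlift psi' z.
Proof.
move=> g1 g2 g3 E; elim/cls_elim: z => [|b x y Ex Ey|Q].
- by rewrite !raddf0 ?scaler0 addr0.
- rewrite !linearP Ex Ey !scalerDr !scalerA [b * a]mulrC.
  by rewrite addrACA.
by rewrite !tlift_cls.
Qed.

(* The multilinear extension to [T] of a function of decorated trees. *)
Fixpoint ext (phi : seq (dtree W) -> Z) (zs : seq T) : Z :=
  if zs is z :: zs' then tlift (fun Q => ext (fun l => phi (Q :: l)) zs') z
  else phi [::].

Definition goods (phi : seq (dtree W) -> Z) :=
  forall l1 l2, good (fun Q => phi (l1 ++ Q :: l2)).

Lemma goods_cons phi Q : goods phi -> goods (fun l => phi (Q :: l)).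
Proof. by move=> gphi l1 l2; apply: (gphi (Q :: l1)). Qed.

Lemma good_lin (phi psi : dtree W -> Z) a : good phi -> good psi -> good (fun Q => a *: phi Q + psi Q).
Proof.
move=> [i1 l1] [i2 l2]; split=> [Q Q' QQ'|I t v i b x y].
  by rewrite (i1 _ _ QQ') (i2 _ _ QQ').
rewrite l1 l2 !scalerDr !scalerA [a * b]mulrC.
by rewrite addrACA.
Qed.

Lemma goods_lin (phi psi : seq (dtree W) -> Z) a : goods phi -> goods psi -> goods (fun l => a *: phi l + psi l).
Proof. by move=> g1 g2 l1 l2; apply: good_lin. Qed.

(** The claims are intertwined: goodness in a further tree needs linearity in [phi] for [zs], and
    linearity for a longer list needs goodness for its tail. *)
Lemma ext_good_lin zs :
  (forall phi, goods phi -> good (fun Q => ext (fun l => phi (Q :: l)) zs)) /\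
  (forall phi psi a, goods phi -> goods psi ->
     ext (fun l => a *: phi l + psi l) zs = a *: ext phi zs + ext psi zs).
Proof.
have G zs' : (forall phi psi a, goods phi -> goods psi ->
     ext (fun l => a *: phi l + psi l) zs' = a *: ext phi zs' + ext psi zs') ->
    forall phi, goods phi -> good (fun Q => ext (fun l => phi (Q :: l)) zs').
  move=> L phi gphi; split=> [Q Q' QQ'|I t v i a x y].
    by congr ext; apply: functional_extensionality_dep => l; apply: (gphi [::] l).1.
  rewrite -L; try exact: goods_cons.
  by congr ext; apply: functional_extensionality_dep => l; apply: (gphi [::] l).2.
suff L : forall phi psi a, goods phi -> goods psi ->
     ext (fun l => a *: phi l + psi l) zs = a *: ext phi zs + ext psi zs.
  by split=> //; apply: G.
elim: zs => [//|z zs IH] phi psi a g1 g2 /=; apply: tlift_lin.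
- by apply: (G _ IH (fun l => a *: phi l + psi l)); apply: goods_lin.
- exact: G.
- exact: G.
by move=> Q; apply: IH; apply: goods_cons.
Qed.

Lemma ext_good phi zs : goods phi -> good (fun Q => ext (fun l => phi (Q :: l)) zs).
Proof. exact: (ext_good_lin zs).1. Qed.

Lemma ext_lin phi psi a zs : goods phi -> goods psi ->
  ext (fun l => a *: phi l + psi l) zs = a *: ext phi zs + ext psi zs.
Proof. exact: (ext_good_lin zs).2. Qed.

Lemma ext_cls phi Qs : goods phi -> ext phi (map (@cls k W) Qs) = phi Qs.
Proof.
elim: Qs phi => //= Q Qs IH phi gphi.
by rewrite tlift_cls ?IH //; [apply: goods_cons|apply: ext_good].
Qed.

Lemma ext_mlin phi : goods phi -> mlin id (ext phi).
Proof.
move=> gphi p q a x y; elim: p phi gphi => [|z p IH] phi gphi /=; first exact: linearP.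
by apply: tlift_lin => [|||Q]; try exact: ext_good; apply: IH; apply: goods_cons.
Qed.

Lemma ext_sym2 phi : goods phi -> sym2 phi -> sym2 (ext phi).
Proof.
move=> gphi sphi p q x y; elim: p phi gphi sphi => [|z p IH] phi gphi sphi /=; last first.
  congr (tlift _ z); apply: functional_extensionality_dep => Q.
  by apply: IH; [apply: goods_cons|apply: sym2_cons].
rewrite -/(ext phi [:: x, y & q]) -/(ext phi [:: y, x & q]).
have M1 q' a u v : ext phi (a *: u + v :: q') = a *: ext phi (u :: q') + ext phi (v :: q').
  exact: (ext_mlin gphi [::]).
have M2 w q' a u v :
    ext phi [:: w, a *: u + v & q'] = a *: ext phi [:: w, u & q'] + ext phi [:: w, v & q'].
  exact: (ext_mlin gphi [:: w]).
have Z1 q' : ext phi (0 :: q') = 0 := mlin0 [::] _ (ext_mlin gphi).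
have Z2 w q' : ext phi [:: w, 0 & q'] = 0 := mlin0 [:: w] _ (ext_mlin gphi).
elim/cls_elim: x => [|a u v Eu Ev|Q].
- by rewrite Z1 Z2.
- by rewrite M1 M2 Eu Ev.
elim/cls_elim: y => [|a u v Eu Ev|Q'].
- by rewrite Z1 Z2.
- by rewrite M1 M2 Eu Ev.
have gg Q1 := ext_good q (goods_cons Q1 gphi).
rewrite /= (tlift_cls _ (ext_good (cls Q' :: q) gphi)) (tlift_cls _ (ext_good (cls Q :: q) gphi)) /=.
rewrite (tlift_cls _ (gg Q)) (tlift_cls _ (gg Q')).
by congr ext; apply: functional_extensionality_dep => l; apply: (sphi [::]).
Qed.

Lemma mlin_cls_eq (F G : seq T -> Z) : mlin id F -> mlin id G ->
  (forall Qs, F (map (@cls k W) Qs) = G (map (@cls k W) Qs)) -> F =1 G.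
Proof.
move=> FP GP E zs.
suff H Qs : F (map (@cls k W) Qs ++ zs) = G (map (@cls k W) Qs ++ zs) by apply: (H [::]).
elim: zs Qs => [|z zs IH] Qs; first by rewrite cats0.
elim/cls_elim: z => [|a x y Ex Ey|Q]; first by rewrite (mlin0 _ _ FP) (mlin0 _ _ GP).
  by rewrite FP GP Ex Ey.
by have := IH (rcons Qs Q); rewrite map_rcons cat_rcons.
Qed.

End Extension.

Section TreeFacts.
Variable (I : finType).
Implicit Type t : rtree_ne1 I.

Lemma rtree_rootP t : exists r, (val t r == None) && [forall x, connect (child_of (val t)) x r].
Proof. by have /andP[/existsP] := valP t. Qed.

Definition root_of t : I := xchoose (rtree_rootP t).

Lemma root_None t : val t (root_of t) = None.
Proof. by have /andP[/eqP] := xchooseP (rtree_rootP t). Qed.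

Lemma connect_root t x : connect (child_of (val t)) x (root_of t).
Proof. by have /andP[_ /forallP] := xchooseP (rtree_rootP t). Qed.

Lemma root_unique t x : val t x = None -> x = root_of t.
Proof.
move=> tx; case/connectP: (connect_root t x) => [[|y s]] //= /andP[].
by rewrite /child_of tx.
Qed.

Lemma not_unary t x : #|children (val t) x| != 1%N.
Proof. by have /andP[_ /forallP] := valP t. Qed.

End TreeFacts.

(** * Grafting trees onto a new root *)

Section Graft.
Variables (k : fieldType) (W : lmodType k).

Section Def.
Variables (J : finType) (hJ : #|J| != 1%N) (F : J -> dtree W) (w : W).

Let S : finType := {j : J & dt_vert (F j)}.
Definition gnode j (x : dt_vert (F j)) : S := Tagged (fun j => dt_vert (F j)) x.

(** The vertex [None] is the new root. A root of [F j] has no parent there, so [omap] yields an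
    inner [None], which is again the new root. *)
Definition graft_par : {ffun option S -> option (option S)} :=
  [ffun x => if x is Some u then Some (omap (@gnode (tag u)) (par (tagged u))) else None].

Lemma graft_parE j (x : dt_vert (F j)) :
  graft_par (Some (gnode x)) = Some (omap (@gnode j) (par x)).
Proof. by rewrite ffunE. Qed.

Lemma gnode_inj j : injective (@gnode j).
Proof. by move=> x y /eqP; rewrite eq_Tagged => /eqP. Qed.

Lemma gnode_eq j j' (x : dt_vert (F j)) (y : dt_vert (F j')) :
  gnode x = gnode y -> exists e : j = j', ecast i (dt_vert (F i)) e x = y.
Proof.
pose P (u : S) := exists e : j = tag u, ecast i (dt_vert (F i)) e x = tagged u.
by move=> E; suff: P (gnode y) by []; rewrite -E; exists erefl.
Qed.

Lemma gnodeP (P : S -> Prop) : (forall j (x : dt_vert (F j)), P (gnode x)) -> forall u, P u.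
Proof. by move=> H [j x]; apply: H. Qed.

Fact graft_subproof : is_rooted_tree graft_par && no_unary_vertex graft_par.
Proof.
apply/andP; split.
  apply/existsP; exists None; rewrite ffunE eqxx /=; apply/forallP => -[u|]; last exact: connect0.
  elim/gnodeP: u => j x; apply: (@connect_trans _ _ (Some (gnode (root_of (dt_tree (F j)))))).
    case/connectP: (connect_root (dt_tree (F j)) x) => s; elim: s x => [|y s IH] x /=.
      by move=> _ ->; apply: connect0.
    case/andP=> xy ys E; apply: connect_trans (IH _ ys E); apply: connect1.
    by rewrite /child_of graft_parE /par (eqP xy).
  by apply: connect1; rewrite /child_of graft_parE /par root_None.
apply/forallP => -[u|].
  elim/gnodeP: u => j x.
  suff -> : children graft_par (Some (gnode x)) =
      (fun y => Some (@gnode j y)) @: children (val (dt_tree (F j))) x.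
    by rewrite card_imset ?not_unary // => y z [/gnode_inj].
  apply/setP => -[v|]; last first.
    rewrite inE /child_of ffunE /=; apply/esym/negbTE/imsetP.
    by case.
  elim/gnodeP: v => j' y; rewrite inE /child_of graft_parE.
  apply/eqP/imsetP => [|[z]]; last first.
    rewrite inE => /eqP pz /Some_inj/gnode_eq[e]; subst j'.
    by move=> /= ->; rewrite /par pz.
  case E : (par y) => [z|] //= /Some_inj/Some_inj/gnode_eq[e]; subst j'.
  move=> /= Ez; exists y => //.
  by rewrite inE /child_of -Ez; apply/eqP.
suff -> : children graft_par None =
    (fun j => Some (gnode (root_of (dt_tree (F j))))) @: setT.
  by rewrite card_imset ?cardsT // => i j /Some_inj/gnode_eq[].
apply/setP => -[v|]; last first.
  rewrite inE /child_of ffunE /=; apply/esym/negbTE/imsetP.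
  by case.
elim/gnodeP: v => j y; rewrite inE /child_of graft_parE.
apply/eqP/imsetP => [|[z _ /Some_inj]].
  case E : (par y) => [z|] //= _; exists j => //.
  by rewrite (root_unique E).
by case/gnode_eq=> e; subst z; move=> /= ->; rewrite /par root_None.
Qed.

Definition graft_lab (x : option S) : W := if x is Some u then dt_lab (tagged u) else w.

Definition graft : dtree W := DTree (exist _ graft_par graft_subproof : rtree_ne1 _) graft_lab.

Lemma par_graft j (x : dt_vert (F j)) :
  @par k W graft (Some (gnode x)) = Some (omap (@gnode j) (par x)).
Proof. exact: graft_parE. Qed.

Lemma par_graft_root : @par k W graft None = None.
Proof. exact: ffunE. Qed.

End Def.
Arguments gnode {J F j}.

Lemma diso_refl (Q : dtree W) : diso Q Q.
Proof.
exists id; split=> // [|x]; first by exists id.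
by case: (par x).
Qed.

Lemma graft_iso (J J' : finType) hJ hJ' F F' w (s : J -> J') :
  bijective s -> (forall j, diso (F j) (F' (s j))) ->
  diso (@graft J hJ F w) (@graft J' hJ' F' w).
Proof.
move=> [s' sK s'K] /(fun H j => cid (H j)) H.
pose f j := sval (H j); have fP j := svalP (H j).
pose h (x : option {j : J & dt_vert (F j)}) : option {j : J' & dt_vert (F' j)} :=
  omap (fun u => gnode (f (tag u) (tagged u))) x.
exists h; split.
- apply: inj_card_bij.
    move=> [[j x]|] [[j' y]|] //= /Some_inj/gnode_eq[/[dup] /(can_inj sK) E]; subst j'; move=> e.
    rewrite (eq_irrelevance e erefl) /= => E; have [fb _ _] := fP j.
    by rewrite (bij_inj fb E).
  rewrite !card_option ltnS !card_tagged !sumnE !big_map -!enumT !big_enum /=.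
  rewrite (reindex s) /=; last by exists s' => j _.
  by apply: leq_sum => j _; have [/bij_eq_card -> _ _] := fP j.
- case=> [[j x]|] /=; last by rewrite /par /= !ffunE.
  rewrite /par /= !ffunE /=; have [_ fp _] := fP j.
  by rewrite fp; case: (par x).
- case=> [[j x]|] //=; have [_ _ fl] := fP j.
  exact: fl.
Qed.

Lemma cls_mlin (I : finType) (t : rtree_ne1 I) (v : I -> W) i a x y :
  cls (DTree t (upd v i (a *: x + y))) =
  a *: cls (DTree t (upd v i x)) + cls (DTree t (upd v i y)).
Proof.
rewrite /cls /=.
have E z : [ffun j : 'I_#|I| => upd v i z (enum_val j)] =
    update [ffun j => v (enum_val j)] (enum_rank i) z.
  by apply/ffunP => j; rewrite !ffunE /upd (can2_eq enum_valK enum_rankK).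
rewrite !E /pureT tpure_multilinear tensor_pure_linr.
exact: linearP.
Qed.

(* Trees over a common family of shapes, in which only the label of [i0] varies. *)
Lemma graft_mlin (J : finType) (hJ : #|J| != 1%N) (F : W -> J -> dtree W) w (j0 : J)
    (I : finType) (t : rtree_ne1 I) v (i : I) :
  (forall z, F z j0 = DTree t (upd v i z)) -> (forall j z z', j != j0 -> F z j = F z' j) ->
  forall a x y, cls (graft hJ (F (a *: x + y)) w) =
    a *: cls (graft hJ (F x) w) + cls (graft hJ (F y) w).
Proof.
move=> F0 F1 a x y.
(* The vertex type of [F z j0] is known only through an equation for each [z]. [sh] records the
   shapes independently of [z], with the varying vertex marked, so that all grafts have one vertex
   type. *)
pose sh j : {I : finType & (rtree_ne1 I * (I -> W) * option I)%type} :=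
  if j == j0 then existT _ I (t, v, Some i)
  else existT _ (dt_vert (F 0 j)) (dt_tree (F 0 j), @dt_lab k W (F 0 j), None).
pose lab z j : tag (sh j) -> W :=
  if (tagged (sh j)).2 is Some i then upd (tagged (sh j)).1.2 i z else (tagged (sh j)).1.2.
have EF z : F z = fun j => DTree (tagged (sh j)).1.1 (lab z j).
  apply: functional_extensionality_dep => j; rewrite /lab /sh.
  case: eqVneq => [->|ne] /=; first exact: F0.
  by rewrite (F1 _ _ 0 ne); case: (F 0 j).
pose S0 : {I : finType & (rtree_ne1 I * (I -> W) * option I)%type} :=
  existT _ I (t, v, Some i).
have e : S0 = sh j0 by rewrite /sh eqxx.
pose i1 := existT (fun j => Finite.sort (tag (sh j))) j0 (ecast P (tag P) e i).
have lab1 z (u : {j : J & tag (sh j)}) :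
    lab z (tag u) (tagged u) = if u == i1 then z else lab 0 (tag u) (tagged u).
  case: u => j u; rewrite /lab /=; case: (eqVneq j j0) => [E|ne].
    subst j; rewrite eq_Tagged /i1 /=.
    by move: u; clear i1; case: _ / e => /= u; rewrite /upd; case: (u == i).
  case: eqP => [E|_]; first by case/eqP: ne; apply: (congr1 (@tag _ _) E).
  have : (tagged (sh j)).2 = None by rewrite /sh (negPf ne).
  by case: (tagged (sh j)).2.
pose Q z := graft hJ (fun j => DTree (tagged (sh j)).1.1 (lab z j)) w.
have EQ z : Q z = DTree (dt_tree (Q 0)) (upd (@dt_lab k W (Q 0)) (Some i1) z).
  congr (@DTree k W _ _ _).
    exact: val_inj.
  apply: (@functional_extensionality_dep (option {j : J & tag (sh j)}) (fun=> W)).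
  by case=> [u|] //=; apply: lab1.
have := cls_mlin (dt_tree (Q 0)) (@dt_lab k W (Q 0)) (Some i1) a x y.
by rewrite -(EQ x) -(EQ y) -(EQ (a *: x + y)) /Q -!EF.
Qed.

End Graft.

Section Node.
Variables (k : fieldType) (W : lmodType k).
Notation T := (schur (RT_ne1 k) W).
Implicit Types (w : W) (Qs : seq (dtree W)).

Lemma ord0_false : 'I_0 -> False. Proof. by case. Qed.

Definition fam Qs : 'I_(size Qs) -> dtree W :=
  match Qs with
  | [::] => fun j => False_rect _ (ord0_false j)
  | Q :: l => fun j => nth Q (Q :: l) j
  end.

Lemma famE d Qs j : fam (Qs := Qs) j = nth d Qs j.
Proof. by case: Qs j => [|Q l] j; [case: (ord0_false j)|apply: set_nth_default]. Qed.

Lemma card_ord_neq1 n : n <> 1%N -> #|'I_n| != 1%N.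
Proof. by rewrite card_ord => /eqP. Qed.

(* [0] if the root would have exactly one child. *)
Definition glist w Qs : T :=
  match @eqP _ (size Qs) 1%N with
  | ReflectT _ => 0
  | ReflectF ne => cls (graft (card_ord_neq1 ne) (fam (Qs := Qs)) w)
  end.

Lemma glistE n (h : #|'I_n| != 1%N) d w Qs : size Qs = n ->
  glist w Qs = cls (graft h (fun j : 'I_n => nth d Qs j) w).
Proof.
move=> E; subst n; rewrite /glist; case: eqP => [E|ne].
  by exfalso; move: h; rewrite card_ord E.
rewrite (bool_irrelevance (card_ord_neq1 ne) h); congr (cls (graft _ _ _)).
by apply: functional_extensionality_dep => j; apply: famE.
Qed.

Lemma glist1 w Qs : size Qs = 1%N -> glist w Qs = 0.
Proof. by move=> E; rewrite /glist; case: eqP. Qed.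

Lemma glist_goods w : goods (glist w).
Proof.
move=> l1 l2; have sz Q : size (l1 ++ Q :: l2) = (size l1 + size l2).+1.
  by rewrite size_cat addnS.
case: (eqVneq (size l1 + size l2).+1 1%N) => [E|/eqP ne].
  by split=> [Q Q' _|I t v i a x y]; rewrite !glist1 ?sz // scaler0 addr0.
have h := card_ord_neq1 ne; split=> [Q Q' QQ'|I t v i a x y].
  rewrite !(glistE h Q) ?sz //; apply/cls_iso/graft_iso; first by exists id.
  move=> j; rewrite !nth_cat; case: ltnP => // _; first exact: diso_refl.
  by case: (j - size l1)%N => // m; apply: diso_refl.
pose F z (j : 'I_(size l1 + size l2).+1) :=
  nth (DTree t v) (l1 ++ DTree t (upd v i z) :: l2) j.
rewrite !(glistE h (DTree t v)) ?sz //.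
have lt_l1 : (size l1 < (size l1 + size l2).+1)%N by rewrite ltnS leq_addr.
apply: (@graft_mlin _ _ _ h F w (Ordinal lt_l1) I t v i) => [z|j z z'].
  by rewrite /F nth_cat /= ltnn subnn.
rewrite /F !nth_cat -val_eqE /=; case: ltnP => // le ne'.
by case E : (j - size l1)%N => //; case/eqP: ne'; apply/eqP; rewrite eqn_leq le -subn_eq0 E.
Qed.

Lemma glist_sym2 w : sym2 (glist w).
Proof.
move=> p q x y; pose n := (size p + size q).+2.
have sz u v : size (p ++ [:: u, v & q]) = n by rewrite size_cat /= !addnS.
have h : #|'I_n| != 1%N by rewrite card_ord.
rewrite !(glistE h x) ?sz //; apply/cls_iso.
have lt1 : (size p < n)%N by rewrite /n; lia.
have lt2 : ((size p).+1 < n)%N by rewrite /n; lia.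
apply: (graft_iso _ _ _ (s := tperm (Ordinal lt1) (Ordinal lt2))) => [|j].
  exact: injF_bij perm_inj.
rewrite !nth_cat; case: tpermP => [->|->|/eqP + /eqP] /=.
- by rewrite ltnn subnn ltnNge leqnSn subSnn; apply: diso_refl.
- by rewrite ltnn subnn ltnNge leqnSn subSnn; apply: diso_refl.
rewrite -!val_eqE /= => ne1 ne2; case: ltnP => le; first exact: diso_refl.
case E : (j - size p)%N => [|[|m]]; try exact: diso_refl; lia.
Qed.

Lemma glist_lin a w w' Qs : glist (a *: w + w') Qs = a *: glist w Qs + glist w' Qs.
Proof.
rewrite /glist; case: eqP => ne; first by rewrite scaler0 addr0.
set h := card_ord_neq1 ne; set F := fam (Qs := Qs); have := cls_mlin (dt_tree (graft h F 0)) (graft_lab (F := F) 0) None a w w'.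
have E z : graft_lab (F := F) z = upd (graft_lab (F := F) 0) None z.
  by apply: functional_extensionality_dep => -[u|].
by rewrite -!E.
Qed.

(** Zero on a single child, where the species has no tree; [yT] later puts [L] in that place. *)
Definition nd w (zs : seq T) : T := ext (glist w) zs.

Lemma nd_lin a w w' zs : nd (a *: w + w') zs = a *: nd w zs + nd w' zs.
Proof.
rewrite /nd -ext_lin; try exact: glist_goods.
by congr ext; apply: functional_extensionality_dep => l; apply: glist_lin.
Qed.

Lemma nd0 zs : nd 0 zs = 0.
Proof. by have := nd_lin (-1) 0 0 zs; rewrite scaler0 addr0 scaleN1r addNr. Qed.

Lemma nd_mlin w : mlin id (nd w).
Proof. exact/ext_mlin/glist_goods. Qed.

Lemma nd_sym2 w : sym2 (nd w).
Proof. by apply: ext_sym2; [apply: glist_goods|apply: glist_sym2]. Qed.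

Lemma nd_cls w Qs : nd w (map (@cls k W) Qs) = glist w Qs.
Proof. exact/ext_cls/glist_goods. Qed.

End Node.

(** * Evaluation of trees by recursion from the root *)

Section Ancestors.
Variables (I : finType) (t : rtree_ne1 I).
Implicit Types x y z : I.

Definition up n x : option I := iter n (obind (val t)) (Some x).

Lemma upS n x : up n.+1 x = obind (val t) (up n x). Proof. by []. Qed.

Lemma upD m n x : up (m + n) x = obind (up m) (up n x).
Proof.
elim: m => [|m IH]; first by rewrite add0n; case: (up n x).
by rewrite addSn upS IH; case: (up n x).
Qed.

Lemma up_root x : exists2 n, (n < #|I|)%N & up n x = Some (root_of t).
Proof.
case/connectP: (connect_root t x) => s0 /shortenP[s xs us _] E.
exists (size s); first by have := max_card (mem (x :: s)); rewrite (card_uniqP us).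
elim: s x xs E {us s0} => [|y s IH] x /=; first by move=> _ ->.
case/andP=> /eqP xy ys /(IH _ ys) E.
have H : up (size s).+1 x = up (size s) y by rewrite -addn1 upD /= xy.
by rewrite -[RHS]E -H.
Qed.

Lemma up_None n x : (#|I| <= n)%N -> up n x = None.
Proof.
have [m lt_m E] := up_root x => le; have -> : n = ((n - m.+1) + (1 + m))%N by lia.
by rewrite !upD E /= root_None.
Qed.

Lemma up_cycle n z : up n.+1 z <> Some z.
Proof.
move=> E; have H m : up (m * n.+1) z = Some z.
  by elim: m => [|m IH]; rewrite ?mul0n // mulSn upD IH.
have := H #|I|; rewrite up_None // leq_pmulr //.
Qed.

Lemma up_inj a b x z : up a x = Some z -> up b x = Some z -> a = b.
Proof.
wlog le_ab : a b / (a <= b)%N => [H Ea Eb|].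
  by case/orP: (leq_total a b) => le; [apply: H|apply/esym/H].
move=> Ea; rewrite -(subnK le_ab) upD Ea /=.
by case: (b - a)%N => // n /up_cycle.
Qed.

End Ancestors.

Section Evaluation.
Variables (k : fieldType) (W Z : lmodType k) (op : W -> seq Z -> Z).

(** The fuel counts levels, and [#|I|] of them are enough by [up_None]. The order in which [enum]
    lists the children is immaterial for a symmetric [op]. *)
Fixpoint evl (I : finType) (p : I -> option I) (lab : I -> W) n (x : I) : Z :=
  if n is n'.+1 then
    op (lab x) [seq evl p lab n' y | y <- enum [pred y | p y == Some x]]
  else 0.

Definition eval (Q : dtree W) : Z :=
  evl (@par k W Q) (@dt_lab k W Q) #|dt_vert Q| (root_of (dt_tree Q)).

Hypothesis op_lin : forall zs a w w', op (a *: w + w') zs = a *: op w zs + op w' zs.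
Hypothesis op_mlin : forall w, mlin id (op w).
Hypothesis op_sym2 : forall w, sym2 (op w).

(** The image of [f] only has to be closed under children, which covers the inclusion of a grafted
    subtree as well as isomorphisms. *)
Lemma evl_map (I J : finType) p q (u : I -> W) (v : J -> W) (f : I -> J) :
  injective f -> (forall x, v (f x) = u x) ->
  (forall x x', q (f x') = Some (f x) <-> p x' = Some x) ->
  (forall y x, q y = Some (f x) -> exists x', y = f x') ->
  forall n x, evl q v n (f x) = evl p u n x.
Proof.
move=> f_inj vf qf qf'; elim=> //= n IH x; rewrite vf.
apply: sym2_perm => //; rewrite -(eq_map IH) (map_comp (evl q v n) f).
apply: perm_map; apply: uniq_perm; rewrite ?enum_uniq ?(map_inj_uniq f_inj) ?enum_uniq //.
move=> y; rewrite mem_enum inE; apply/eqP/mapP => [E|[x' ]].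
  have [x' Ex'] := qf' _ _ E; exists x' => //.
  by rewrite mem_enum inE; apply/eqP/qf; rewrite -Ex'.
by rewrite mem_enum inE => /eqP /qf E ->.
Qed.

(** By hypothesis no vertex lies [n] levels below [z], so the recursion ends before the fuel
    does. *)
Lemma evl_stable (I : finType) (t : rtree_ne1 I) lab n m z :
  (forall x, up t n x <> Some z) -> evl (val t) lab (n + m) z = evl (val t) lab n z.
Proof.
elim: n z => [|n IH] z H; first by case: (H z).
rewrite addSn /=; congr op; apply/eq_in_map => y; rewrite mem_enum inE => /eqP yz.
by apply: IH => x E; apply: (H x); rewrite upS E.
Qed.

Lemma eval_fuel (Q : dtree W) n : (#|dt_vert Q| <= n)%N ->
  evl (@par k W Q) (@dt_lab k W Q) n (root_of (dt_tree Q)) = eval Q.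
Proof.
move=> le; rewrite -(subnKC le) /eval; apply: (evl_stable (t := dt_tree Q)) => x.
by rewrite up_None.
Qed.

Lemma eval_iso Q Q' : diso Q Q' -> eval Q = eval Q'.
Proof.
case=> f [fb fp fl]; have f_inj := bij_inj fb.
rewrite /eval (bij_eq_card fb).
have <- : f (root_of (dt_tree Q)) = root_of (dt_tree Q').
  by apply: root_unique; have := fp (root_of (dt_tree Q)); rewrite /par root_None.
apply/esym/evl_map => // [x x'|y x _].
  rewrite fp; case: (par x') => //= y; split=> [[/f_inj ->]|[->]] //.
by have [h _ hK] := fb; exists (h y); rewrite hK.
Qed.

Section Linear.
Variables (I : finType) (t : rtree_ne1 I) (v : I -> W) (i : I).
Let e z := evl (val t) (upd v i z).

(** By [up_inj] at most one child of [z] has [i] among its descendants. That child enters linearly,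
    and the second claim says that its siblings do not see the label of [i]. *)
Lemma evl_lin n z :
  ((exists2 j, (j < n)%N & up t j i = Some z) ->
   forall a x y, e (a *: x + y) n z = a *: e x n z + e y n z) /\
  (~ (exists2 j, (j < n)%N & up t j i = Some z) -> forall x y, e x n z = e y n z).
Proof.
elim: n z => [|n IH] z; first by split=> [[]|].
pose ch := enum [pred y | val t y == Some z].
have chP c : c \in ch -> val t c = Some z by rewrite mem_enum inE => /eqP.
have eq_ch (s : seq I) x y : {subset s <= ch} ->
    (forall c, c \in s -> ~ exists2 j, (j < n)%N & up t j i = Some c) ->
    map (e x n) s = map (e y n) s.
  by move=> _ H; apply/eq_in_map => c /H nc; apply: ((IH c).2 nc).
rewrite /e /= -/ch; case: (eqVneq i z) => [Ei|ne].
  have nch c : c \in ch -> ~ exists2 j, (j < n)%N & up t j i = Some c.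
    move=> /chP cz [j _ E]; apply: (@up_cycle I t j z).
    by rewrite -Ei upS Ei -Ei E /= cz Ei.
  split=> [_ a x y|[]]; last by exists 0%N; rewrite //= Ei.
  rewrite /upd -Ei eqxx -/(e _ _) (eq_ch _ (a *: x + y) 0 (fun c H => H) nch).
  by rewrite (eq_ch _ x 0 (fun c H => H) nch) (eq_ch _ y 0 (fun c H => H) nch) op_lin.
have updz x : upd v i x z = v z by rewrite /upd eq_sym (negPf ne).
split=> [[[|j] lt_j]|H x y]; first by case=> /eqP; rewrite (negPf ne).
  rewrite upS; case Ej : (up t j i) => [c|] //= cz a x y; rewrite !updz.
  have /splitPr E : c \in ch by rewrite mem_enum inE; apply/eqP.
  have := enum_uniq [pred y | val t y == Some z]; rewrite -/ch.
  case: E chP eq_ch => l1 l2 chP eq_ch; rewrite cat_uniq /= => /and3P[_ /norP[cl1 _] /andP[cl2 _]].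
  have nch c' : c' \in l1 ++ l2 -> ~ exists2 j, (j < n)%N & up t j i = Some c'.
    move=> H [j' _ Ej']; have E : val t c' = Some z.
      by apply: chP; move: H; rewrite !mem_cat inE => /orP[]->; rewrite ?orbT.
    have : j'.+1 = j.+1 by apply: (@up_inj I t _ _ i z); rewrite upS ?Ej' ?Ej.
    move=> [Ejj]; move: Ej'; rewrite Ejj Ej => -[Ecc].
    by move: H; rewrite -Ecc mem_cat (negPf cl1) (negPf cl2).
  rewrite -/(e (a *: x + y)) -/(e x) -/(e y) !map_cat /= (IH c).1; last by exists j.
  have s1 : {subset l1 <= l1 ++ c :: l2} by move=> u; rewrite mem_cat => ->.
  have s2 : {subset l2 <= l1 ++ c :: l2} by move=> u; rewrite mem_cat inE => ->; rewrite !orbT.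
  have n1 c' : c' \in l1 -> ~ exists2 j, (j < n)%N & up t j i = Some c'.
    by move=> H; apply: nch; rewrite mem_cat H.
  have n2 c' : c' \in l2 -> ~ exists2 j, (j < n)%N & up t j i = Some c'.
    by move=> H; apply: nch; rewrite mem_cat H orbT.
  rewrite (eq_ch _ (a *: x + y) 0 s1 n1) (eq_ch _ (a *: x + y) 0 s2 n2).
  rewrite (eq_ch _ x 0 s1 n1) (eq_ch _ x 0 s2 n2).
  by rewrite (eq_ch _ y 0 s1 n1) (eq_ch _ y 0 s2 n2) (op_mlin _ (map (e 0 n) l1)).
rewrite !updz; congr op; apply: eq_ch => // c /chP cz [j lt_j E].
by apply: H; exists j.+1; rewrite // upS E.
Qed.

End Linear.

Lemma eval_good : good eval.
Proof.
split=> [|I t v i a x y]; first exact: eval_iso.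
by apply: (evl_lin t v i _ _).1; apply: up_root.
Qed.

Notation T := (schur (RT_ne1 k) W).

Definition fold : {linear T -> Z} := tlift eval.

Lemma fold_cls Q : fold (cls Q) = eval Q.
Proof. exact/tlift_cls/eval_good. Qed.

Lemma eval_graft (J : finType) (hJ : #|J| != 1%N) F w :
  eval (graft hJ F w) = op w [seq eval (F j) | j <- enum J].
Proof.
set Q := graft hJ F w.
have rQ : root_of (dt_tree Q) = None by apply/esym/root_unique; rewrite /= ffunE.
rewrite /eval rQ {1}card_option /=; apply: sym2_perm => //.
set n := #|_|; pose r j := Some (gnode (root_of (dt_tree (F j)))) : dt_vert Q.
have E j : eval (F j) = evl (@par k W Q) (@dt_lab k W Q) n (r j).
  rewrite -(@eval_fuel (F j) n).
    apply/esym; apply: (evl_map (f := fun x => Some (gnode x) : dt_vert Q)) => //.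
    - by move=> x y /Some_inj/gnode_inj.
    - move=> x x'; rewrite par_graft; split=> [/Some_inj|->] //.
      by case: (par x') => //= y /Some_inj/gnode_inj ->.
    - move=> [u|] x; last by rewrite par_graft_root.
      elim/gnodeP: u => j' y; rewrite par_graft => /Some_inj.
      case: (par y) => [z|] //= /Some_inj/gnode_eq[e _].
      by subst j'; exists y.
  rewrite /n; apply: (leq_card (fun x : dt_vert (F j) => gnode x)).
  exact: gnode_inj.
rewrite (eq_map E) (map_comp (evl _ _ _) r); apply: perm_map.
have r_inj : injective r by move=> i j /Some_inj/gnode_eq[].
apply: uniq_perm; first exact: enum_uniq.
  by rewrite (map_inj_uniq r_inj) enum_uniq.
move=> [u|]; rewrite mem_enum inE; last first.
  by rewrite par_graft_root; apply/esym/negbTE/mapP; case.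
elim/gnodeP: u => j x; rewrite par_graft.
apply/eqP/mapP => [|[j' _ /Some_inj/gnode_eq[e]]].
  case E' : (par x) => [y|] // _; exists j; rewrite ?mem_enum //.
  by rewrite /r -(root_unique E').
by subst j'; move=> /= ->; rewrite /par root_None.
Qed.

Lemma fold_nd w zs : size zs != 1%N -> fold (nd w zs) = op w (map fold zs).
Proof.
(* [mlin_cls_eq] compares at all arities; at arity one, where the two sides may differ, both are
   replaced by [0]. *)
pose F zs := if size zs == 1%N then 0 else fold (nd w zs).
pose G zs := if size zs == 1%N then 0 else op w (map fold zs).
have sz p q (x y : T) : size (p ++ x :: q) = size (p ++ y :: q) by rewrite !size_cat.
suff E : F =1 G by move=> /negPf ne; have := E zs; rewrite /F /G ne.
apply: mlin_cls_eq => [p q a x y|p q a x y|Qs].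
- rewrite /F !(sz p q _ 0); case: ifP => _; first by rewrite scaler0 addr0.
  by rewrite (nd_mlin w p q) linearP.
- rewrite /G !(sz p q _ 0); case: ifP => _; first by rewrite scaler0 addr0.
  by rewrite !map_cat /= linearP (op_mlin w (map fold p)).
rewrite /F /G size_map; case: eqVneq => // /eqP ne.
rewrite nd_cls; case: Qs ne => [|Q Qs] ne.
  rewrite (glistE (card_ord_neq1 ne) (DTree (dt_tree (graft (card_ord_neq1 ne) (fam (Qs := [::])) w)) (fun=> w))) //.
  by rewrite fold_cls eval_graft /= (size0nil (size_enum_ord 0)).
rewrite (glistE (card_ord_neq1 ne) Q) // fold_cls eval_graft -[in RHS]map_comp.
rewrite (@eq_map _ _ (fold \o @cls k W) eval fold_cls); congr op.
rewrite -[Q :: Qs in RHS](mkseq_nth Q) /mkseq -val_enum_ord -!map_comp.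
exact: eq_map.
Qed.

End Evaluation.

(** * Decomposition of a tree at its root *)

Section Subtrees.
Variables (I : finType) (t : rtree_ne1 I).
Implicit Types x y z : I.
Notation con := (connect (child_of (val t))).
Notation r := (root_of t).

Lemma con_step x y z : val t x = Some y -> con x z -> x = z \/ con y z.
Proof.
move=> xy /connectP[[|u s] /=]; first by left.
by case/andP; rewrite /child_of xy => /eqP[<-] us ->; right; apply/connectP; exists s.
Qed.

Definition top := {c : I | val t c == Some r}.
Implicit Type c : top.

Lemma topP c : val t (val c) = Some r. Proof. exact/eqP/(valP c). Qed.

Lemma con_top c : ~~ con r (val c).
Proof.
apply/negP => /connectP[[|u s] /=]; last by rewrite {1}/child_of root_None.
by move=> _ E; have := topP c; rewrite (E : val c = r) root_None.
Qed.

Lemma con_top_inj x c c' : con x (val c) -> con x (val c') -> c = c'.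
Proof.
case/connectP => s; elim: s x => [|y s IH] x /=.
  move=> _ E; rewrite -(E : val c = x) => /(con_step (topP c)) [/val_inj //|H].
  by case/negP: (con_top c').
case/andP=> /eqP xy ys E /(con_step xy) [Ex|]; last exact: IH ys E.
have Ey : y = r by apply: Some_inj; rewrite -xy Ex topP.
have yc : con y (val c) by apply/connectP; exists s.
by rewrite Ey (negPf (con_top c)) in yc.
Qed.

Lemma con_top_exists x : x = r \/ exists c, con x (val c).
Proof.
case/connectP: (connect_root t x) => s; elim: s x => [|y s IH] x /=; first by left.
case/andP=> /eqP xy ys E; right; case: (IH y ys E) => [Ey|[c yc]].
  have xc : val t x == Some r by rewrite xy Ey.
  by exists (exist _ x xc : top); apply: connect0.
by exists c; apply: connect_trans yc; apply/connect1/eqP.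
Qed.

Definition below c := {x : I | con x (val c)}.

Definition below_par c : {ffun below c -> option (below c)} :=
  [ffun x : below c => if val x == val c then None
    else obind (fun y => insub y : option (below c)) (val t (val x))].

Lemma below_par_root c (x : below c) : val x = val c -> below_par c x = None.
Proof. by rewrite ffunE => ->; rewrite eqxx. Qed.

Lemma below_parP c (x : below c) : val x != val c ->
  exists2 y, below_par c x = Some y & val t (val x) = Some (val y).
Proof.
move=> ne; rewrite ffunE (negPf ne).
case/connectP: (valP x) => [[|y s]] /=.
  by move=> _ E; case/eqP: ne; apply: esym E.
case/andP=> /eqP xy ys E; rewrite xy /=.
have yc : con y (val c) by apply/connectP; exists s.
by exists (exist _ y yc : below c) => //; rewrite insubT.
Qed.

Fact below_subproof c : is_rooted_tree (below_par c) && no_unary_vertex (below_par c).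
Proof.
apply/andP; split.
  pose rc : below c := exist _ (val c) (connect0 _ _).
  apply/existsP; exists rc; rewrite below_par_root // eqxx /=; apply/forallP => x.
  case/connectP: (valP x) => s; elim: s x => [|y s IH] x /=.
    by move=> _ E; rewrite (_ : x = rc) ?connect0 //; apply: val_inj.
  case/andP=> /eqP xy ys E; case: (eqVneq (val x) (val c)) => [Ex|ne].
    by rewrite (_ : x = rc) ?connect0 //; apply: val_inj.
  have [y' E1 E2] := below_parP ne.
  move: E2; rewrite xy => -[Ey]; subst y.
  by apply: connect_trans (IH _ ys E); apply: connect1; rewrite /child_of E1.
apply/forallP => x.
suff E : val @: children (below_par c) x = children (val t) (val x).
  by have := not_unary t (val x); rewrite -E card_imset //; apply: val_inj.
apply/setP => z; apply/imsetP/idP => [[y]|].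
  rewrite !inE /child_of => /eqP yx ->; case: (eqVneq (val y) (val c)) => [Ey|ne].
    by rewrite below_par_root in yx.
  by have [y'] := below_parP ne; rewrite yx => -[<-] ->.
rewrite inE /child_of => /eqP zx.
have zc : con z (val c) by apply: connect_trans (valP x); apply/connect1/eqP.
exists (exist _ z zc : below c) => //; rewrite inE /child_of.
have [|y -> E] := @below_parP c (exist _ z zc).
  apply: contra (con_top c) => /eqP /= Ez.
  have Ex : val x = r by apply: Some_inj; rewrite -zx Ez topP.
  by have := valP x; rewrite {1}Ex.
by apply/eqP; congr Some; apply/val_inj/Some_inj; rewrite -E.
Qed.

Definition subtree c : rtree_ne1 (below c) := exist _ (below_par c) (below_subproof c).

Lemma card_below c : (#|{: below c}| < #|I|)%N.
Proof.
rewrite card_sig; apply: proper_card; apply/properP; split; first by apply/subsetP.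
by exists r => //; rewrite inE con_top.
Qed.

Lemma card_top : #|{: top}| != 1%N.
Proof.
rewrite card_sig; have := not_unary t r; rewrite /children cardsE.
by congr (_ != _); apply: eq_card => x; rewrite !inE.
Qed.

End Subtrees.

Section Decomposition.
Variables (k : fieldType) (W : lmodType k).
Notation T := (schur (RT_ne1 k) W).

Lemma dtree_decomp (Q : dtree W) : exists (J : finType) (h : #|J| != 1%N) F w,
  diso (graft h F w) Q /\ forall j, (#|dt_vert (F j)| < #|dt_vert Q|)%N.
Proof.
case: Q => I t v; pose F (c : top t) := DTree (subtree c) (fun x => v (val x)).
exists (top t), (card_top t), F, (v (root_of t)); split; last by move=> c; apply: card_below.
pose f (u : dt_vert (graft (card_top t) F (v (root_of t)))) : I :=
  if u is Some u then val (tagged u) else root_of t.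
have noroot (c : top t) y : y = root_of t -> connect (child_of (val t)) y (val c) -> False.
  by move=> ->; rewrite (negPf (con_top c)).
have f_inj : injective f.
  move=> [[c x]|] [[c' x']|] //= E.
  - have xc : connect (child_of (val t)) (val x') (val c).
      by rewrite -(E : val x = val x'); apply: (valP x).
    have Ec := con_top_inj xc (valP x').
    by subst c'; rewrite (val_inj E).
  - by case: (noroot c (val x) E (valP x)).
  - by case: (noroot c' (val x') (esym E) (valP x')).
have f_surj x : exists u, f u = x.
  case: (con_top_exists t x) => [->|[c xc]]; first by exists None.
  by exists (Some (@gnode k W _ F c (exist _ x xc))).
exists f; split.
- apply: inj_card_bij => //=; pose h x := sval (cid (f_surj x)).
  have hK : cancel h f by move=> x; rewrite /h; case: cid.
  exact: (leq_card h (can_inj hK)).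
- case=> [u|]; last by rewrite par_graft_root /= /par /= root_None.
  elim/gnodeP: u => c x; rewrite par_graft.
  case: (eqVneq (val x) (val c)) => [E|ne].
    by rewrite /par /= below_par_root // E topP.
  by have [y E1 E2] := below_parP ne; rewrite /par /= E1 E2.
- by case.
Qed.

Lemma cls_graft (J : finType) (h : #|J| != 1%N) F w :
  cls (graft h F w) = nd w [seq @cls k W (F j) | j <- enum J].
Proof.
have -> : [seq @cls k W (F j) | j <- enum J] = map (@cls k W) (map F (enum J)).
  by rewrite -map_comp.
have sz : size (map F (enum J)) = #|J| by rewrite size_map -cardE.
have h' : #|'I_(#|J|) | != 1%N by rewrite card_ord.
rewrite nd_cls (glistE h' (graft h F w)) //; apply/cls_iso.
apply: (graft_iso _ _ _ (s := @enum_rank J)) => [|j]; first exact: enum_rank_bij.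
rewrite (nth_map j) ?nth_enum_rank; first exact: diso_refl.
by rewrite -cardE ltn_ord.
Qed.

(** Structural induction on trees: decomposition at the root, with the number of vertices as the
    measure. *)
Lemma nd_elim (P : T -> Prop) :
  P 0 -> (forall a x y, P x -> P y -> P (a *: x + y)) ->
  (forall w zs, size zs != 1%N -> (forall z, z \in zs -> P z) -> P (nd w zs)) ->
  forall z, P z.
Proof.
move=> P0 PL Pn; apply: cls_elim => // Q.
have [n] := ubnP #|dt_vert Q|; elim: n Q => // n IH Q lt_n.
have [J [h [F [w [/cls_iso <- H]]]]] := dtree_decomp Q.
rewrite cls_graft; apply: Pn => [|z /mapP[j _ ->]]; first by rewrite size_map -cardE.
by apply: IH; apply: leq_trans (H j) _.
Qed.

Lemma schur_map_cls (W' : lmodType k) (f : {linear W -> W'}) Q :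
  schur_map (RT_ne1 k) f (cls Q) = cls (DTree (dt_tree Q) (fun x => f (dt_lab x))).
Proof.
rewrite /cls; apply: etrans (dsum_map_dinj _ _) _.
rewrite /pureT; congr dinj; apply: etrans (tensor_map_pure _ _ _ _) _.
rewrite tpow_map_pure; congr (tensor_pure _ _ _ (tpure _)).
by apply/ffunP => i; rewrite !ffunE.
Qed.

End Decomposition.

(** * The action of words on trees *)

Section FunctionSubspace.
Variables (k : fieldType) (X : Type) (V : lmodType k).

(** Serves for the functions of words compatible with brackets and for the formal vector fields. *)
Record linpred := LinPred {
  lp_pred :> (X -> V) -> Prop;
  lp_zero : lp_pred (fun=> 0);
  lp_lin : forall a f g, lp_pred f -> lp_pred g -> lp_pred (fun x => a *: f x + g x) }.

Variable P : linpred.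

Record funsub := FunSub_ { fs_val : X -> V; _ : `[< P fs_val >] }.
HB.instance Definition _ := [isSub for fs_val].
HB.instance Definition _ := [Choice of funsub by <:].

Definition FunSub f (Pf : P f) : funsub := FunSub_ (asboolT Pf).

Lemma fs_valP (f : funsub) : P (fs_val f).
Proof. by case: f => f /= /asboolP. Qed.

Lemma funsubP (f g : funsub) : (forall x, fs_val f x = fs_val g x) -> f = g.
Proof. by move=> fg; apply/val_inj/functional_extensionality_dep. Qed.

Fact fs_add_subproof (f g : funsub) : P (fun x => 1 *: fs_val f x + fs_val g x).
Proof. by apply: lp_lin; apply: fs_valP. Qed.
Fact fs_scale_subproof a (f : funsub) : P (fun x => a *: fs_val f x + 0).
Proof. by apply: lp_lin; [apply: fs_valP|apply: lp_zero]. Qed.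

Definition fs_zero := FunSub (lp_zero P).
Definition fs_add f g := FunSub (fs_add_subproof f g).
Definition fs_scale a f := FunSub (fs_scale_subproof a f).
Definition fs_opp f := fs_scale (-1) f.

Fact fs_addA : associative fs_add.
Proof. by move=> f g h; apply: funsubP => x /=; rewrite !scale1r addrA. Qed.
Fact fs_addC : commutative fs_add.
Proof. by move=> f g; apply: funsubP => x /=; rewrite !scale1r addrC. Qed.
Fact fs_add0 : left_id fs_zero fs_add.
Proof. by move=> f; apply: funsubP => x /=; rewrite scaler0 add0r. Qed.
Fact fs_addN : left_inverse fs_zero fs_opp fs_add.
Proof. by move=> f; apply: funsubP => x /=; rewrite scale1r addr0 scaleN1r addNr. Qed.
HB.instance Definition _ := GRing.isZmodule.Build funsub fs_addA fs_addC fs_add0 fs_addN.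

Fact fs_scaleA a b f : fs_scale a (fs_scale b f) = fs_scale (a * b) f.
Proof. by apply: funsubP => x /=; rewrite !addr0 scalerA. Qed.
Fact fs_scale1 : left_id 1 fs_scale.
Proof. by move=> f; apply: funsubP => x /=; rewrite addr0 scale1r. Qed.
Fact fs_scaleDr : right_distributive fs_scale +%R.
Proof. by move=> a f g; apply: funsubP => x /=; rewrite !addr0 !scale1r scalerDr. Qed.
Fact fs_scaleDl f : {morph fs_scale^~ f : a b / a + b}.
Proof. by move=> a b; apply: funsubP => x /=; rewrite !addr0 !scale1r scalerDl. Qed.
HB.instance Definition _ := GRing.Zmodule_isLmodule.Build k funsub
  fs_scaleA fs_scale1 fs_scaleDr fs_scaleDl.

Lemma fs_valL a (f g : funsub) x : fs_val (a *: f + g) x = a *: fs_val f x + fs_val g x.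
Proof. by rewrite /= scale1r addr0. Qed.

Lemma fs_valB (f g : funsub) x : fs_val (f - g) x = fs_val f x - fs_val g x.
Proof. by rewrite /= scale1r addr0 scaleN1r. Qed.

End FunctionSubspace.

Section MixedLists.
Variables A B : Type.

(** A block consists of letters and trees and stands for its word [lets] applied to its forest
    [trs]; how letters and trees are interleaved is irrelevant. *)
Fixpoint lets (l : seq (A + B)) : seq A :=
  match l with
  | inl a :: l' => a :: lets l'
  | inr _ :: l' => lets l'
  | [::] => [::]
  end.

Fixpoint trs (l : seq (A + B)) : seq B :=
  match l with
  | inl _ :: l' => trs l'
  | inr b :: l' => b :: trs l'
  | [::] => [::]
  end.

Lemma lets_cat l m : lets (l ++ m) = lets l ++ lets m.
Proof. by elim: l => //= -[a|b] l ->. Qed.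
Lemma trs_cat l m : trs (l ++ m) = trs l ++ trs m.
Proof. by elim: l => //= -[a|b] l ->. Qed.
Lemma lets_inl l : lets (map inl l) = l.
Proof. by elim: l => //= a l ->. Qed.
Lemma trs_inl l : trs (map inl l) = [::].
Proof. by elim: l. Qed.
Lemma lets_inr l : lets (map inr l) = [::].
Proof. by elim: l. Qed.
Lemma trs_inr l : trs (map inr l) = l.
Proof. by elim: l => //= a l ->. Qed.

Definition mixed (v : seq A) (C : seq B) : seq (A + B) := map inl v ++ map inr C.

Lemma lets_mixed v C : lets (mixed v C) = v.
Proof. by rewrite lets_cat lets_inl lets_inr cats0. Qed.
Lemma trs_mixed v C : trs (mixed v C) = C.
Proof. by rewrite trs_cat trs_inl trs_inr. Qed.

Lemma Split_map_inr C (x y : seq (A + B)) : Split (map inr C) x y ->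
  exists C1 C2, [/\ Split C C1 C2, x = map inr C1 & y = map inr C2].
Proof.
elim: C x y => [|c C IH] x y /=.
  by case/Split_nil_inv=> -> ->; exists [::], [::]; split=> //; constructor.
move=> H; case: (Split_inv H) => {H} [[x' ->]|[y' ->]] /IH[C1 [C2 [S -> ->]]].
  by exists (c :: C1), C2; split=> //; constructor.
by exists C1, (c :: C2); split=> //; constructor.
Qed.

Lemma Split_mixed v C x y : Split (mixed v C) x y ->
  exists v1 v2 C1 C2, [/\ Split C C1 C2, Split v v1 v2, x = mixed v1 C1 & y = mixed v2 C2].
Proof.
elim: v x y => [|a v IH] x y /=.
  case/Split_map_inr=> C1 [C2 [S -> ->]]; exists [::], [::], C1, C2.
  by split=> //; constructor.
move=> H; case: (Split_inv H) => {H} [[x' ->]|[y' ->]] /IH[v1 [v2 [C1 [C2 [S S' -> ->]]]]].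
  by exists (a :: v1), v2, C1, C2; split=> //; constructor.
by exists v1, (a :: v2), C1, C2; split=> //; constructor.
Qed.

End MixedLists.

Section Ucomp.
Variables (k : fieldType) (g : lieType k) (V : lmodType k).
Implicit Types phi : seq g -> V.

Lemma ucomp0 : ucomp (fun _ : seq g => 0 : V).
Proof. by split=> [p q a x y|p q x y]; rewrite ?scaler0 ?addr0 ?subrr. Qed.

Lemma ucompL a phi psi : ucomp phi -> ucomp psi -> ucomp (fun w => a *: phi w + psi w).
Proof.
move=> [m1 r1] [m2 r2]; split=> [p q b x y|p q x y].
  by rewrite m1 m2 !scalerDr !scalerA [a * b]mulrC addrACA.
by rewrite opprD addrACA -scalerBr r1 r2.
Qed.

Definition ucomp_pred : linpred (seq g) V := LinPred ucomp0 ucompL.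

Lemma ucomp_comp (U : lmodType k) (L : V -> U) phi : linear L ->
  ucomp phi -> ucomp (fun w => L (phi w)).
Proof.
move=> LP [m r]; have LB x y : L (x - y) = L x - L y.
  by rewrite addrC -scaleN1r LP scaleN1r addrC.
by split=> [p q a x y|p q x y]; rewrite ?m ?LP // -LB r.
Qed.

Lemma ucomp_catr phi v : ucomp phi -> ucomp (fun w => phi (w ++ v)).
Proof.
by move=> [m r]; split=> [p q a x y|p q x y]; rewrite -!catA /= ?m ?r.
Qed.

Lemma ucomp_catl phi v : ucomp phi -> ucomp (fun w => phi (v ++ w)).
Proof.
by move=> [m r]; split=> [p q a x y|p q x y]; rewrite !catA ?m ?r.
Qed.

End Ucomp.

Section Unary.
Variables (k : fieldType) (char0 : [pchar k] =i pred0) (g : lieType k).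
Notation W := (sym_plus g).
Notation T := (schur (RT_ne1 k) W).
Notation sg := (@sigma k g).
Notation Z := (funsub (ucomp_pred g T)).

(** Selects the terms of the Guin-Oudom sum with at least two blocks; the one-block term is the
    unknown. *)
Definition nd2 (a : W) (zs : seq T) : T := if (1 < size zs)%N then nd a zs else 0.

Lemma nd2_mlin a : mlin id (nd2 a).
Proof.
move=> p q b x y; rewrite /nd2 !size_cat /= !addnS ltnS.
by case: ifP => _; rewrite ?scaler0 ?addr0 // nd_mlin.
Qed.

Lemma nd2_sym2 a : sym2 (nd2 a).
Proof. by move=> p q x y; rewrite /nd2 !size_cat /= nd_sym2. Qed.

Lemma nd2_lin b a a' zs : nd2 (b *: a + a') zs = b *: nd2 a zs + nd2 a' zs.
Proof. by rewrite /nd2; case: ifP => _; rewrite ?nd_lin // scaler0 addr0. Qed.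

(** An element [z] stands for a tree with its images under all words: [fs_val z [::]] is the tree,
    [fs_val z w] its image under [w]. A block without letters that is not a single tree has value
    [0], as [sg [::]] is [0]. *)
Definition yz (l : seq (g + Z)) : T :=
  if trs l is [:: z] then fs_val z (lets l)
  else nd (sg (lets l)) [seq fs_val z [::] | z <- trs l].

Lemma yz_inl_ucomp p q :
  ucomp (fun w => yz (p ++ map inl w ++ q)).
Proof.
have E w : yz (p ++ map inl w ++ q) =
    if trs p ++ trs q is [:: z] then fs_val z (lets p ++ w ++ lets q)
    else nd (sg (lets p ++ w ++ lets q)) [seq fs_val z [::] | z <- trs p ++ trs q].
  by rewrite /yz !(trs_cat, lets_cat) trs_inl lets_inl.
rewrite (functional_extensionality_dep E).
have N zs : ucomp (fun w => nd (sg (lets p ++ w ++ lets q)) zs).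
  apply: (@ucomp_comp _ _ _ _ (fun a => nd a zs) (fun w => sg (lets p ++ w ++ lets q))).
    by move=> b a a'; apply: nd_lin.
  apply: (@ucomp_catr _ _ _ (fun w => sg (lets p ++ w))); apply: ucomp_catl.
  exact: sigma_ucomp.
case: (trs p ++ trs q) => [|z [|z' zs]] //.
apply: (@ucomp_catr _ _ _ (fun w => fs_val z (lets p ++ w))); apply: ucomp_catl.
exact: (fs_valP z).
Qed.

Lemma yz_inl : mlin inl yz.
Proof. by move=> p q a x y; have := (yz_inl_ucomp p q).1 [::] [::] a x y. Qed.

Lemma yz_bracket p q x y :
  yz (p ++ [:: inl x, inl y & q]) - yz (p ++ [:: inl y, inl x & q]) = yz (p ++ inl (lieb x y) :: q).
Proof. by have := (yz_inl_ucomp p q).2 [::] [::] x y. Qed.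

Lemma yzE l : size (trs l) != 1%N ->
  yz l = nd (sg (lets l)) [seq fs_val z [::] | z <- trs l].
Proof. by rewrite /yz; case: (trs l) => [|z [|z' zs]]. Qed.

Lemma yz_inr : mlin inr yz.
Proof.
move=> p q a x y; case: (eqVneq (size (trs p ++ trs q)) 0%N) => [/size0nil E|ne].
  rewrite /yz !trs_cat !lets_cat /=; case: (trs p) E => //=; case: (trs q) => // _ /=.
  by rewrite scale1r addr0.
have sz u : size (trs (p ++ inr u :: q)) != 1%N.
  by move: ne; rewrite trs_cat !size_cat /= addnS; case: (_ + _)%N.
rewrite !yzE ?sz // !trs_cat !lets_cat /= !map_cat /= scale1r addr0.
exact: nd_mlin.
Qed.

Lemma yz_swap p q x y : yz (p ++ [:: inr x, inr y & q]) = yz (p ++ [:: inr y, inr x & q]).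
Proof.
have sz u v : size (trs (p ++ [:: inr u, inr v & q])) != 1%N.
  by rewrite trs_cat size_cat /= !addnS.
by rewrite !yzE ?sz // !trs_cat !lets_cat /= !map_cat /= nd_sym2.
Qed.

Section Opv.
Implicit Types (v w : seq g) (ls : seq Z).

(** The value of [L w] at the tree with root word [v] and children [ls]. *)
Definition opv_fun v ls w : T :=
  nd (sg (w ++ v)) [seq fs_val z [::] | z <- ls] - psum yz (nd2 (sg w)) (mixed v ls).

Fact opv_subproof v ls : ucomp (opv_fun v ls).
Proof.
pose L zs a := nd a zs : T.
have L1 zs : linear (L zs) by move=> b a a'; apply: nd_lin.
have L2 : linear (fun a => psum yz (nd2 a) (mixed v ls)).
  by move=> b a a'; rewrite -psumP; apply: eq_psum => ts; apply: nd2_lin.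
have N1 := ucomp_comp (L1 [seq fs_val z [::] | z <- ls])
  (ucomp_catr v (sigma_ucomp char0 g)).
have N2 := ucomp_comp L2 (sigma_ucomp char0 g).
have := ucompL (-1) N2 N1; rewrite (_ : (fun w => _) = opv_fun v ls) //.
by apply: functional_extensionality_dep => w; rewrite scaleN1r addrC.
Qed.

Definition opv v ls : Z := @FunSub k _ T (ucomp_pred g T) _ (opv_subproof v ls).

(** Compatibility in the root word, which comes from [psum_rel], allows [hat] to replace that word
    by a label in S(g). *)
Lemma opv_ucomp ls : ucomp (opv^~ ls).
Proof.
split=> [p q a x y|p q x y]; apply: funsubP => w; rewrite ?fs_valL ?fs_valB /= /opv_fun.
  rewrite !catA (sigma_ucomp char0 g).1 nd_lin.
  rewrite /mixed !map_cat -!catA /=.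
  rewrite (psum_mlin yz_inl (@nd2_mlin (sg w))) opprD addrACA.
  by rewrite -scalerN -scalerDr.
rewrite opprD addrACA opprK.
have -> : forall zs : seq T, nd (sg (w ++ p ++ [:: x, y & q])) zs - nd (sg (w ++ p ++ [:: y, x & q])) zs
    = nd (sg (w ++ p ++ lieb x y :: q)) zs.
  move=> zs; rewrite !catA -(sigma_ucomp char0 g).2 [RHS](_ : _ = nd ((-1) *: sg ((w ++ p) ++ [:: y, x & q])
     + sg ((w ++ p) ++ [:: x, y & q])) zs); last by rewrite scaleN1r addrC.
  by rewrite nd_lin scaleN1r addrC.
congr (_ + _); rewrite -[X in _ + X = _]opprK -opprD; congr (- _).
rewrite /mixed !map_cat -!catA /=.
by rewrite (psum_rel (c := inl (lieb x y)) (fun p q => yz_bracket p q x y) (@nd2_mlin (sg w)) (@nd2_sym2 _)).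
Qed.

Lemma opv_mlin v : mlin id (opv v).
Proof.
move=> p q a x y; apply: funsubP => w; rewrite fs_valL /= /opv_fun.
rewrite !map_cat /= scale1r addr0 nd_mlin /mixed !map_cat /= !catA.
rewrite (psum_mlin yz_inr (@nd2_mlin (sg w))) opprD addrACA.
by rewrite -scalerN -scalerDr.
Qed.

Lemma opv_sym2 v : sym2 (opv v).
Proof.
move=> p q x y; apply: funsubP => w; rewrite /= /opv_fun !map_cat /= nd_sym2.
congr (_ - _); rewrite /mixed !map_cat /= !catA; apply/eqP; rewrite -subr_eq0.
rewrite (psum_rel (c := inr 0)) //.
- by rewrite (mlin0 _ _ (psum_mlin yz_inr (@nd2_mlin (sg w)))).
- by move=> p' q'; rewrite yz_swap subrr (mlin0 _ _ yz_inr).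
- exact: nd2_mlin.
- exact: nd2_sym2.
Qed.

Definition op (a : W) ls : Z := hat (opv_ucomp ls) a.

Lemma op_sigma x v ls : op (sg (x :: v)) ls = opv (x :: v) ls.
Proof. exact: (hat_sigma char0). Qed.

Lemma op_lin ls b a a' : op (b *: a + a') ls = b *: op a ls + op a' ls.
Proof. exact: linearP. Qed.

Lemma op_mlin a : mlin id (op a).
Proof.
move=> p q b x y; elim/(sigma_elim char0): a => [|c u v Eu Ev|x' v].
- by rewrite /op !raddf0 ?scaler0 ?addr0.
- rewrite !op_lin Eu Ev !scalerDr !scalerA [b * c]mulrC.
  by rewrite addrACA.
by rewrite !op_sigma opv_mlin.
Qed.

Lemma op_sym2 a : sym2 (op a).
Proof.
move=> p q x y; elim/(sigma_elim char0): a => [|c u v Eu Ev|x' v].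
- by rewrite /op !raddf0.
- by rewrite !op_lin Eu Ev.
by rewrite !op_sigma opv_sym2.
Qed.

End Opv.

End Unary.

Section UnaryTheory.
Variables (k : fieldType) (char0 : [pchar k] =i pred0) (g : lieType k).
Notation W := (sym_plus g).
Notation T := (schur (RT_ne1 k) W).
Notation sg := (@sigma k g).
Notation Z := (funsub (ucomp_pred g T)).

Definition Lf : {linear T -> Z} := fold (@op k char0 g).
Definition L (w : seq g) (t : T) : T := fs_val (Lf t) w.

Lemma L_lin w a t u : L w (a *: t + u) = a *: L w t + L w u.
Proof. by rewrite /L linearP fs_valL. Qed.

Lemma L_zero w : L w 0 = 0.
Proof. by rewrite /L raddf0. Qed.

Lemma Lf_nd x v C : size C != 1%N -> Lf (nd (sg (x :: v)) C) = opv char0 (x :: v) (map Lf C).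
Proof.
move=> sC; rewrite /Lf fold_nd ?op_sigma //.
- by move=> ls a w w'; apply: op_lin.
- by move=> a; apply: op_mlin.
- by move=> a; apply: op_sym2.
Qed.

Lemma nd_sigma_elim (P : T -> Prop) :
  P 0 -> (forall a x y, P x -> P y -> P (a *: x + y)) ->
  (forall x v C, size C != 1%N -> (forall c, c \in C -> P c) -> P (nd (sg (x :: v)) C)) ->
  forall t, P t.
Proof.
move=> P0 PL Pn; apply: nd_elim => // a C sC PC.
elim/(sigma_elim char0): a => [|b u v Eu Ev|x v]; first by rewrite nd0.
  by rewrite nd_lin; apply: PL.
exact: Pn.
Qed.

(** As [sg [::]] is [0], the sum over partitions in [opv_fun] vanishes and the node is returned,
    with its children restored by induction. *)
Lemma L_nil t : L [::] t = t.
Proof.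
elim/nd_sigma_elim: t => [|a t u Et Eu|x v C sC IH]; first exact: L_zero.
  by rewrite L_lin Et Eu.
rewrite {1}/L Lf_nd //= /opv_fun /= -map_comp.
rewrite (_ : psum _ _ _ = 0) ?subr0.
  by congr nd; rewrite -[RHS]map_id; apply/eq_in_map => c /IH.
transitivity (psum (@yz k g) (fun=> 0 *: (0 : T) + 0) (mixed (x :: v) (map Lf C))).
  apply: eq_psum => ts; rewrite scaler0 addr0 /nd2 [sg _]/(0 : W).
  by rewrite nd0; case: ifP.
by rewrite psumP scale0r add0r -[RHS](subrr (psum (@yz k g) (fun=> 0 : T) (mixed (x :: v) (map Lf C)))) -psumB; apply: eq_psum => ts; rewrite subr0.
Qed.

(** [yT (mixed w C)] is the brace [w{C}] on trees, with [L] in place of the missing unary node. For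
    the empty word it is the identity on single trees and [0] on other forests. *)
Definition yT (l : seq (g + T)) : T :=
  if trs l is [:: t] then L (lets l) t else nd (sg (lets l)) (trs l).

Definition lift_tree (x : g + T) : g + Z :=
  match x with inl a => inl a | inr t => inr (Lf t) end.

Lemma yTE l : yT l = yz (map lift_tree l).
Proof.
have E1 : lets (map lift_tree l) = lets l by elim: l => //= -[a|b] l -> //.
have E2 : trs (map lift_tree l) = map Lf (trs l) by elim: l {E1} => //= -[a|b] l -> //.
rewrite /yT /yz E1 E2; case: (trs l) => [|t [|u ts]] //.
have H s : [seq fs_val z [::] | z <- map Lf s] = s.
  by rewrite -map_comp -[RHS]map_id; apply: eq_map => c; apply: L_nil.
by rewrite H.
Qed.

Lemma lift_tree_mixed v C : map lift_tree (mixed v C) = mixed v (map Lf C).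
Proof. by rewrite /mixed map_cat -!map_comp. Qed.

Lemma psum_yT (F : seq T -> T) v C : psum yT F (mixed v C) = psum (@yz k g) F (mixed v (map Lf C)).
Proof.
rewrite -lift_tree_mixed psum_map; apply: eq_psum_f => l; exact: yTE.
Qed.

Lemma yT_inl : mlin inl yT.
Proof. by move=> p q a x y; rewrite !yTE !map_cat /=; apply: yz_inl. Qed.

Lemma yT_bracket p q x y :
  yT (p ++ [:: inl x, inl y & q]) - yT (p ++ [:: inl y, inl x & q]) = yT (p ++ inl (lieb x y) :: q).
Proof. by rewrite !yTE !map_cat /=; apply: yz_bracket. Qed.

Lemma yT_inr : mlin inr yT.
Proof. by move=> p q a x y; rewrite !yTE !map_cat /= linearP; apply: yz_inr. Qed.

Lemma yT_swap p q x y : yT (p ++ [:: inr x, inr y & q]) = yT (p ++ [:: inr y, inr x & q]).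
Proof. by rewrite !yTE !map_cat /=; apply: yz_swap. Qed.

Lemma yT_mixed w C : size C != 1%N -> yT (mixed w C) = nd (sg w) C.
Proof. by rewrite /yT trs_mixed lets_mixed; case: C => [|t [|u C]]. Qed.

Lemma yT_mixed1 w t : yT (mixed w [:: t]) = L w t.
Proof. by rewrite /yT trs_mixed lets_mixed. Qed.

Lemma yT_mlin w : mlin id (fun C => yT (mixed w C)).
Proof.
by move=> p q a x y; rewrite /mixed !map_cat /= !catA; apply: yT_inr.
Qed.

Lemma yT_sym2 w : sym2 (fun C => yT (mixed w C)).
Proof. by move=> p q x y; rewrite /mixed !map_cat /= !catA; apply: yT_swap. Qed.

Lemma yT1 t : yT [:: inr t] = t. Proof. exact: L_nil. Qed.

Lemma yT2 t u C : yT [:: inr t, inr u & map inr C] = 0.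
Proof. by rewrite -(map_cons inr) -(map_cons inr) -[map _ _]/(mixed [::] _) yT_mixed // nd0. Qed.

Lemma L_nd x v C w : size C != 1%N ->
  L w (nd (sg (x :: v)) C) =
  nd (sg (w ++ x :: v)) C - psum yT (nd2 (sg w)) (mixed (x :: v) C).
Proof.
move=> sC; rewrite /L Lf_nd //= /opv_fun psum_yT; congr (nd _ _ - _).
by rewrite -map_comp -[RHS]map_id; apply: eq_map => c; apply: L_nil.
Qed.

Lemma yT_split w C : yT (mixed w C) =
  (if C is [:: t] then L w t else 0) + (nd2 (sg w) C + if C is [::] then nd (sg w) [::] else 0).
Proof.
case: C => [|t [|u C]].
- by rewrite yT_mixed // /nd2 /= !add0r.
- by rewrite yT_mixed1 /nd2 /= !addr0.
by rewrite yT_mixed // /nd2 /= add0r addr0.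
Qed.

(** The list [mixed (x :: v) C] is nonempty, so it has no partition into zero blocks and exactly one
    into a single block. *)
Lemma psum_yT_split (F : seq T -> T) (G : T -> T) a x v C :
  (forall ts, F ts = (if ts is [:: t] then G t else 0)
     + (nd2 a ts + if ts is [::] then F [::] else 0)) ->
  psum yT F (mixed (x :: v) C) =
  G (yT (mixed (x :: v) C)) + psum yT (nd2 a) (mixed (x :: v) C).
Proof.
move=> E; rewrite (eq_psum _ _ E) !psumD; congr (_ + _).
  by rewrite {1}/mixed /= psum_one.
by rewrite (psum_nonnil yT (F [::])) /= addr0.
Qed.

(* Letting [v] and then [w] act amounts to letting [w ++ v] act. *)
Lemma yT_comp w v C :
  psum yT (fun ts => yT (mixed w ts)) (mixed v C) = yT (mixed (w ++ v) C).
Proof.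
have C0 w' C' : psum yT (fun ts => yT (mixed w' ts)) (map inr C') = yT (mixed w' C').
  by rewrite (psum_pure yT1 yT2) //; apply: yT_mlin.
(* For a forest other than a single tree this is the definition of [L], read through [L_nd]. *)
have C1 w' v' C' : size C' != 1%N ->
    psum yT (fun ts => yT (mixed w' ts)) (mixed v' C') = yT (mixed (w' ++ v') C').
  case: v' => [|x v'] sC; first by rewrite cats0; apply: C0.
  rewrite (psum_yT_split (G := L w') (a := sg w')) => [|ts]; last first.
    by rewrite yT_split; case: ts => [|t [|u ts]] //=; rewrite yT_mixed.
  by rewrite (yT_mixed _ sC) L_nd // subrK yT_mixed.
case: (eqVneq (size C) 1%N) => [|sC]; last exact: C1.
case: C => [|t [|u C]] // _; move: w v.
elim/nd_sigma_elim: t => [|a t u Et Eu|x u C sC IH] w v.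
- have ML := psum_mlin yT_inr (yT_mlin w).
  by rewrite /mixed (mlin0 (map inl v) [::] ML) (mlin0 (map inl (w ++ v)) [::] yT_inr).
- have ML := psum_mlin yT_inr (yT_mlin w).
  rewrite /mixed (ML (map inl v) [::]) (yT_inr (map inl (w ++ v)) [::]).
  by congr (_ *: _ + _); [apply: Et|apply: Eu].
set t := nd _ C.
pose H ts := psum yT (fun ts => yT (mixed w ts)) (mixed v ts).
(* Lists whose trees are among the children [C] of [t]: for these, [C1] or the induction hypothesis
   supplies the identity. *)
pose R (l : seq (g + T)) := exists u' C', l = mixed u' C' /\ {subset C' <= C}.
have R_Split l x' y' : Split l x' y' -> R l -> R x' /\ R y'.
  move=> S [u' [C' [E sub]]]; rewrite E in S.
  have [v1 [v2 [C1' [C2' [S' _ -> ->]]]]] := Split_mixed S.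
  have memS c : (c \in C') = (c \in C1') || (c \in C2').
    elim: S' => //= a l0 x1 y1 _ E'; rewrite !inE E'; first by rewrite orbA.
    by rewrite orbCA.
  split; [exists v1, C1'|exists v2, C2']; split=> // c Hc; apply: sub; rewrite memS Hc //.
  by rewrite orbT.
have fR l w' : R l -> psum yT (fun ts => yT (map inl w' ++ map inr ts)) l = yT (map inl w' ++ l).
  case=> u' [C' [-> sub]]; rewrite -[LHS]/(psum yT (fun ts => yT (mixed w' ts)) (mixed u' C')).
  have -> : map inl w' ++ mixed u' C' = mixed (w' ++ u') C' by rewrite /mixed map_cat catA.
  case: (eqVneq (size C') 1%N) sub => [|sC' _]; last exact: C1.
  by case: C' => [|c [|]] // _ sub; apply: IH; apply: sub; rewrite mem_head.
have RC : R (mixed (x :: u) C) by exists (x :: u), C; split=> // c.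
have := psum_comp yT1 yT2 R_Split fR v (yT_mlin w) RC.
have -> : map inl v ++ mixed (x :: u) C = mixed (v ++ x :: u) C by rewrite /mixed map_cat catA.
rewrite (C1 w (v ++ x :: u) C sC) => E.
have {E} : psum yT H (mixed (x :: u) C) = yT (mixed (w ++ v ++ x :: u) C) := E.
(* The terms with several blocks agree with those in [L_nd] for the word [w ++ v]. What remains is
   the one-block term [H [:: t]], which is the claim for [t]. *)
rewrite (psum_yT_split (G := fun t => H [:: t]) (a := sg (w ++ v))) => [|ts]; last first.
  case: ts => [|t1 [|t2 ts]]; first by rewrite /nd2 /= !add0r.
    by rewrite /nd2 /= !addr0.
  by rewrite add0r addr0 /H C1 // yT_mixed.
rewrite !(yT_mixed _ sC) -/t => E; rewrite yT_mixed1 /t L_nd // -catA -E addrK.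
by [].
Qed.

End UnaryTheory.

(** * Formal vector fields *)

Section FormalVectorFields.
Variables (k : fieldType) (E : lmodType k).

Definition mulsym (f : seq E -> E) := mlin id f /\ sym2 f.

Fact mulsym0 : mulsym (fun=> 0).
Proof. by split=> [p q a x y|p q x y] //; rewrite scaler0 addr0. Qed.

Fact mulsymL a f h : mulsym f -> mulsym h -> mulsym (fun x => a *: f x + h x).
Proof.
move=> [m1 s1] [m2 s2]; split=> [p q b x y|p q x y]; last by rewrite s1 s2.
by rewrite m1 m2 !scalerDr !scalerA [a * b]mulrC addrACA.
Qed.

Definition mulsym_pred : linpred (seq E) E := LinPred mulsym0 mulsymL.

(* A symmetric multilinear function on lists is a formal vector field on [E],
   given by its Taylor coefficients at the origin. *)
Definition vf : Type := funsub mulsym_pred.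
HB.instance Definition _ := GRing.Lmodule.on vf.
Implicit Types f h e : vf.

Definition vfv (f : vf) : seq E -> E := fs_val f.

Lemma vf_mlin f : mlin id (vfv f). Proof. exact: (fs_valP f).1. Qed.
Lemma vf_sym2 f : sym2 (vfv f). Proof. exact: (fs_valP f).2. Qed.

Lemma vfP f h : (forall C, vfv f C = vfv h C) -> f = h.
Proof. exact: funsubP. Qed.

Fact vf_mul_subproof f h : mulsym (ssum (fun x y => vfv f (vfv h x :: y))).
Proof.
split=> [p q a x y|p q x y]; rewrite !ssum_cat.
  rewrite -ssumP; apply: eq_ssum => p1 p2 /=; rewrite scalerDr addrACA -!ssumP.
  congr (_ + _); apply: eq_ssum => q1 q2.
    by rewrite (vf_mlin h) (vf_mlin f [::]).
  exact: (vf_mlin f (_ :: p2)).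
apply: eq_ssum => p1 p2 /=.
set A1 := ssum _ q; set A2 := ssum _ q; set A3 := ssum _ q; set A4 := ssum _ q.
set B1 := ssum _ q; set B4 := ssum _ q.
have -> : A1 = B1 by apply: eq_ssum => q1 q2; rewrite (vf_sym2 h).
have -> : A4 = B4 by apply: eq_ssum => q1 q2; apply: (vf_sym2 f (_ :: p2)).
by rewrite -!addrA (addrCA A2).
Qed.

(** The Taylor coefficients of the derivative of [f] along [h]. *)
Definition vf_mul f h : vf := @FunSub k _ E mulsym_pred _ (vf_mul_subproof f h).

Lemma vf_mulE f h C : vfv (vf_mul f h) C = ssum (fun x y => vfv f (vfv h x :: y)) C.
Proof. by []. Qed.

Lemma vfvL a f h C : vfv (a *: f + h) C = a *: vfv f C + vfv h C.
Proof. exact: fs_valL. Qed.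

Fact vf_mul_linl a f h e : vf_mul (a *: f + h) e = a *: vf_mul f e + vf_mul h e.
Proof.
apply: vfP => C; rewrite vfvL !vf_mulE -ssumP.
by apply: eq_ssum => x y; rewrite vfvL.
Qed.

Fact vf_mul_linr a f h e : vf_mul f (a *: h + e) = a *: vf_mul f h + vf_mul f e.
Proof.
apply: vfP => C; rewrite vfvL !vf_mulE -ssumP.
by apply: eq_ssum => x y; rewrite vfvL (vf_mlin f [::]).
Qed.

HB.instance Definition _ := hasBilinearProduct.Build k vf vf_mul_linl vf_mul_linr.

Lemma vf_prodE f h C : vfv (f ◁ h) C = ssum (fun x y => vfv f (vfv h x :: y)) C.
Proof. by []. Qed.

Lemma vfvB f h C : vfv (f - h) C = vfv f C - vfv h C.
Proof. exact: fs_valB. Qed.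

(** The associator is the second derivative of [f] in the directions [h] and [e]; its symmetry is
    right-symmetry. *)
Fact vf_assoc f h e C : vfv ((f ◁ h) ◁ e - f ◁ (h ◁ e)) C =
  ssum (fun x y => ssum (fun u v => vfv f [:: vfv h u, vfv e x & v]) y) C.
Proof.
rewrite vfvB !vf_prodE.
have -> : ssum (fun x y => vfv f (vfv (h ◁ e) x :: y)) C =
    ssum (fun x y => ssum (fun u v => vfv f (vfv h (vfv e x :: u) :: v)) y) C.
  rewrite (ssum_assoc (fun x u v => vfv f (vfv h (vfv e x :: u) :: v))).
  apply: eq_ssum => x y; rewrite vf_prodE.
  apply: (@ssum_lin _ _ _ _ (fun z => vfv f (z :: y))).
  by move=> a s t; apply: (vf_mlin f [::]).
rewrite -ssumB; apply: eq_ssum => x y; rewrite vf_prodE /=.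
by rewrite addrC addKr.
Qed.

Fact vf_right_symmetric f h e :
  (f ◁ h) ◁ e - f ◁ (h ◁ e) = (f ◁ e) ◁ h - f ◁ (e ◁ h).
Proof.
apply: vfP => C; rewrite !vf_assoc ssum_swap; apply: eq_ssum => x y.
by apply: eq_ssum => u v; apply: (vf_sym2 f [::]).
Qed.

HB.instance Definition _ := isPreLie.Build k vf vf_right_symmetric.

Definition ev (f : vf) : E := vfv f [::].

Lemma ev_mul f h : ev (f ◁ h) = vfv f [:: ev h]. Proof. by []. Qed.

Fact ev_linear : linear ev. Proof. by move=> a f h; apply: vfvL. Qed.

Fact cst_subproof t : mulsym (fun C => if C is [::] then t else 0).
Proof.
by split=> [[|c p] q a x y|[|c p] q x y] //=; rewrite scaler0 addr0.
Qed.

Definition cst t : vf := @FunSub k _ E mulsym_pred _ (cst_subproof t).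

Lemma cst_mul t h : cst t ◁ h = 0.
Proof.
apply: vfP => C; rewrite vf_prodE -[RHS](subrr (ssum (fun _ _ => 0 : E) C)) -ssumB.
by apply: eq_ssum => x y; rewrite subr0.
Qed.

Lemma mul_cst f t C : vfv (f ◁ cst t) C = vfv f (t :: C).
Proof.
rewrite vf_prodE ssumC -[RHS](ssum_nil_r (fun x => vfv f (t :: x))).
apply: eq_ssum => x [|c y] //=; exact: (mlin0 [::] x (vf_mlin f)).
Qed.

Lemma dersum0 (V : lmodType k) (h : vf) (F : seq vf -> V) C :
  (forall p q c, C = p ++ c :: q -> F (p ++ (c ◁ h) :: q) = 0) -> dersum h F C = 0.
Proof.
elim: C F => //= c C IH F FP; rewrite (FP [::] C c erefl) add0r.
by apply: IH => p q c' Ec; apply: (FP (c :: p)); rewrite Ec.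
Qed.

(** Constant fields have zero derivative, so the brace is an iterated derivative of [f]. The list is
    reversed because its head is the last direction of differentiation. *)
Lemma brace_cst f ts C : vfv (brace f (map cst ts)) C = vfv f (catrev ts C).
Proof.
elim: ts C => // t ts IH C. rewrite [map _ _]/=.
rewrite (brace_cons f) vfvB mul_cst IH.
rewrite dersum0 ?subr0 // => p q c Ec.
have -> : c ◁ cst t = 0.
  have : c \in map cst ts by rewrite Ec mem_cat mem_head orbT.
  by case/mapP => u _ ->; apply: cst_mul.
exact: mlin0 p q (@brace_mlin k vf f).
Qed.

(** With [h] moved to the front, the product with [h] vanishes at the origin, and so do the fields
    [c ◁ h] in the derivative terms, which are shorter braces of the same kind. *)
Lemma ev_brace0 f p h q : ev h = 0 -> ev (brace f (p ++ h :: q)) = 0.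
Proof.
move=> h0; have [n] := ubnP (size (p ++ q)); elim: n p h q h0 => // n IH p h q h0 lt_n.
have -> : brace f (p ++ h :: q) = brace f (h :: (p ++ q)).
  apply: sym2_perm; first exact: brace_sym2.
  by rewrite -[h :: q]cat1s perm_catCA.
rewrite brace_cons; have evB u v : ev (u - v) = ev u - ev v := vfvB u v [::].
rewrite evB ev_mul h0 (mlin0 [::] [::] (@vf_mlin _)).
rewrite (@dersum_linear _ _ _ _ ev _ _ _ ev_linear) dersum0 ?subr0 // => p' q' c E'.
apply: IH.
  by rewrite ev_mul h0 (mlin0 [::] [::] (@vf_mlin _)).
by move: lt_n; rewrite E' size_cat /= size_cat addnS.
Qed.

(** Each argument differs from the constant field with the same value by a field that vanishes at
    the origin, so [ev_brace0] reduces to [brace_cst]. *)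
Lemma ev_brace f hs : ev (brace f hs) = vfv f (map ev hs).
Proof.
have M := @brace_mlin k vf f.
have evD u v : ev (u + v) = ev u + ev v by rewrite -[u]scale1r ev_linear !scale1r.
have S hs' ts : ev (brace f (map cst ts ++ hs')) = ev (brace f (map cst ts ++ map cst (map ev hs'))).
  elim: hs' ts => // h hs' IH ts /=.
  have {1}-> : h = 1 *: (h - cst (ev h)) + cst (ev h) by rewrite scale1r subrK.
  have E0 : ev (brace f (map cst ts ++ (h - cst (ev h)) :: hs')) = 0.
    by apply: ev_brace0; rewrite /ev vfvB -/(ev _) subrr.
  rewrite M scale1r evD E0 add0r.
  by have := IH (rcons ts (ev h)); rewrite map_rcons !cat_rcons.
rewrite -[hs]/(map cst [::] ++ hs) S /= /ev brace_cst catrevE cats0.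
by apply: sym2_perm; [apply: vf_sym2|rewrite perm_rev].
Qed.

End FormalVectorFields.

(** * Words in a pre-Lie algebra and the Guin-Oudom identity *)

Section WordAction.
Variables (k : fieldType) (g : lieType k) (A : preLieType k) (i : {linear g -> lie_of A}).
Hypothesis iL : lie_morphism i.

(* The action of a nonempty word on the unit adjoined to [A]. *)
Definition one (w : seq g) : A :=
  if w is x :: w' then foldl (fun (a : A) y => a ◁ (i y : A)) (i x : A) w' else 0.

Lemma one_rcons x w y : one (rcons (x :: w) y) = one (x :: w) ◁ (i y : A).
Proof. by rewrite /= foldl_rcons. Qed.

Lemma iLin (a : k) x y : (i (a *: x + y) : A) = a *: (i x : A) + (i y : A).
Proof. exact: linearP. Qed.

Lemma act_lin (a : k) (u v : A) w :
  foldl (fun (a : A) y => a ◁ (i y : A)) (a *: u + v) w =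
  a *: foldl (fun (a : A) y => a ◁ (i y : A)) u w + foldl (fun (a : A) y => a ◁ (i y : A)) v w.
Proof. by elim: w u v => //= x w IH u v; rewrite bprod_linl IH. Qed.

Lemma act_sub (u v : A) w :
  foldl (fun (a : A) y => a ◁ (i y : A)) (u - v) w =
  foldl (fun (a : A) y => a ◁ (i y : A)) u w - foldl (fun (a : A) y => a ◁ (i y : A)) v w.
Proof. by rewrite addrC -scaleN1r act_lin scaleN1r addrC. Qed.

(** At the first letter the relation is [iL]. Further on it says that right multiplications make [A]
    a right module over [g], which is right-symmetry. *)
Lemma one_ucomp : ucomp one.
Proof.
split=> [[|c p] q a x y|[|c p] q x y] /=.
- by rewrite iLin act_lin.
- by rewrite !foldl_cat /= iLin bprod_linr act_lin.
- by rewrite -act_sub (iL x y).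
rewrite !foldl_cat /= -act_sub; congr foldl.
rewrite (iL x y) -[lieb _ _]/((i x : A) ◁ (i y : A) - (i y : A) ◁ (i x : A)).
set u := foldl _ _ _; rewrite bprodBr.
have /eqP := right_symmetric u (i x : A) (i y : A).
rewrite subr_eq => /eqP ->.
by rewrite [LHS](ACl ((1*4)*(3*2))) /= subrr add0r.
Qed.

(** As for [yT], the empty word acts as the identity on a single element and gives [0] on other
    lists. *)
Definition yA (l : seq (g + A)) : A :=
  if lets l is [::] then (if trs l is [:: b] then b else 0)
  else brace (one (lets l)) (trs l).

Lemma yA_mixed x w C : yA (mixed (x :: w) C) = brace (one (x :: w)) C.
Proof. by rewrite /yA lets_mixed trs_mixed. Qed.

Lemma yA_mixed0 C : yA (mixed [::] C) = if C is [:: b] then b else 0.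
Proof. by rewrite /yA lets_mixed trs_mixed. Qed.

Lemma yA1 b : yA [:: inr b] = b. Proof. by []. Qed.
Lemma yA2 b c C : yA [:: inr b, inr c & map inr C] = 0.
Proof. by rewrite -!map_cons -[map _ _]/(mixed [::] _) yA_mixed0. Qed.

Lemma yA_mlin w : mlin id (fun C => yA (mixed w C)).
Proof.
case: w => [|x w] p q a u v; last by rewrite !yA_mixed brace_mlin.
by rewrite !yA_mixed0; case: p => [|b [|c p]] /=; case: q => [|d q]; rewrite ?scaler0 ?addr0.
Qed.

(** Appending a letter multiplies the class of the word by it on the right, so this is
    [brace_prod]. *)
Lemma yA_letter w x C : yA (mixed (rcons w x) C) =
  ssum (fun u v => yA (mixed w (yA (mixed [:: x] u) :: v))) C.
Proof.
case: w => [|y w].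
  rewrite -(ssum_nil_r (fun u => yA (mixed [:: x] u))); apply: eq_ssum => u [|c v] /=;
  by rewrite ?yA_mixed0.
rewrite rcons_cons yA_mixed -rcons_cons one_rcons brace_prod.
by apply: eq_ssum => u v; rewrite !yA_mixed.
Qed.

(** Induction on [v] from its last letter. A single letter lies in one block and the other blocks
    are single elements, which is [yA_letter]; longer words follow from [psum_comp]. *)
Lemma yA_comp w v C :
  psum yA (fun ts => yA (mixed w ts)) (mixed v C) = yA (mixed (w ++ v) C).
Proof.
have C0 w' C' : psum yA (fun ts => yA (mixed w' ts)) (map inr C') = yA (mixed w' C').
  by rewrite (psum_pure yA1 yA2) //; apply: yA_mlin.
have C1 w' x C' : psum yA (fun ts => yA (mixed w' ts)) (mixed [:: x] C') = yA (mixed (rcons w' x) C').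
  rewrite yA_letter /= psum_cons ssum_map; apply: eq_ssum => u y.
  by rewrite (psum_pure yA1 yA2) //; apply: (mlin_cons _ (yA_mlin w')).
elim/last_ind: v C w => [|v x IH] C w; first by rewrite cats0; apply: C0.
rewrite -rcons_cat -C1.
pose R (l : seq (g + A)) := exists u' C', l = mixed u' C' /\ (size u' <= 1)%N.
have R_Split l x' y' : Split l x' y' -> R l -> R x' /\ R y'.
  move=> S [u' [C' [E su]]]; rewrite E in S.
  have [v1 [v2 [C1' [C2' [S' Sv -> ->]]]]] := Split_mixed S.
  have sz := Split_size Sv; split; [exists v1, C1'|exists v2, C2']; split=> //; lia.
have fR l w' : R l -> psum yA (fun ts => yA (map inl w' ++ map inr ts)) l = yA (map inl w' ++ l).
  case=> [[|y [|z u']] [C' [-> //= _]]]; first exact: C0.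
  rewrite -[LHS]/(psum yA (fun ts => yA (mixed w' ts)) (mixed [:: y] C')) C1.
  by rewrite -cats1 /mixed map_cat -catA.
have RC : R (mixed [:: x] C) by exists [:: x], C.
have := psum_comp yA1 yA2 R_Split fR v (yA_mlin w) RC.
have -> : map inl v ++ mixed [:: x] C = mixed (rcons v x) C.
  by rewrite -cats1 /mixed map_cat -catA.
move=> <-; apply: eq_psum => ts; exact: IH.
Qed.

End WordAction.

Lemma one_morph (k : fieldType) (g : lieType k) (A B : preLieType k)
    (i : {linear g -> lie_of A}) (j : {linear g -> lie_of B}) (F : {linear A -> B}) :
  (forall x y, F (x ◁ y) = F x ◁ F y) -> (forall x, F (i x) = j x) ->
  forall w, F (one i w) = one j w.
Proof.
move=> FM Fi [|x w]; first exact: raddf0.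
elim/last_ind: w => [|w y IH]; first exact: Fi.
by rewrite -!rcons_cons !one_rcons FM IH Fi.
Qed.

(** * The map from trees to the enveloping algebra and its left inverse *)

Section Psi.
Variables (k : fieldType) (char0 : [pchar k] =i pred0) (g : lieType k).
Notation W := (sym_plus g).
Notation T := (schur (RT_ne1 k) W).
Notation sg := (@sigma k g).
Notation E := (vf T).

Definition field_of_word (w : seq g) : E :=
  @FunSub k _ T (@mulsym_pred k T) (fun C => yT char0 (mixed w C))
    (conj (yT_mlin char0 w) (yT_sym2 char0 w)).

(** This is [yT_comp] for a single letter: one block contains it, and the others are single
    trees. *)
Lemma field_rcons w x : field_of_word (rcons w x) = field_of_word w ◁ field_of_word [:: x].
Proof.
apply: vfP => C; rewrite vf_prodE /= -cats1 -yT_comp /= psum_cons ssum_map.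
apply: eq_ssum => u v.
by rewrite (psum_pure (@yT1 k char0 g) (@yT2 k char0 g)) //; apply: (mlin_cons _ (yT_mlin char0 w)).
Qed.

Fact letter_linear : linear (fun x : g => field_of_word [:: x] : lie_of E).
Proof.
move=> a x y; apply: vfP => C; rewrite [RHS]vfvL.
exact: (yT_inl char0 [::]).
Qed.

Definition letter_field : {linear g -> lie_of E} :=
  HB.pack (fun x : g => field_of_word [:: x] : lie_of E)
    (GRing.isLinear.Build k g (lie_of E) *:%R _ letter_linear).

Lemma letter_field_lie : lie_morphism letter_field.
Proof.
move=> x y; change (field_of_word [:: lieb x y] =
  field_of_word [:: x] ◁ field_of_word [:: y] - field_of_word [:: y] ◁ field_of_word [:: x]).
rewrite -!field_rcons /=; apply: vfP => C; rewrite vfvB.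
by have := yT_bracket char0 [::] (map inr C) x y.
Qed.

Definition kappa : {linear UPreLie g -> E} := UPreLie_lift letter_field_lie.

Lemma kappaM x y : kappa (x ◁ y) = kappa x ◁ kappa y.
Proof. by have [H _ _] := UPreLie_universal letter_field_lie. Qed.

Lemma kappa_unit x : kappa (UPreLie_unit g x) = letter_field x.
Proof. by have [_ H _] := UPreLie_universal letter_field_lie. Qed.

Lemma one_letter x w : one letter_field (x :: w) = field_of_word (x :: w).
Proof.
elim/last_ind: w => [//|w y IH].
by rewrite -!rcons_cons one_rcons IH field_rcons.
Qed.

Notation oneU := (one (UPreLie_unit g)).

(** The identification of S(g) with the augmentation ideal of U(g), followed by the action on the
    adjoined unit. *)
Definition word_class : {linear W -> UPreLie g} := hat (one_ucomp (@UPreLie_unit_lie k g)).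

Lemma word_class_sigma x v : word_class (sg (x :: v)) = oneU (x :: v).
Proof. exact: (hat_sigma char0). Qed.

Definition Psi_op (a : W) (bs : seq (UPreLie g)) : UPreLie g := brace (word_class a) bs.

Definition Psi : {linear T -> UPreLie g} := fold Psi_op.

Lemma Psi_op_lin bs c a a' : Psi_op (c *: a + a') bs = c *: Psi_op a bs + Psi_op a' bs.
Proof. by rewrite /Psi_op linearP brace_lin. Qed.

Lemma Psi_op_mlin a : mlin id (Psi_op a). Proof. exact: brace_mlin. Qed.
Lemma Psi_op_sym2 a : sym2 (Psi_op a). Proof. exact: brace_sym2. Qed.

Lemma Psi_nd x v C : size C != 1%N ->
  Psi (nd (sg (x :: v)) C) = brace (oneU (x :: v)) (map Psi C).
Proof.
move=> sC; rewrite /Psi fold_nd //; first by rewrite /Psi_op word_class_sigma.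
- exact: Psi_op_lin.
- exact: Psi_op_mlin.
- exact: Psi_op_sym2.
Qed.

(** [kappa] carries the braces that make up [Psi t] to braces of vector fields, which at the origin
    become values of [yT] by [ev_brace]. As no vertex is unary, [yT] rebuilds the node. *)
Lemma PsiK t : ev (kappa (Psi t)) = t.
Proof.
elim/(nd_sigma_elim char0): t => [|a t u Et Eu|x v C sC IH].
- by rewrite !raddf0.
- by rewrite !linearP ev_linear Et Eu.
rewrite Psi_nd // (brace_morph kappaM) (one_morph kappaM kappa_unit) one_letter ev_brace.
rewrite -!map_comp -[RHS](yT_mixed char0 (x :: v) sC).
congr (yT _ (mixed _ _)); rewrite -[RHS]map_id.
by apply/eq_in_map => c /IH.
Qed.

End Psi.

(** * Surjectivity *)

Section SumClosure.
Variables (k : fieldType) (X : Type) (V : lmodType k) (Q : V -> Prop).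
Hypothesis QD : forall u v, Q u -> Q v -> Q (u + v).

Lemma ssum_in (H : seq X -> seq X -> V) l :
  (forall x y, Split l x y -> Q (H x y)) -> Q (ssum H l).
Proof.
elim: l H => [|a l IH] H QH /=; first by apply: QH; constructor.
by apply: QD; apply: IH => x y S; apply: QH; constructor.
Qed.

Lemma psum_in (T : eqType) (f : seq X -> T) (P : T -> Prop) (R : seq X -> Prop) F l :
  (forall l x y, Split l x y -> R l -> R x /\ R y) ->
  (forall l, R l -> P (f l)) ->
  R l -> (forall ts, (forall t, t \in ts -> P t) -> Q (F ts)) -> Q (psum f F l).
Proof.
move=> R_Split Pf; elim/psum_ind: l F => [|a l IH] F Rl QF; first by apply: QF.
rewrite psum_cons; apply: ssum_in => x y S.
have [Rx Ry] := R_Split _ _ _ (Split_l a S) Rl.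
apply: IH => // [|ts Pts]; first by rewrite (Split_size S) leq_addl.
by apply: QF => t; rewrite inE => /orP[/eqP ->|/Pts //]; apply: Pf.
Qed.

End SumClosure.

Section Surjectivity.
Variables (k : fieldType) (char0 : [pchar k] =i pred0) (g : lieType k).
Notation W := (sym_plus g).
Notation T := (schur (RT_ne1 k) W).
Notation sg := (@sigma k g).
Notation U := (UPreLie g).
Notation oneU := (one (UPreLie_unit g)).
Notation Psi := (Psi g).

Definition Im (a : U) := exists t, Psi t = a.

Lemma Im0 : Im 0. Proof. by exists 0; rewrite raddf0. Qed.
Lemma ImL c a b : Im a -> Im b -> Im (c *: a + b).
Proof. by move=> [t <-] [u <-]; exists (c *: t + u); rewrite linearP. Qed.
Lemma ImD a b : Im a -> Im b -> Im (a + b).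
Proof. by move=> Ha Hb; rewrite -[a]scale1r; apply: ImL. Qed.
Lemma ImB a b : Im a -> Im b -> Im (a - b).
Proof. by move=> Ha Hb; rewrite addrC -scaleN1r; apply: ImL. Qed.

Lemma Im_seq (bs : seq U) : (forall b, b \in bs -> Im b) -> exists ts, bs = map Psi ts.
Proof.
elim: bs => [|b bs IH] H; first by exists [::].
have [t <-] : Im b by apply: H; apply: mem_head.
have [|ts ->] := IH; first by move=> c Hc; apply: H; rewrite inE Hc orbT.
by exists (t :: ts).
Qed.

Lemma Im_brace_neq1 x v bs : size bs != 1%N -> (forall b, b \in bs -> Im b) ->
  Im (brace (oneU (x :: v)) bs).
Proof.
move=> sb /Im_seq[ts E]; exists (nd (sg (x :: v)) ts); rewrite E Psi_nd //.
by move: sb; rewrite E size_map.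
Qed.

(* A unary node is rewritten with [yA_comp], whose other terms have either more
   children at the root or a smaller unary node. *)
Lemma Im_brace1 x v t : Im (brace (oneU (x :: v)) [:: Psi t]).
Proof.
elim/(nd_sigma_elim char0): t x v => [|a t u Et Eu|y u C sC IH] x v.
- rewrite raddf0 (mlin0 [::] [::] (@brace_mlin k U (oneU (x :: v)))); exact: Im0.
- rewrite linearP (@brace_mlin k U (oneU (x :: v)) [::] [::]).
  by apply: ImL; [apply: Et|apply: Eu].
pose F1 b := brace (oneU (x :: v)) [:: b].
pose F2 (ts : seq U) := if (size ts == 1)%N then 0 else brace (oneU (x :: v)) ts.
have E := yA_comp (UPreLie_unit g) (x :: v) (y :: u) (map Psi C).
have EF ts : yA (UPreLie_unit g) (mixed (x :: v) ts) =
    (if ts is [:: b] then F1 b else 0) + F2 ts.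
  rewrite yA_mixed /F2.
  by case: ts => [|b [|c ts]] /=; rewrite ?add0r ?addr0.
rewrite (eq_psum _ _ EF) in E.
rewrite psumD {1}/mixed /= psum_one -/(mixed (y :: u) (map Psi C)) !yA_mixed in E.
rewrite (Psi_nd char0 _ _ sC).
have -> : brace (oneU (x :: v)) [:: brace (oneU (y :: u)) (map Psi C)] =
    brace (oneU ((x :: v) ++ y :: u)) (map Psi C)
    - psum (yA (UPreLie_unit g)) F2 (mixed (y :: u) (map Psi C)).
  by rewrite -E addrK.
apply: ImB.
  apply: Im_brace_neq1; first by rewrite size_map.
  by move=> b /mapP[c _ ->]; exists c.
pose R (l : seq (g + U)) := exists u' C', l = mixed u' C' /\ {subset C' <= map Psi C}.
apply: (psum_in ImD (P := Im) (R := R)).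
- move=> l x' y' S [u' [C' [El sub]]]; rewrite El in S.
  have [v1 [v2 [C1' [C2' [S' _ -> ->]]]]] := Split_mixed S.
  have memS c : (c \in C') = (c \in C1') || (c \in C2').
    elim: S' => //= a l0 x1 y1 _ E'; rewrite !inE E'; first by rewrite orbA.
    by rewrite orbCA.
  split; [exists v1, C1'|exists v2, C2']; split=> // c Hc; apply: sub; rewrite memS Hc //.
  by rewrite orbT.
- move=> _ [[|z u'] [C' [-> sub]]].
    rewrite yA_mixed0; case: C' sub => [|b [|c C']] sub; try exact: Im0.
    have /mapP[c _ ->] : b \in map Psi C by apply: sub; rewrite mem_head.
    by exists c.
  rewrite yA_mixed; case: (eqVneq (size C') 1%N) => [|sC'].
    case: C' sub => [|b [|]] // sub _.
    have /mapP[c Hc ->] : b \in map Psi C by apply: sub; rewrite mem_head.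
    exact: IH.
  apply: Im_brace_neq1 => // b /sub /mapP[c _ ->]; by exists c.
- by exists (y :: u), (map Psi C); split=> // c.
move=> ts Pts; rewrite /F2; case: ifPn => [_|st]; first exact: Im0.
exact: Im_brace_neq1.
Qed.

Lemma Im_brace x v bs : (forall b, b \in bs -> Im b) -> Im (brace (oneU (x :: v)) bs).
Proof.
case: (eqVneq (size bs) 1%N) => [|sb]; last exact: Im_brace_neq1.
case: bs => [|b [|]] // _ H.
have [t <-] : Im b by apply: H; rewrite mem_head.
exact: Im_brace1.
Qed.

(** The recursion for [brace] expresses the product by a brace with one more child and by products
    inside the children, to which induction on the tree applies. *)
Lemma Im_mul a b : Im a -> Im b -> Im (a ◁ b).
Proof.
move=> [t <-] Hb.
elim/(nd_sigma_elim char0): t => [|c t u Et Eu|x v C sC IH].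
- rewrite raddf0 bprod0l; exact: Im0.
- by rewrite linearP bprod_linl; apply: ImL.
rewrite (Psi_nd char0 _ _ sC).
have -> : brace (oneU (x :: v)) (map Psi C) ◁ b =
    brace (oneU (x :: v)) (b :: map Psi C) + dersum b (brace (oneU (x :: v))) (map Psi C).
  by rewrite brace_cons subrK.
apply: ImD.
  by apply: Im_brace => c; rewrite inE => /orP[/eqP -> //|/mapP[d _ ->]]; exists d.
(* [p] collects the children already passed, which only need to lie in the image; those in [q] must
   be children of the tree, for the induction hypothesis. *)
have H p q : (forall c, c \in p -> Im c) -> (forall c, c \in q -> c \in map Psi C) ->
    Im (dersum b (fun D => brace (oneU (x :: v)) (p ++ D)) q).
  elim: q p => [|c q IHq] p Hp Hq /=; first exact: Im0.
  have /mapP[d Hd Ed] : c \in map Psi C by apply: Hq; rewrite mem_head.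
  apply: ImD.
    apply: Im_brace => e; rewrite mem_cat inE => /orP[/Hp //|/orP[/eqP ->|He]].
      by rewrite Ed; apply: IH.
    have /mapP[d' _ ->] : e \in map Psi C by apply: Hq; rewrite inE He orbT.
    by exists d'.
  have := IHq (rcons p c); rewrite (_ : (fun D => _ (rcons p c ++ D)) =
     (fun D => brace (oneU (x :: v)) (p ++ c :: D))); last first.
    by apply: functional_extensionality_dep => D; rewrite cat_rcons.
  apply.
    by move=> e; rewrite mem_rcons inE => /orP[/eqP ->|/Hp //]; rewrite Ed; exists d.
  by move=> e He; apply: Hq; rewrite inE He orbT.
exact: (H [::]).
Qed.

Lemma Im_unit x : Im (UPreLie_unit g x).
Proof. by exists (nd (sg [:: x]) [::]); rewrite Psi_nd. Qed.

Lemma Psi_surj a : Im a.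
Proof.
elim/alg_pi_surj: a; elim/alg_pi_surj; elim/freeg_elim => [|c m D IH].
  by rewrite !raddf0; apply: Im0.
rewrite !linearP; apply: ImL => // {D IH}.
elim: m => [x|s IHs t IHt]; first exact: Im_unit.
have -> : fgen k (Node s t) = (fgen k s : free_na k g) ◁ (fgen k t : free_na k g).
  by rewrite [RHS]/(free_na_mul _ _) /free_na_mul !fglift_gen.
by rewrite !alg_piM; apply: Im_mul.
Qed.

End Surjectivity.

(** * Naturality *)

Lemma evl_morph (k : fieldType) (W W' Z Z' : lmodType k)
    (op : W -> seq Z -> Z) (op' : W' -> seq Z' -> Z') (f : W -> W') (F : Z -> Z')
    (I : finType) (p : I -> option I) (lab : I -> W) n x :
  F 0 = 0 -> (forall a bs, F (op a bs) = op' (f a) (map F bs)) ->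
  F (evl op p lab n x) = evl op' p (fun y => f (lab y)) n x.
Proof.
move=> F0 Fop; elim: n x => //= n IH x; rewrite Fop -map_comp.
by congr op'; apply: eq_map => y; apply: IH.
Qed.

Lemma sym_plus_map_pure (k : fieldType) (g h : lmodType k) (f : {linear g -> h}) n v :
  sym_plus_map f (sym_pi g n (tpure v)) = sym_pi h n (tpure [ffun i => f (v i)]).
Proof.
apply: etrans (dsum_map_dinj _ _) _; rewrite -tpow_map_pure; congr dinj.
exact: quot_lin_pi.
Qed.

Section Naturality.
Variables (k : fieldType) (g h : lieType k) (f : {linear g -> h}).
Hypothesis fL : lie_morphism f.
Notation F := (UPreLie_map fL).

Lemma UPreLie_mapM x y : F (x ◁ y) = F x ◁ F y.
Proof. by have [H _ _] := UPreLie_universal (UPreLie_map_subproof fL). Qed.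

Lemma UPreLie_map_unit x : F (UPreLie_unit g x) = UPreLie_unit h (f x).
Proof. by have [_ H _] := UPreLie_universal (UPreLie_map_subproof fL). Qed.

Lemma UPreLie_map_one w : F (one (UPreLie_unit g) w) = one (UPreLie_unit h) (map f w).
Proof.
case: w => [|x w]; first exact: raddf0.
elim/last_ind: w => [|w y IH]; first exact: UPreLie_map_unit.
rewrite -rcons_cons map_rcons [map _ _]/= !one_rcons UPreLie_mapM.
by rewrite IH UPreLie_map_unit.
Qed.

(** [hat] averages over rearrangements, a recipe that commutes with applying [f] to the letters. *)
Lemma word_class_natural a :
  F (word_class g a) = word_class h (sym_plus_map f a).
Proof.
elim/dsum_elim: a => [|x y Ex Ey|n]; first by rewrite !raddf0.
  rewrite (raddfD (word_class g)) (raddfD (sym_plus_map f)) (raddfD (word_class h)).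
  by rewrite (raddfD F); congr (_ + _).
elim/quot_pi_surj => t; rewrite -[dinj _]/(sym_pi g n t).
elim/tpow_elim: t => [|a t u Et Eu|v]; first by rewrite !raddf0.
  by rewrite !linearP Et Eu.
rewrite sym_plus_map_pure /word_class !hat_pure /wavg linearZ; congr (_ *: _).
rewrite raddf_sum; apply: eq_bigr => s _.
apply: etrans (UPreLie_map_one _) _; rewrite -map_comp; congr one.
by apply: eq_map => i; rewrite /= ffunE.
Qed.

Definition Psi_map : {linear schur (RT_ne1 k) (sym_plus g) -> UPreLie h} :=
  (Psi h \o schur_map (RT_ne1 k) (sym_plus_map f))%FUN.
Definition map_Psi : {linear schur (RT_ne1 k) (sym_plus g) -> UPreLie h} :=
  (F \o Psi g)%FUN.

Lemma Psi_cls (g' : lieType k) Q : Psi g' (cls Q) = eval (@Psi_op k g') Q.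
Proof. exact: (fold_cls (@Psi_op_lin k g') (@Psi_op_mlin k g') (@Psi_op_sym2 k g') Q). Qed.

Lemma Psi_natural_cls (Q : dtree (sym_plus g)) : Psi_map (cls Q) = map_Psi (cls Q).
Proof.
have Es := schur_map_cls (sym_plus_map f) Q.
set Q' := DTree _ _ in Es.
have El : Psi_map (cls Q) = eval (@Psi_op k h) Q' :=
  etrans (congr1 (Psi h) Es) (Psi_cls Q').
have Er : map_Psi (cls Q) = F (eval (@Psi_op k g) Q) := congr1 F (Psi_cls Q).
have F0 : F 0 = 0 by exact: raddf0.
have Fop a bs : F (Psi_op a bs) = Psi_op (sym_plus_map f a) (map F bs).
  by rewrite /Psi_op (brace_morph UPreLie_mapM) word_class_natural.
have E : F (eval (@Psi_op k g) Q) = eval (@Psi_op k h) Q' :=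
  evl_morph (@par k _ Q) (@dt_lab k _ Q) #|dt_vert Q| (root_of (dt_tree Q)) F0 Fop.
exact: etrans El (esym (etrans Er E)).
Qed.

Lemma Psi_natural : Psi_map =1 map_Psi.
Proof. exact: (cls_linear_eq Psi_natural_cls). Qed.

End Naturality.

(** * The inverse isomorphism *)

Section Inverse.
Variables (k : fieldType) (char0 : [pchar k] =i pred0) (g : lieType k).

Definition Phi_fun (a : UPreLie g) : schur (RT_ne1 k) (sym_plus g) := ev (kappa char0 g a).

Fact Phi_linear : linear Phi_fun.
Proof. by move=> c a b; rewrite /Phi_fun linearP ev_linear. Qed.

Definition Phi : {linear UPreLie g -> schur (RT_ne1 k) (sym_plus g)} :=
  HB.pack Phi_fun (GRing.isLinear.Build k _ _ *:%R Phi_fun Phi_linear).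

Lemma PhiK : cancel Phi (Psi g).
Proof.
by move=> a; have [t <-] := Psi_surj char0 a; rewrite [Phi _](PsiK char0).
Qed.

End Inverse.

Theorem theorem1 (k : fieldType) (char0 : [pchar k] =i pred0) :
  exists phi : forall g : lieType k,
      {linear UPreLie g -> schur (RT_ne1 k) (sym_plus g)},
    (forall g : lieType k, bijective (phi g)) /\
    (forall (g h : lieType k) (f : {linear g -> h}) (fL : lie_morphism f)
            (x : UPreLie g),
        phi h (UPreLie_map fL x)
        = schur_map (RT_ne1 k) (sym_plus_map f) (phi g x)).
Proof.
exists (Phi char0); split=> [g|g h f fL x].
  by exists (Psi g); [apply: PhiK|apply: PsiK].
(* Naturality of [Psi], evaluated at [Phi x]; applying [Phi] for [h] to it gives naturality of the
   inverse. *)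
have E : Psi h (schur_map (RT_ne1 k) (sym_plus_map f) (Phi char0 g x)) = UPreLie_map fL x :=
  etrans (Psi_natural fL _) (congr1 (UPreLie_map fL) (PhiK char0 x)).
exact: etrans (congr1 (Phi char0 h) (esym E)) (PsiK char0 _).
Qed.
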